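(* Let $X$ be a Banach sequence lattice such that $\varphi_X(n)\varphi_{X'}(n)\le Cn$ for all $n$ (some constant $C$) and $\|\mathrm{id}:X_n\to\ell_2^n\|\le\frac1{\sqrt n}\|\mathrm{id}:X_n\to\ell_1^n\|$ for all $n$. Then for every index set $J$ with $\Lambda_T\subset J$, $$\lim_{n\to\infty}\frac{K(B_{X_n},J)}{\sqrt{\frac{\log n}{n}}}=1.$$
   Context: A Banach sequence lattice $X$ over $\mathbb{N}$ is a Banach space of complex sequences such that $|y|\le|x|$ coordinatewise and $x\in X$ imply $y\in X$, $\|y\|\le\|x\|$. $X_n$ is $\mathbb{C}^n$ with $\|z\|=\|\sum_{k\le n}|z_k|e_k\|_X$. $X'$ is the Köthe dual (sequences $x$ with $\|x\|_{X'}=\sup\{\sum|x_ky_k|:\|y\|_X\le1\}<\infty$). $\varphi_X(n)=\|\sum_{j=1}^ne_j\|_X$. $\Lambda_T$ is the set of all finitely supported multi-indices with entries in $\{0,1\}$; an index set is a subset of $\mathbb{N}_0^{(\mathbb{N})}$. For an index set $J$, $H_\infty^J(B_{X_n})$ is the space of bounded holomorphic $f$ on the open unit ball $B_{X_n}$ with Taylor coefficients $c_\alpha(f)=\partial^\alpha f(0)/\alpha!=0$ for $\alpha\notin J$, and the Bohr radius is $K(B_{X_n},J)=\sup\{r\in(0,1):\sup_{z\in rB_{X_n}}\sum_{\alpha\in J}|c_\alpha(f)z^\alpha|\le\sup_{B_{X_n}}|f|\ \forall f\in H_\infty^J(B_{X_n})\}$. *)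

(* Defs.v *)
From mathcomp Require Import all_boot all_order all_algebra.
From mathcomp Require Import all_classical all_reals all_analysis.
From mathcomp Require Import complex.
Import Order.TTheory GRing.Theory Num.Theory.
Import numFieldNormedType.Exports.

Set Implicit Arguments.
Unset Strict Implicit.
Unset Printing Implicit Defensive.

Local Open Scope ring_scope.
Local Open Scope classical_set_scope.

Section BohrDefs.
Variable R : realType.

Definition cabs (z : R[i]) : R := ComplexField.Normc.normc z.

Definition cseq := nat -> R[i].

Definition unit_vec (k : nat) : cseq := fun j => if j == k then 1 else 0.

Definition is_subspace (X : set cseq) : Prop :=
  [/\ X (fun _ => 0),
      (forall x y, X x -> X y -> X (fun k => x k + y k)) &
      (forall (a : R[i]) x, X x -> X (fun k => a * x k))].

Definition is_norm_on (X : set cseq) (nrm : cseq -> R) : Prop :=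
  [/\ (forall x, X x -> 0 <= nrm x),
      (forall x, X x -> nrm x = 0 -> x = (fun _ => 0)),
      (forall (a : R[i]) x, X x -> nrm (fun k => a * x k) = cabs a * nrm x) &
      (forall x y, X x -> X y -> nrm (fun k => x k + y k) <= nrm x + nrm y)].

Definition is_complete (X : set cseq) (nrm : cseq -> R) : Prop :=
  forall u : nat -> cseq, (forall m, X (u m)) ->
    (forall eps : R, 0 < eps -> exists N, forall p q, (N <= p)%N -> (N <= q)%N ->
        nrm (fun k => u p k - u q k) < eps) ->
    exists2 y, X y & forall eps : R, 0 < eps -> exists N, forall p, (N <= p)%N ->
        nrm (fun k => u p k - y k) < eps.

Definition is_lattice (X : set cseq) (nrm : cseq -> R) : Prop :=
  forall x y, X x -> (forall k, cabs (y k) <= cabs (x k)) -> X y /\ nrm y <= nrm x.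

Definition banach_seq_lattice (X : set cseq) (nrm : cseq -> R) : Prop :=
  [/\ is_subspace X, is_norm_on X nrm, is_complete X nrm, is_lattice X nrm &
      forall k, X (unit_vec k)].

Definition ind (n : nat) : cseq := fun k => if (k < n)%N then 1 else 0.

Definition phiX (nrm : cseq -> R) (n : nat) : R := nrm (ind n).

(* Koethe dual norm (extended-real valued: +oo if x \notin X') *)
Definition kothe_norm (X : set cseq) (nrm : cseq -> R) (x : cseq) : \bar R :=
  ereal_sup [set (\esum_(k in [set: nat]) (cabs (x k * y k))%:E)%E
            | y in [set y | X y /\ nrm y <= 1]].

Definition phiXd (X : set cseq) (nrm : cseq -> R) (n : nat) : \bar R :=
  kothe_norm X nrm (ind n).

Definition extend n (z : 'rV[R[i]]_n) : cseq :=
  fun k => if insub k is Some i then z 0 i else 0.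

Definition nrmXn (nrm : cseq -> R) n (z : 'rV[R[i]]_n) : R :=
  nrm (fun k => real_complex R (cabs (extend z k))).

Unset Implicit Arguments.
Definition BX (nrm : cseq -> R) (n : nat) : set 'rV[R[i]]_n := [set z | nrmXn nrm z < 1].

Definition rBX (nrm : cseq -> R) (n : nat) (r : R) : set 'rV[R[i]]_n :=
  [set real_complex R r *: z | z in BX nrm n].

Definition id_norm2 (nrm : cseq -> R) n : R :=
  sup [set Num.sqrt (\sum_(i < n) cabs (z 0 i) ^+ 2)
      | z in [set z : 'rV[R[i]]_n | nrmXn nrm z <= 1]].

Definition id_norm1 (nrm : cseq -> R) n : R :=
  sup [set \sum_(i < n) cabs (z 0 i)
      | z in [set z : 'rV[R[i]]_n | nrmXn nrm z <= 1]].

Set Implicit Arguments.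
Definition finsupp (a : nat -> nat) : Prop := exists N, forall k, (N <= k)%N -> a k = 0%N.

Definition index_set (J : set (nat -> nat)) : Prop := J `<=` finsupp.

Definition LambdaT : set (nat -> nat) := [set a | finsupp a /\ forall k, (a k <= 1)%N].

Definition mi_ext n (a : {ffun 'I_n -> nat}) : nat -> nat :=
  fun k => if insub k is Some i then a i else 0%N.

Definition monomial n (z : 'rV[R[i]]_n) (a : {ffun 'I_n -> nat}) : R[i] :=
  \prod_(i < n) z 0 i ^+ a i.

(* C^n as a normed R[i]-module (the library's sup norm on row vectors; all
   norms on C^n are equivalent, so the notion of differentiability does not
   depend on this choice) *)
Definition cvec n : normedModType R[i] := 'rV[R[i]]_n.

(* complex partial derivative d/dz_i (the space 'rV[R[i]]_n is a normed
   R[i]-module, so derivatives are complex derivatives) *)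
Definition partial n (i : 'I_n) (f : 'rV[R[i]]_n -> R[i]^o) : 'rV[R[i]]_n -> R[i]^o :=
  fun z => derive f (z : cvec n) (delta_mx 0 i : cvec n).

Definition dpartial n (a : {ffun 'I_n -> nat}) (f : 'rV[R[i]]_n -> R[i]^o)
  : 'rV[R[i]]_n -> R[i]^o :=
  foldr (fun i g => iter (a i) (partial i) g) f (enum 'I_n).

Definition taylor_coef n (f : 'rV[R[i]]_n -> R[i]^o) (a : {ffun 'I_n -> nat}) : R[i] :=
  dpartial a f 0 / (\prod_(i < n) (a i)`!)%:R.

Definition holomorphic_on n (U : set 'rV[R[i]]_n) (f : 'rV[R[i]]_n -> R[i]^o) : Prop :=
  forall z, U z -> differentiable f (z : cvec n).

Definition HinfJ (nrm : cseq -> R) (J : set (nat -> nat)) n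
  (f : 'rV[R[i]]_n -> R[i]^o) : Prop :=
  [/\ holomorphic_on (BX nrm n) f,
      (exists M : R, forall z, BX nrm n z -> cabs (f z) <= M) &
      (forall a, ~ J (mi_ext a) -> taylor_coef f a = 0)].

Definition supB (nrm : cseq -> R) n (f : 'rV[R[i]]_n -> R[i]^o) : \bar R :=
  ereal_sup [set (cabs (f z))%:E | z in BX nrm n].

Definition majorant (J : set (nat -> nat)) n (f : 'rV[R[i]]_n -> R[i]^o)
  (z : 'rV[R[i]]_n) : \bar R :=
  (\esum_(a in [set a : {ffun 'I_n -> nat} | J (mi_ext a)])
     (cabs (taylor_coef f a * monomial z a))%:E)%E.

Definition bohr_radius (nrm : cseq -> R) (J : set (nat -> nat)) n : R :=
  sup [set r : R | 0 < r < 1 /\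
         forall f, HinfJ nrm J f ->
           (ereal_sup [set majorant J f z | z in rBX nrm n r] <= supB nrm f)%E].

End BohrDefs.

Arguments BX {R} nrm n _.
Arguments rBX {R} nrm n r _.
Arguments id_norm2 {R} nrm n.
Arguments id_norm1 {R} nrm n.

(* Main.v *)
(* Lower bound. Covering w in the ball by a polydisc contained in the ball turns f into a function
   u |-> f (w u) on the unit polydisc, so it suffices to treat polynomials on the polydisc. Cauchy's
   formula, obtained from Goursat's theorem with averages over roots of unity in place of contour
   integrals, gives the approximation by Taylor polynomials. By Wiener's inequality only m-homogeneous
   P need be considered. Writing P (z + w) as a polynomial in w of fixed degree k with coefficients
   homogeneous in z, a Bohnenblust-Hille inequality in w (Blei) and hypercontractivity in z yield
   sum |c_a| <= sqrt(N_(m-k)) n^((k-1)/2) poly(m) 4^(m/(k+1)), with N_d the number of monomials of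
   degree d. Taking k = 1 for m <= ln n / 16 and a large fixed k otherwise, this is summable against
   ((1 - e) sqrt(ln n / n))^m.

   Upper bound. With S the norm of id : X_n -> l_1^n, the hypothesis on id : X_n -> l_2^n puts the
   ball of X_n inside S/n times the l_2 ball of radius sqrt n; the equality case of Cauchy-Schwarz
   puts the constant vector S/n in its closure. A random sum of the monomials z_A, |A| = m ~ ln n, is
   at most of order m sqrt n (e n / m)^(m/2) on that l_2 ball, whereas its majorant at r times the
   constant vector is binom(n,m) r^m. *)
Require Import Defs.
From mathcomp Require Import all_boot all_order all_algebra.
From mathcomp Require Import all_classical all_reals all_analysis.
From mathcomp Require Import complex.
From mathcomp Require Import ring lra zify.
Import Order.TTheory GRing.Theory Num.Theory.
Import numFieldNormedType.Exports.
Local Open Scope ring_scope.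
Local Open Scope classical_set_scope.

Set Implicit Arguments.
Unset Strict Implicit.
Unset Printing Implicit Defensive.

(** The constant 1 leaves no room for a loss C^m in degree m, so powers of n have to cancel exactly.
    Lower bound: put rho = sqrt(ln n / n). For large n one has sqrt(N_d) rho^d <= e sqrt n, and this
    sqrt n is what n^((k-1)/2) rho^k = (ln n)^(k/2) / sqrt n takes back. The remaining 4^(m/(k+1))
    loses against (1 - e)^m once k is large; since k then stays fixed, Blei's inequality may be used
    with crude constants. The power of ln n is polynomial in m only if m is at least of order ln n;
    below that, a loss C^m is a small power of n, and the case k = 1 has a spare factor rho to pay
    for it. All polynomial bounds are independent of the degree of truncation, so they pass from
    Taylor polynomials to functions. Upper bound: put V = (e n / m)^m. For m ~ ln n the binomial
    coefficient is V up to a factor of order m, and sqrt V rho^m is at least sqrt n / e. This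
    cancels the sqrt n of the random bound, and (1 + e)^m is left against a polynomial in m. *)

Section ComplexModulus.
Variable R : realType.
Implicit Types z w : R[i].

Lemma cabs_ge0 z : 0 <= cabs z.
Proof. by case: z => a b; rewrite /cabs /= sqrtr_ge0. Qed.

Lemma cabs0 : cabs (0 : R[i]) = 0.
Proof. exact: ComplexField.Normc.normc0. Qed.

Lemma cabs1 : cabs (1 : R[i]) = 1.
Proof. exact: ComplexField.Normc.normc1. Qed.

Lemma cabs_eq0 z : (cabs z == 0) = (z == 0).
Proof.
apply/eqP/eqP => [|->]; last exact: cabs0.
exact: ComplexField.Normc.eq0_normc.
Qed.

Lemma cabs_gt0 z : (0 < cabs z) = (z != 0).
Proof. by rewrite lt_def cabs_ge0 andbT cabs_eq0. Qed.

Lemma cabsM z w : cabs (z * w) = cabs z * cabs w.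
Proof. exact: ComplexField.Normc.normcM. Qed.

Lemma cabsV z : cabs z^-1 = (cabs z)^-1.
Proof. exact: ComplexField.Normc.normcV. Qed.

Lemma cabsN z : cabs (- z) = cabs z.
Proof. exact: (@normcN R z). Qed.

Lemma cabsX z k : cabs (z ^+ k) = cabs z ^+ k.
Proof. by elim: k => [|k IH]; rewrite ?expr0 ?cabs1 // !exprS cabsM IH. Qed.

Lemma cabsD z w : cabs (z + w) <= cabs z + cabs w.
Proof. exact: (@le_normcD R z w). Qed.

Lemma cabsB z w : cabs (z - w) <= cabs z + cabs w.
Proof. by rewrite (le_trans (cabsD _ _))// cabsN. Qed.

Lemma cabsBC z w : cabs (z - w) = cabs (w - z).
Proof. by rewrite -cabsN opprB. Qed.

Lemma cabsB_ge z w : cabs z - cabs w <= cabs (z - w).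
Proof. by rewrite lerBlDr (le_trans _ (cabsD _ _))// subrK. Qed.

Lemma cabs_tri u z w : cabs (z - w) <= cabs (z - u) + cabs (u - w).
Proof. by rewrite (le_trans _ (cabsD _ _))// subrKA. Qed.

Lemma cabs_sum I (r : seq I) (P : pred I) (F : I -> R[i]) :
  cabs (\sum_(i <- r | P i) F i) <= \sum_(i <- r | P i) cabs (F i).
Proof.
elim/big_rec2: _ => [|i x y _ le]; first by rewrite cabs0.
by rewrite (le_trans (cabsD _ _))// lerD2l.
Qed.

Lemma cabs_prod I (r : seq I) (P : pred I) (F : I -> R[i]) :
  cabs (\prod_(i <- r | P i) F i) = \prod_(i <- r | P i) cabs (F i).
Proof. by elim/big_rec2: _ => [|i x y _ <-]; rewrite ?cabs1 ?cabsM. Qed.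

Lemma cabsR (x : R) : cabs (real_complex R x) = `|x|.
Proof. by rewrite /cabs /= expr0n addr0 sqrtr_sqr. Qed.

Lemma cabs_nat k : cabs (k%:R : R[i]) = k%:R.
Proof. by rewrite -(rmorph_nat (real_complex R)) cabsR ger0_norm. Qed.

Lemma sqr_cabs z : cabs z ^+ 2 = complex.Re z ^+ 2 + complex.Im z ^+ 2.
Proof. by case: z => a b /=; rewrite /cabs /= sqr_sqrtr// addr_ge0// sqr_ge0. Qed.

Lemma Re_le_cabs z : `|complex.Re z| <= cabs z.
Proof.
rewrite -(@ler_pXn2r _ 2)// ?nnegrE ?cabs_ge0//.
by rewrite sqr_cabs real_normK ?num_real// lerDl sqr_ge0.
Qed.

Lemma Im_le_cabs z : `|complex.Im z| <= cabs z.
Proof.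
rewrite -(@ler_pXn2r _ 2)// ?nnegrE ?cabs_ge0//.
by rewrite sqr_cabs real_normK ?num_real// lerDr sqr_ge0.
Qed.

Lemma cabs_le_ReIm z : cabs z <= `|complex.Re z| + `|complex.Im z|.
Proof.
rewrite -(@ler_pXn2r _ 2)// ?nnegrE ?cabs_ge0 ?addr_ge0//.
rewrite sqr_cabs sqrrD !real_normK ?num_real// addrAC lerDl mulrn_wge0//.

Qed.

Lemma cabs_conj z : cabs (conjc z) = cabs z.
Proof. by case: z => a b; rewrite /cabs /= sqrrN. Qed.

Lemma mul_conjc z : z * conjc z = real_complex R (cabs z ^+ 2).
Proof.
rewrite sqr_cabs; case: z => a b /=.
by apply/eqP; rewrite eq_complex /=; apply/andP; split; apply/eqP; ring.
Qed.

(** Rotation of z onto the positive axis. Such phases, put into free variables of a polynomial, turn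
    a sum of moduli into one of its values. *)
Lemma cabs_phase z : exists2 u, cabs u = 1 & u * z = real_complex R (cabs z).
Proof.
have [->|z0] := eqVneq z 0; first by exists 1; rewrite ?cabs1// mulr0 cabs0.
exists (conjc z / real_complex R (cabs z)).
  rewrite cabsM cabs_conj cabsV cabsR ger0_norm ?cabs_ge0// divff//.
  by rewrite cabs_eq0.
have c0 : real_complex R (cabs z) != 0.
  by rewrite (inj_eq (@complexI R)) cabs_eq0.
by rewrite mulrAC (mulrC _ z) mul_conjc rmorphXn expr2 mulfK.
Qed.

(** Completeness of C, inherited from R through real and imaginary parts; it supplies the
    derivatives of limits in [limit_cdiff]. *)
Lemma cauchy_seq_lim (u : nat -> R[i]) :
  (forall e : R, 0 < e -> exists N, forall p q, (N <= p)%N -> (N <= q)%N ->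
     cabs (u p - u q) < e) ->
  exists l, forall e : R, 0 < e -> exists N, forall p, (N <= p)%N -> cabs (u p - l) < e.
Proof.
move=> cu.
have real_case (v : nat -> R) :
    (forall e : R, 0 < e -> exists N, forall p q, (N <= p)%N -> (N <= q)%N ->
      `|v p - v q| < e) ->
    exists l, forall e : R, 0 < e -> exists N, forall p, (N <= p)%N -> `|v p - l| < e.
  move=> cv; have /cvg_ex [l vl] : cvgn v.
    apply: cauchy_cvg; apply/cauchy_ballP => e e0.
    have [N HN] := cv e e0.
    exists ((v @` [set n | (N <= n)%N]), (v @` [set n | (N <= n)%N])).
      by split; exists N => // n /= Hn; exists n.
    by move=> [_ _] [/= [p Hp <-] [q Hq <-]]; apply: HN.
  exists l => e e0; move/cvgrPdist_lt/(_ e e0): vl => [N _ HN].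
  by exists N => p Hp; rewrite distrC; apply: HN.
have [e e0|x hx] := real_case (fun n => complex.Re (u n)).
  have [N HN] := cu e e0; exists N => p q Hp Hq.
  by rewrite (le_lt_trans _ (HN p q Hp Hq))// (le_trans _ (Re_le_cabs _))// raddfB.
have [e e0|y hy] := real_case (fun n => complex.Im (u n)).
  have [N HN] := cu e e0; exists N => p q Hp Hq.
  by rewrite (le_lt_trans _ (HN p q Hp Hq))// (le_trans _ (Im_le_cabs _))// raddfB.
exists (Complex x y) => e e0.
have e2 : 0 < e / 2 by rewrite divr_gt0.
have [N1 H1] := hx _ e2; have [N2 H2] := hy _ e2.
exists (maxn N1 N2) => p; rewrite geq_max => /andP[p1 p2].
rewrite (le_lt_trans (cabs_le_ReIm _))// [e]splitr ltrD//.
  by move: (H1 p p1); case: (u p) => a b.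
by move: (H2 p p2); case: (u p) => a b.
Qed.

End ComplexModulus.

Lemma nat_large (R : realType) (x : R) :
  exists N0, forall N, (N0 <= N)%N -> x < N%:R.
Proof.
exists (Num.truncn x).+1 => N HN.
by rewrite (lt_le_trans (truncnS_gt x))// ler_nat.
Qed.

(** * Roots of unity and their power sums *)

Section RootsOfUnity.
Variable R : realType.

Definition om (N : nat) : R[i] := Complex (cos (2 * pi / N%:R)) (sin (2 * pi / N%:R)).

Lemma cabs_cis (x : R) : cabs (Complex (cos x) (sin x)) = 1.
Proof. by rewrite /cabs /= cos2Dsin2 sqrtr1. Qed.

Lemma omX N j : om N ^+ j =
  Complex (cos (2 * pi / N%:R *+ j)) (sin (2 * pi / N%:R *+ j)).
Proof.
elim: j => [|j IH]; first by rewrite !mulr0n cos0 sin0.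
rewrite exprS IH /om; move: (2 * pi / N%:R) => a; rewrite mulrSr cosD sinD.
move: (cos a) (sin a) (cos (a *+ j)) (sin (a *+ j)) => c s c' s'.
by apply/eqP; rewrite eq_complex /=; apply/andP; split; apply/eqP; ring.
Qed.

Lemma cabs_om N : cabs (om N) = 1.
Proof. exact: cabs_cis. Qed.

Lemma om_neq0 N : om N != 0.
Proof. by rewrite -cabs_eq0 cabs_om oner_eq0. Qed.

Lemma om_N N : (0 < N)%N -> om N ^+ N = 1.
Proof.
move=> N0; rewrite omX -[_ *+ N]mulr_natr divfK ?pnatr_eq0 -?lt0n//.
by rewrite mulr_natl cos2pi sin2pi.
Qed.

(** With x = pi j / N in (0, pi), cos (2x) = 1 would force sin x = 0. *)
Lemma om_neq1 N j : (0 < j < N)%N -> om N ^+ j != 1.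
Proof.
move=> /andP[j0 jN]; rewrite omX; apply/eqP => -[c1 _].
have N0 : (0 < N%:R :> R) by rewrite ltr0n (leq_ltn_trans _ jN).
pose x : R := pi / N%:R *+ j.
have xE : 2 * pi / N%:R *+ j = x *+ 2 by rewrite /x mulrnAC -mulrA mulr_natl.
have s0 : 0 < sin x.
  apply: sin_gt0_pi; rewrite /x -mulr_natr.
  have p0 := pi_gt0 R.
  have j0' : (0 < j%:R :> R) by rewrite ltr0n.
  rewrite mulr_gt0 ?divr_gt0//=.
  by rewrite mulrAC ltr_pdivrMr// ltr_pM2l// ltr_nat.
have := c1; rewrite xE mulr2n cosD => cc.
have := cos2Dsin2 x; rewrite !expr2 => ss.
have : sin x * sin x = 0 by lra.
by move/eqP; rewrite mulf_eq0 orbb gt_eqF.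
Qed.

(** Discrete orthogonality, from the geometric sum of ratio om^a. It stands in for the vanishing of
    contour integrals of powers, at the price of aliasing: every multiple of N survives, not only a
    = 0. *)
Lemma sum_om N a : (0 < N)%N ->
  \sum_(j < N) om N ^+ (a * j) = if (N %| a)%N then N%:R else 0.
Proof.
move=> N0; under eq_bigr do rewrite exprM.
case: ifPn => [/dvdnP[q ->]|nd].
  under eq_bigr do rewrite mulnC exprM om_N// !expr1n.
  by rewrite sumr_const card_ord.
have an1 : om N ^+ a != 1.
  rewrite (divn_eq a N) exprD mulnC exprM om_N// expr1n mul1r om_neq1//.
  by rewrite ltn_mod N0 andbT lt0n; apply: contra nd.
apply: (mulfI (_ : om N ^+ a - 1 != 0)); first by rewrite subr_eq0.
have := subrX1 (om N ^+ a) N; rewrite -exprM mulnC exprM om_N// expr1n subrr.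
by move=> <-; rewrite mulr0.
Qed.

(** Neighbouring sample points on a circle become arbitrarily close; [cauchy_formula_uniform] needs
    this where a sum over them telescopes. *)
Lemma om_near1 (e : R) : 0 < e -> exists N0, forall N, (N0 <= N)%N -> cabs (om N - 1) < e.
Proof.
move=> e0; have e2 : 0 < e / 2 by rewrite divr_gt0.
have near0 (f : R -> R) : {for 0, continuous f} ->
    exists N0, forall N, (N0 <= N)%N -> `|f (2 * pi / N%:R) - f 0| < e / 2.
  move=> /cvgrPdist_lt/(_ _ e2)[d /= d0 Hd].
  have [N0 HN0] := nat_large (2 * pi / d).
  exists N0 => N NN0; rewrite distrC; apply: Hd => /=.
  have p0 : 0 < 2 * pi :> R by rewrite mulr_gt0// pi_gt0.
  have N0' : 0 < N%:R :> R by rewrite (lt_trans _ (HN0 _ NN0))// divr_gt0.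
  rewrite sub0r normrN ger0_norm ?divr_ge0 ?ltW//.
  by rewrite ltr_pdivrMr// [ltRHS]mulrC -ltr_pdivrMr// HN0.
have [N1 H1] := near0 cos (@continuous_cos R 0).
have [N2 H2] := near0 sin (@continuous_sin R 0).
exists (maxn N1 N2) => N; rewrite geq_max => /andP[h1 h2].
rewrite (le_lt_trans (cabs_le_ReIm _))// [e]splitr ltrD//=.
  by have := H1 N h1; rewrite cos0.
by have := H2 N h2; rewrite sin0 !subr0.
Qed.

End RootsOfUnity.

Lemma eqW (R : realType) (x y : R) : x = y -> x <= y.
Proof. by move=> ->. Qed.

#[global] Arguments cabs : simpl never.

(** * Bisection, mean value inequality and primitives along lines *)

Section ComplexAnalysis.
Variable R : realType.
Local Notation "x %:C" := (real_complex R x) : ring_scope.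
Local Notation C := R[i].

(** Dyadic subdivision of the unit square, a square being given by its lower left corner and its
    level. Goursat's theorem and the compactness argument of [unif_diff] are both instances. *)
Lemma bisection (Bad : R -> R -> nat -> Prop) :
  Bad 0 0 0%N ->
  (forall x y n, Bad x y n -> exists i j : bool,
     Bad (x + i%:R * 2^-1 ^+ n.+1) (y + j%:R * 2^-1 ^+ n.+1) n.+1) ->
  exists x0 y0, forall n, exists x y,
    [/\ Bad x y n, x <= x0 <= x + 2^-1 ^+ n, y <= y0 <= y + 2^-1 ^+ n &
        (0 <= x /\ x + 2^-1 ^+ n <= 1) /\ (0 <= y /\ y + 2^-1 ^+ n <= 1)].
Proof.
move=> B0 BS.
have /choice [nxt nxtP] : forall p : nat * (R * R), exists ij : bool * bool,
    Bad p.2.1 p.2.2 p.1 -> Bad (p.2.1 + ij.1%:R * 2^-1 ^+ p.1.+1)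
                              (p.2.2 + ij.2%:R * 2^-1 ^+ p.1.+1) p.1.+1.
  move=> [n [x y]] /=; have [/BS[i [j B]]|nB] := pselect (Bad x y n).
    by exists (i, j).
  by exists (true, true).
pose s := fix s n : R * R := if n is m.+1 then
   ((s m).1 + (nxt (m, s m)).1%:R * 2^-1 ^+ n, (s m).2 + (nxt (m, s m)).2%:R * 2^-1 ^+ n)
   else (0, 0).
have Bs n : Bad (s n).1 (s n).2 n.
  by elim: n => [//|n IH] /=; apply: (nxtP (n, s n)).
(* In each coordinate the left ends increase and the right ends decrease, so the supremum of the
   left ends lies in all the intervals. *)
have main (u : nat -> R) (b : nat -> bool) : u 0%N = 0 ->
    (forall n, u n.+1 = u n + (b n)%:R * 2^-1 ^+ n.+1) ->
    exists x0, forall n, [/\ u n <= x0 <= u n + 2^-1 ^+ n, 0 <= u n & u n + 2^-1 ^+ n <= 1].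
  move=> u0 uS.
  have h0 n : 0 < 2^-1 ^+ n :> R by rewrite exprn_gt0// invr_gt0.
  have hS n : 2^-1 ^+ n = 2^-1 ^+ n.+1 + 2^-1 ^+ n.+1 :> R.
    by rewrite exprS; set t := _ ^+ n; lra.
  have up n : u n <= u n.+1.
    by rewrite uS lerDl mulr_ge0// ltW.
  have dn n : u n.+1 + 2^-1 ^+ n.+1 <= u n + 2^-1 ^+ n.
    rewrite uS (hS n); have := h0 n.+1; case: (b n) => /=; lra.
  have upm m n : (m <= n)%N -> u m <= u n.
    by apply: (homo_leq (@lexx _ _) (fun _ _ _ => @le_trans _ _ _ _ _) up).
  have dnm m n : (m <= n)%N -> u n + 2^-1 ^+ n <= u m + 2^-1 ^+ m.
    move: m n; apply: (@homo_leq _ (fun n => u n + 2^-1 ^+ n) (fun a b => b <= a)) => //.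
    by move=> a c d h1 h2; apply: le_trans h1.
  have cross m n : u m <= u n + 2^-1 ^+ n.
    have [mn|/ltnW nm] := leqP m n.
      by rewrite (le_trans (upm _ _ mn))// lerDl ltW.
    by rewrite (le_trans _ (dnm _ _ nm))// lerDl ltW.
  exists (sup (range u)) => n; split.
  - apply/andP; split.
      apply: ub_le_sup; last by exists n.
      by exists (u 0%N + 2^-1 ^+ 0) => _ [m _ <-]; apply: cross.
    apply: ge_sup; first by exists (u 0%N); exists 0%N.
    by move=> _ [m _ <-]; apply: cross.
  - by rewrite -u0 upm.
  - by have := dnm 0%N n (leq0n n); rewrite u0 expr0 add0r.
have [x0 Hx] := main (fun n => (s n).1) (fun n => (nxt (n, s n)).1) erefl (fun=> erefl).
have [y0 Hy] := main (fun n => (s n).2) (fun n => (nxt (n, s n)).2) erefl (fun=> erefl).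
exists x0, y0 => n; exists (s n).1, (s n).2.
by have [? ? ?] := Hx n; have [? ? ?] := Hy n; split.
Qed.

Lemma half_pow_lt (e : R) : 0 < e -> exists n, 2^-1 ^+ n < e.
Proof.
move=> e0; have [N HN] := nat_large e^-1; exists N.
rewrite exprVn -[ltRHS]invrK ltf_pV2 ?posrE ?exprn_gt0 ?invr_gt0//.
by rewrite (lt_le_trans (HN N (leqnn N)))// -natrX ler_nat ltnW// ltn_expl.
Qed.

(** Written with a real e and without a quotient: h = 0 needs no exception, and the norm of [R[i]],
    which has values in [R[i]], is avoided. *)
Definition cdiff (g : C -> C) (z d : C) := forall e : R, 0 < e ->
  exists2 dl : R, 0 < dl & forall h, cabs h < dl ->
    cabs (g (z + h) - g z - d * h) <= e * cabs h.

Definition rcdiff (g : R -> C) (t : R) (d : C) := forall e : R, 0 < e ->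
  exists2 dl : R, 0 < dl & forall h : R, `|h| < dl ->
    cabs (g (t + h) - g t - d * h%:C) <= e * `|h|.

Lemma real_derive (u : R -> R) (x d : R) :
  (forall e : R, 0 < e -> exists2 dl : R, 0 < dl & forall h : R, `|h| < dl ->
    `|u (x + h) - u x - d * h| <= e * `|h|) ->
  is_derive x (1 : R) u d.
Proof.
move=> H.
have cv : (fun h : R => h^-1 *: ((u \o shift x) (h *: (1 : R)) - u x)) @ 0^' --> d.
  apply/cvgrPdist_le => e e0; have [dl dl0 Hd] := H e e0.
  near=> h.
  have h0 : h != 0 by near: h; exact: nbhs_dnbhs_neq.
  have hd : `|h| < dl by near: h; apply: dnbhs0_lt.
  have hp : 0 < `|h| by rewrite normr_gt0.
  rewrite /= distrC -(ler_pM2r hp).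
  rewrite -normrM /GRing.scale /= mulr1 mulrBl mulrAC mulVf// mul1r.
  by have := Hd h hd; rewrite [h + x]addrC.
split; last by apply/cvg_lim.
by apply/cvg_ex; exists d.
Unshelve. all: by end_near.
Qed.

(** The mean value theorem fails for complex values and is applied to real and imaginary parts
    separately; this costs the factor 2. *)
Lemma rcdiff_mvt (g d : R -> C) (c : C) (e : R) :
  (forall t, 0 <= t <= 1 -> rcdiff g t (d t)) ->
  (forall t, 0 <= t <= 1 -> cabs (d t - c) <= e) ->
  cabs (g 1 - g 0 - c) <= 2 * e.
Proof.
move=> Hd Hc.
have part (p : C -> R) : (forall z w, p (z - w) = p z - p w) ->
    (forall z (x : R), p (z * x%:C) = p z * x) -> (forall z, `|p z| <= cabs z) ->
    `|p (g 1) - p (g 0) - p c| <= e.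
  move=> pB pM pC.
  have der (t : R) : 0 <= t <= 1 -> is_derive t (1 : R) (fun t => p (g t)) (p (d t)).
    move=> t01; apply: real_derive => e' e'0; have [dl dl0 Hdl] := Hd t t01 e' e'0.
    by exists dl => // h /Hdl; apply: le_trans; rewrite -pM -!pB.
  have wc : {within `[0, 1], continuous (fun t => p (g t))}.
    by apply: derivable_within_continuous => t; rewrite in_itv => /der[].
  have dd (t : R) : t \in `]0, 1[%R -> is_derive t (1 : R) (fun t => p (g t)) (p (d t)).
    by move=> /subset_itv_oo_cc; rewrite in_itv => /der.
  have [t] := MVT_segment ler01 dd wc.
  rewrite in_itv /= => t01; rewrite subr0 mulr1 => ->.
  by rewrite -pB (le_trans (pC _))// Hc.
rewrite (le_trans (cabs_le_ReIm _))// mulr_natl mulr2n lerD//.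
  have := part (@complex.Re R); rewrite !raddfB; apply.
  - by move=> z w; rewrite raddfB.
  - by move=> [a b] x; rewrite /= mulr0 subr0.
  - exact: Re_le_cabs.
have := part (@complex.Im R); rewrite !raddfB; apply.
- by move=> z w; rewrite raddfB.
- by move=> [a b] x; rewrite /= mulr0 add0r.
- exact: Im_le_cabs.
Qed.

(** Primitive of u in the only form that Goursat's argument uses: where u is within e of an affine
    function, the increment of U is close to the exact integral of that function. The 2 comes from
    treating real and imaginary parts separately. *)
Definition primitive_on (B : R) (u U : R -> C) := forall (a b : R) (c d : C) (e : R),
  `|a| < B -> `|b| < B ->
  (forall s, 0 <= s <= 1 ->
     cabs (u (a + s * (b - a)) - (c + d * (a + s * (b - a))%:C)) <= e) ->
  cabs (U b - U a - c * (b - a)%:C - d * ((b ^+ 2 - a ^+ 2) / 2)%:C) <= 2 * e * `|b - a|.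

Definition ccontinuous (u : R -> C) := forall (x e : R), 0 < e ->
  exists2 dl : R, 0 < dl & forall y, `|y - x| < dl -> cabs (u y - u x) < e.

Lemma real_primitive (B : R) (u : R -> R) : 0 < B -> continuous u ->
  exists U : R -> R, forall x, `|x| < B -> is_derive x (1 : R) U (u x).
Proof.
move=> B0 cu.
have iu : lebesgue_measure.-integrable `[- B, B] (EFin \o u).
  apply: continuous_compact_integrable; first exact: segment_compact.
  exact: continuous_subspaceT.
exists (fun x => \int[lebesgue_measure]_(t in `[- B, x]) u t)%R => x.
rewrite ltr_norml => /andP[x1 x2].
have [//|d1 d2] := continuous_FTC1 x2 iu _ (cu x).
by apply: DeriveDef; [exact: d1 | rewrite -derive1E; exact: d2].
Qed.

(** The fundamental theorem of calculus gives primitives of the real and imaginary parts.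
    Subtracting the primitive of the affine function leaves a function [V] whose increment the mean
    value theorem evaluates. *)
Lemma primitive_exists (B : R) (u : R -> C) : 0 < B -> ccontinuous u ->
  exists U, primitive_on B u U.
Proof.
move=> B0 cu.
have part (p : C -> R) : (forall z w, p (z - w) = p z - p w) ->
    (forall z (x : R), p (z * x%:C) = p z * x) -> (forall z, `|p z| <= cabs z) ->
  exists U : R -> R, forall (a b : R) (c d : C) (e : R),
  `|a| < B -> `|b| < B ->
  (forall s, 0 <= s <= 1 ->
     cabs (u (a + s * (b - a)) - (c + d * (a + s * (b - a))%:C)) <= e) ->
  `|U b - U a - p c * (b - a) - p d * ((b ^+ 2 - a ^+ 2) / 2)| <= e * `|b - a|.
  move=> pB pM pC.
  have pD z w : p (z + w) = p z + p w.
    have := pB (z + w) w; rewrite addrK => ->; by rewrite subrK.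
  have cpu : continuous (fun t => p (u t)).
    move=> x; apply/cvgrPdist_lt => e e0; have [dl dl0 Hd] := cu x e e0.
    exists dl => // y /=; rewrite distrC => /Hd; apply: le_lt_trans.
    by rewrite distrC -pB.
  have [U HU] := real_primitive B0 cpu.
  exists U => a b c d e.
  wlog ab : a b / a <= b => [hw|] ha hb H.
    have [|/ltW] := leP a b; first by move=> ab; apply: hw.
    move=> ba.
    have H' s : 0 <= s <= 1 ->
        cabs (u (b + s * (a - b)) - (c + d * (b + s * (a - b))%:C)) <= e.
      move=> /andP[s0 s1]; have := H (1 - s); rewrite subr_ge0 s1 lerBlDr lerDl s0 => /(_ isT).
      have -> : a + (1 - s) * (b - a) = b + s * (a - b) by ring.
      by [].
    have := hw b a ba hb ha H' => h; rewrite (distrC b a); apply: le_trans h.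
    by apply/eqW; rewrite -[LHS]normrN; congr `|_|; ring.
  pose V (t : R) : R := U t - (p c * t + p d * (t ^+ 2 / 2)).
  have dV (t : R) : t \in `[a, b]%R -> is_derive t (1 : R) V (p (u t) - (p c + p d * t)).
    rewrite in_itv /= => /andP[at_ tb].
    have tB : `|t| < B.
      move: ha hb; rewrite !ltr_norml => /andP[h1 _] /andP[_ h2].
      by rewrite (lt_le_trans h1)//= (le_lt_trans tb).
    have dU := HU t tB; rewrite /V.
    apply: is_derive_eq.
    rewrite /GRing.scale /=. by field.
  have wc : {within `[a, b], continuous V}.
    by apply: derivable_within_continuous => t /dV[].
  have dd (t : R) : t \in `]a, b[%R -> is_derive t (1 : R) V (p (u t) - (p c + p d * t)).
    by move=> /subset_itv_oo_cc /dV.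
  have [t] := MVT_segment ab dd wc.
  rewrite in_itv /= => /andP[at_ tb] VE.
  have -> : U b - U a - p c * (b - a) - p d * ((b ^+ 2 - a ^+ 2) / 2) = V b - V a.
    by rewrite /V; ring.
  rewrite VE normrM ler_wpM2r//.
  have [ab0|ab0] := eqVneq a b.
    have ta : t = a by apply/le_anti; rewrite at_ ab0 tb.
    have := H 0; rewrite lexx ler01 mul0r addr0 => /(_ isT).
    rewrite ta; apply: le_trans; apply: le_trans (pC _).
    by rewrite pB pD pM.
  have ba0 : b - a != 0 by rewrite subr_eq0 eq_sym.
  have ltab : a < b by rewrite lt_neqAle ab0.
  have := H ((t - a) / (b - a)).
  rewrite divfK// divr_ge0 ?subr_ge0// ler_pdivrMr ?subr_gt0// mul1r lerD2r tb => /(_ isT).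
  have -> : a + (t - a) = t by rewrite addrC subrK.
  apply: le_trans; apply: le_trans (pC _).
  by rewrite pB pD pM.
have [|//||U1 H1] := part (@complex.Re R).
- by move=> z w; rewrite raddfB.
- by move=> [a b] x; rewrite /= mulr0 subr0.
- exact: Re_le_cabs.
have [|//||U2 H2] := part (@complex.Im R).
- by move=> z w; rewrite raddfB.
- by move=> [a b] x; rewrite /= mulr0 add0r.
- exact: Im_le_cabs.
exists (fun x => Complex (U1 x) (U2 x)) => a b c d e ha hb H.
rewrite (le_trans (cabs_le_ReIm _))// -mulrA mulr_natl mulr2n lerD//.
  apply: le_trans (H1 a b c d e ha hb H); apply/eqW; congr `|_|.
  by case: c d {H} => [c1 c2] [d1 d2] /=; ring.
apply: le_trans (H2 a b c d e ha hb H); apply/eqW; congr `|_|.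
by case: c d {H} => [c1 c2] [d1 d2] /=; ring.
Qed.

End ComplexAnalysis.

(** * Goursat's theorem and primitives on a disc *)

Section Goursat.
Variable R : realType.
Local Notation "x %:C" := (real_complex R x) : ring_scope.
Local Notation C := R[i].

Definition iC : C := Complex 0 1.
Local Notation Ic := iC.

Lemma ComplexE (x y : R) : Complex x y = x%:C + Ic * y%:C.
Proof.
rewrite /iC; apply/eqP; rewrite eq_complex /=.
by apply/andP; split; apply/eqP; ring.
Qed.

Lemma cabs_i : cabs Ic = 1.
Proof. by rewrite /cabs /= expr0n expr1n add0r sqrtr1. Qed.

Lemma primitive_seg (B : R) (u U : R -> C) (x a : R) (c d : C) (e : R) :
  primitive_on B u U -> `|x| < B -> `|x + a| < B ->
  (forall s, 0 <= s <= 1 -> cabs (u (x + s * a) - (c + d * (x + s * a)%:C)) <= e) ->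
  cabs (U (x + a) - U x - (c * a%:C + d * (((x + a) ^+ 2 - x ^+ 2) / 2)%:C)) <= 2 * e * `|a|.
Proof.
move=> H hx hxa Hs; have := H x (x + a) c d e hx hxa.
have -> : x + a - x = a by rewrite addrAC subrr add0r.
by rewrite opprD addrA; apply.
Qed.

Lemma cabs_seg (p q : C) (s r : R) : 0 <= s <= 1 -> cabs p < r -> cabs q < r ->
  cabs (p + s%:C * (q - p)) < r.
Proof.
move=> /andP[s0 s1] hp hq.
have -> : p + s%:C * (q - p) = (1 - s)%:C * p + s%:C * q.
  by rewrite rmorphB rmorph1; ring.
rewrite (le_lt_trans (cabsD _ _))// !cabsM !cabsR !ger0_norm ?subr_ge0//.
have [->|sn] := eqVneq s 0; first by rewrite subr0 mul1r mul0r addr0.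
have sp : 0 < s by rewrite lt_def sn.
have : s * cabs q < s * r by rewrite ltr_pM2l.
have : (1 - s) * cabs p <= (1 - s) * r by rewrite ler_wpM2l ?subr_ge0// ltW.
by move=> h1 h2; have := ler_ltD h1 h2; rewrite -mulrDl subrK mul1r.
Qed.

Lemma cabs_rect (x y a b r p q : R) : 0 <= p <= 1 -> 0 <= q <= 1 ->
  cabs (Complex x y) < r -> cabs (Complex (x + a) y) < r ->
  cabs (Complex x (y + b)) < r -> cabs (Complex (x + a) (y + b)) < r ->
  cabs (Complex (x + p * a) (y + q * b)) < r.
Proof.
move=> p01 q01 h1 h2 h3 h4.
have seg1 (y' : R) : cabs (Complex x y') < r -> cabs (Complex (x + a) y') < r ->
    cabs (Complex (x + p * a) y') < r.
  move=> k1 k2; have := cabs_seg p01 k1 k2; rewrite !ComplexE.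
  by congr (cabs _ < r); rewrite !(rmorphD, rmorphM) /=; ring.
have := cabs_seg q01 (seg1 _ h1 h2) (seg1 _ h3 h4); rewrite !ComplexE.
by congr (cabs _ < r); rewrite !(rmorphD, rmorphM) /=; ring.
Qed.

Section Rectangles.
Variables (f : C -> C) (r : R) (A B : R -> R -> C).
Hypothesis fd : forall z, cabs z < r -> exists d, cdiff f z d.
Hypothesis HA : forall y, primitive_on r (fun t => f (Complex t y)) (A y).
Hypothesis HB : forall x, primitive_on r (fun t => f (Complex x t)) (B x).

(** Counterclockwise boundary integral of f over the rectangle, expressed by the primitives [A y] on
    the horizontal line at height y and [B x] on the vertical line at abscissa x. The sides a and b
    may be negative. *)
Definition bdint (x y a b : R) : C :=
  (A y (x + a) - A y x) - (A (y + b) (x + a) - A (y + b) x)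
  + Ic * (B (x + a) (y + b) - B (x + a) y) - Ic * (B x (y + b) - B x y).

Lemma bdint_split x y a b : bdint x y a b =
  bdint x y (a / 2) (b / 2) + bdint (x + a / 2) y (a / 2) (b / 2)
  + bdint x (y + b / 2) (a / 2) (b / 2) + bdint (x + a / 2) (y + b / 2) (a / 2) (b / 2).
Proof.
have h (c t : R) : c + t / 2 + t / 2 = c + t by field.
by rewrite /bdint !h; ring.
Qed.

(** An affine function has boundary integral 0, and replacing f by one costs at most 2 e times the
    length on each of the four sides. *)
Lemma bdint_affine x y a b c d z0 (e : R) : 0 <= e ->
  (forall p q, 0 <= p <= 1 -> 0 <= q <= 1 -> cabs (Complex (x + p * a) (y + q * b)) < r) ->
  (forall p q, 0 <= p <= 1 -> 0 <= q <= 1 ->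
     let z := Complex (x + p * a) (y + q * b) in cabs (f z - c - d * (z - z0)) <= e) ->
  cabs (bdint x y a b) <= 4 * e * (`|a| + `|b|).
Proof.
move=> e0 Hr Hf.
have i0 : 0 <= (0 : R) <= 1 by rewrite lexx ler01.
have i1 : 0 <= (1 : R) <= 1 by rewrite lexx ler01.
have Re_lt (p q : R) : 0 <= p <= 1 -> 0 <= q <= 1 -> `|x + p * a| < r.
  by move=> hp hq; rewrite (le_lt_trans _ (Hr p q hp hq))// (Re_le_cabs (Complex _ _)).
have Im_lt (p q : R) : 0 <= p <= 1 -> 0 <= q <= 1 -> `|y + q * b| < r.
  by move=> hp hq; rewrite (le_lt_trans _ (Hr p q hp hq))// (Im_le_cabs (Complex _ _)).
have X0 : `|x| < r by have := Re_lt 0 0 i0 i0; rewrite mul0r addr0.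
have X1 : `|x + a| < r by have := Re_lt 1 0 i1 i0; rewrite mul1r.
have Y0 : `|y| < r by have := Im_lt 0 0 i0 i0; rewrite mul0r addr0.
have Y1 : `|y + b| < r by have := Im_lt 0 1 i0 i1; rewrite mul1r.
have hor y' q : 0 <= q <= 1 -> y' = y + q * b ->
  cabs (A y' (x + a) - A y' x - ((c + d * (Ic * y'%:C - z0)) * a%:C
     + d * (((x + a) ^+ 2 - x ^+ 2) / 2)%:C)) <= 2 * e * `|a|.
  move=> q01 ->; apply: (@primitive_seg r (fun t => f (Complex t (y + q * b))) _ _ _ _ _ _ (@HA _) X0 X1) => s s01.
  have := Hf s q s01 q01; rewrite /= ComplexE; congr (cabs _ <= e).
  by rewrite !(rmorphD, rmorphM) /=; ring.
have ver x' p : 0 <= p <= 1 -> x' = x + p * a ->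
  cabs (B x' (y + b) - B x' y - ((c + d * (x'%:C - z0)) * b%:C
     + (d * Ic) * (((y + b) ^+ 2 - y ^+ 2) / 2)%:C)) <= 2 * e * `|b|.
  move=> p01 ->; apply: (@primitive_seg r (fun t => f (Complex (x + p * a) t)) _ _ _ _ _ _ (@HB _) Y0 Y1) => s s01.
  have := Hf p s p01 s01; rewrite /= ComplexE; congr (cabs _ <= e).
  by rewrite !(rmorphD, rmorphM) /=; ring.
have := hor y 0 i0; rewrite mul0r addr0 => /(_ erefl).
have := hor (y + b) 1 i1; rewrite mul1r => /(_ erefl).
have := ver x 0 i0; rewrite mul0r addr0 => /(_ erefl).
have := ver (x + a) 1 i1; rewrite mul1r => /(_ erefl).
set E1 := (X in cabs X <= _); set E2 := (X in _ -> cabs X <= _ -> _).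
set E3 := (X in _ -> _ -> cabs X <= _ -> _); set E4 := (X in _ -> _ -> _ -> cabs X <= _ -> _).
move=> h1 h2 h3 h4.
have -> : bdint x y a b = E4 - E3 + Ic * E1 - Ic * E2.
  rewrite /bdint /E1 /E2 /E3 /E4 !(rmorphD, rmorphM) /=; ring.
have l1 : cabs (Ic * E1) <= 2 * e * `|b| by rewrite cabsM cabs_i mul1r.
have l2 : cabs (Ic * E2) <= 2 * e * `|b| by rewrite cabsM cabs_i mul1r.
have t1 := cabsB (E4 - E3 + Ic * E1) (Ic * E2).
have t2 := cabsD (E4 - E3) (Ic * E1).
have t3 := cabsB E4 E3.
lra.
Qed.

(** If the integral had modulus K > 0, repeated quartering would produce rectangles whose integrals
    are at least K / 4^n in modulus; differentiability at their limit point gives a smaller bound.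
    The bisection runs on the unit square and is scaled by a and b. *)
Lemma goursat x y a b :
  cabs (Complex x y) < r -> cabs (Complex (x + a) y) < r ->
  cabs (Complex x (y + b)) < r -> cabs (Complex (x + a) (y + b)) < r ->
  bdint x y a b = 0.
Proof.
move=> c1 c2 c3 c4; apply/eqP; rewrite -cabs_eq0; apply/negPn/negP => Kn.
pose K := cabs (bdint x y a b).
have K0 : 0 < K by rewrite lt_def Kn cabs_ge0.
pose h n : R := 2^-1 ^+ n.
have hS n : h n.+1 = h n / 2 by rewrite /h exprSr.
have h0 n : 0 < h n by rewrite /h exprn_gt0// invr_gt0.
have [|u v n|t0 [s0 Hb]] := @bisection R (fun u v n =>
    K * h n ^+ 2 <= cabs (bdint (x + u * a) (y + v * b) (h n * a) (h n * b))).
- by rewrite /h expr0 expr1n !mulr1 !mul0r !addr0 !mul1r.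
- rewrite -[2^-1 ^+ _]/(h n.+1) bdint_split.
  have e1 (t w c : R) : c + t * w + h n * w / 2 = c + (t + h n.+1) * w.
    by rewrite hS; ring.
  have e2 (w : R) : h n * w / 2 = h n.+1 * w by rewrite hS; ring.
  rewrite !e1 !e2 => hK; apply: contrapT => no.
  have lt4 (i j : bool) : cabs (bdint (x + (u + i%:R * h n.+1) * a)
     (y + (v + j%:R * h n.+1) * b) (h n.+1 * a) (h n.+1 * b)) < K * h n.+1 ^+ 2.
    by rewrite ltNge; apply/negP => hle; apply: no; exists i, j.
  have := lt4 false false; have := lt4 true false.
  have := lt4 false true; have := lt4 true true.
  rewrite !mul0r !mul1r !addr0.
  set E1 := bdint _ _ _ _; set E2 := bdint _ _ _ _; set E3 := bdint _ _ _ _.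
  set E4 := bdint _ _ _ _ => l1 l2 l3 l4.
  have t1 := cabsD (E4 + E3 + E2) E1; have t2 := cabsD (E4 + E3) E2.
  have t3 := cabsD E4 E3.
  have : K * h n ^+ 2 = 4 * (K * h n.+1 ^+ 2) by rewrite hS; field.
  lra.
pose z0 := Complex (x + t0 * a) (y + s0 * b).
have [u [v [_ /andP[tu1 tu2] /andP[sv1 sv2] [[u0 u1] [v0 v1]]]]] := Hb 0%N.
have t01 : 0 <= t0 <= 1 by rewrite expr0 in tu2 sv2 u1 v1; apply/andP; split; lra.
have s01 : 0 <= s0 <= 1 by rewrite expr0 in tu2 sv2 u1 v1; apply/andP; split; lra.
have z0r : cabs z0 < r by apply: cabs_rect.
have [d Hd] := fd z0r.
pose L := `|a| + `|b|.
have L0 : 0 <= L by rewrite addr_ge0.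
(* [bdint_affine] will be used with error e h L and yields 4 e L^2 h^2; this e keeps 4 e L^2 below
   K. *)
pose e := K / (8 * (L ^+ 2 + 1)).
have L1 : 0 < L ^+ 2 + 1 by rewrite ltr_wpDl ?sqr_ge0.
have e0 : 0 < e by rewrite divr_gt0// mulr_gt0.
have [dl dl0 Hdl] := Hd e e0.
have [n Hn] := half_pow_lt (divr_gt0 dl0 (ltr_wpDl L0 (@ltr01 R))).
move: Hn; rewrite -/(h n) ltr_pdivlMr ?ltr_wpDl// => Hn.
have {Hb u v tu1 tu2 sv1 sv2 u0 u1 v0 v1} [u [v [Ku /andP[tu1 tu2] /andP[sv1 sv2] [[u0 u1] [v0 v1]]]]] := Hb n.
rewrite -/(h n) in tu2 sv2 u1 v1.
have hn := h0 n.
have aux (w t p : R) : w <= t -> t <= w + h n -> 0 <= p <= 1 -> `|w + p * h n - t| <= h n.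
  move=> w1 w2 /andP[p0 p1].
  have : p * h n <= h n by rewrite ler_piMl// ltW.
  have : 0 <= p * h n by rewrite mulr_ge0// ltW.
  by move=> k1 k2; rewrite ler_norml; apply/andP; split; lra.
have dist p q : 0 <= p <= 1 -> 0 <= q <= 1 ->
    cabs (Complex (x + u * a + p * (h n * a)) (y + v * b + q * (h n * b)) - z0) <= h n * L.
  move=> p01 q01; rewrite (le_trans (cabs_le_ReIm _))//=.
  have -> : x + u * a + p * (h n * a) - (x + t0 * a) = (u + p * h n - t0) * a by ring.
  have -> : y + v * b + q * (h n * b) - (y + s0 * b) = (v + q * h n - s0) * b by ring.
  rewrite !normrM /L mulrDr lerD// ler_wpM2r//; exact: aux.
have inr p q : 0 <= p <= 1 -> 0 <= q <= 1 ->
    cabs (Complex (x + u * a + p * (h n * a)) (y + v * b + q * (h n * b))) < r.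
  move=> /andP[p0 p1] /andP[q0 q1].
  have -> : x + u * a + p * (h n * a) = x + (u + p * h n) * a by ring.
  have -> : y + v * b + q * (h n * b) = y + (v + q * h n) * b by ring.
  have : p * h n <= h n by rewrite ler_piMl// ltW.
  have : 0 <= p * h n by rewrite mulr_ge0// ltW.
  have : q * h n <= h n by rewrite ler_piMl// ltW.
  have : 0 <= q * h n by rewrite mulr_ge0// ltW.
  by move=> *; apply: cabs_rect => //; apply/andP; split; lra.
have := @bdint_affine (x + u * a) (y + v * b) (h n * a) (h n * b) (f z0) d z0 (e * (h n * L)).
have eh : 0 <= e * (h n * L) by apply: mulr_ge0; [exact: ltW|apply: mulr_ge0 => //; exact: ltW].
move=> /(_ eh inr) H.
have {H} : cabs (bdint (x + u * a) (y + v * b) (h n * a) (h n * b)) <=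
    4 * (e * (h n * L)) * (`|h n * a| + `|h n * b|).
  apply: H => p q p01 q01 /=; set z := Complex _ _.
  have := dist p q p01 q01; rewrite -/z => dz.
  have := Hdl (z - z0); rewrite (addrC z0) subrK => Hz.
  rewrite (le_trans (Hz _))//; last by rewrite ler_wpM2l// ltW.
  by rewrite (le_lt_trans dz)// (le_lt_trans _ Hn)// ler_wpM2l ?lerDl// ltW.
move/(le_trans Ku); rewrite !normrM (ger0_norm (ltW hn)) -mulrDr -/L.
have -> : 4 * (e * (h n * L)) * (h n * L) = (4 * e * L ^+ 2) * h n ^+ 2 by ring.
rewrite ler_pM2r ?exprn_gt0//.
have -> : 4 * e * L ^+ 2 = K * (L ^+ 2 / (2 * (L ^+ 2 + 1))).
  by rewrite /e; field; apply/lt0r_neq0.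
rewrite -{1}[K]mulr1 ler_pM2l// ler_pdivlMr ?mulr_gt0// mul1r.
have := sqr_ge0 L; lra.
Qed.

End Rectangles.

(** The primitive integrates from 0 horizontally and then vertically; both legs stay in the disc.
    Continuity is asked on the whole plane because [primitive_exists] wants it on whole lines. *)
Lemma disc_primitive_cont (f : C -> C) (r : R) : 0 < r ->
  (forall z (e : R), 0 < e -> exists2 dl : R, 0 < dl & forall w, cabs (w - z) < dl ->
     cabs (f w - f z) < e) ->
  (forall z, cabs z < r -> exists d, cdiff f z d) ->
  exists G, forall z, cabs z < r -> cdiff G z (f z).
Proof.
move=> r0 fc fd.
have /choice[A HA] : forall y, exists U, primitive_on r (fun t => f (Complex t y)) U.
  move=> y; apply: primitive_exists => // x e e0.
  have [dl dl0 Hd] := fc (Complex x y) e e0.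
  exists dl => // t ht; apply: Hd.
  rewrite (le_lt_trans (cabs_le_ReIm _))//= subrr normr0 addr0//.
have /choice[B HB] : forall x, exists U, primitive_on r (fun t => f (Complex x t)) U.
  move=> x; apply: primitive_exists => // y e e0.
  have [dl dl0 Hd] := fc (Complex x y) e e0.
  exists dl => // t ht; apply: Hd.
  rewrite (le_lt_trans (cabs_le_ReIm _))//= subrr normr0 add0r//.
pose G1 x y := A 0 x - A 0 0 + Ic * (B x y - B x 0).
(* The same value with the vertical leg first, by Goursat. In this form the increment in x is
   visible, in the form [G1] the increment in y. *)
have G2 x y : cabs (Complex x y) < r -> G1 x y = Ic * (B 0 y - B 0 0) + (A y x - A y 0).
  move=> xyr.
  have x0r : cabs (Complex x 0) < r.
    apply: le_lt_trans xyr; rewrite -/(x%:C) cabsR; exact: (Re_le_cabs (Complex x y)).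
  have y0r : cabs (Complex 0 y) < r.
    rewrite ComplexE add0r cabsM cabs_i mul1r cabsR.
    apply: le_lt_trans xyr; exact: (Im_le_cabs (Complex x y)).
  have zr : cabs (Complex (0 : R) 0) < r by rewrite -[Complex _ _]/(0 : C) cabs0.
  have := @goursat f r A B fd HA HB 0 0 x y.
  rewrite !add0r /bdint !add0r => /(_ zr x0r y0r xyr) /eqP.
  rewrite subr_eq0 addrAC subr_eq => /eqP E; apply/eqP.
  rewrite /G1 -subr_eq0; move/eqP: E; rewrite -subr_eq0.
  by congr (_ == 0); ring.
exists (fun z => G1 (complex.Re z) (complex.Im z)) => -[x y] zr /= e e0.
have e4 : 0 < e / 8 by rewrite divr_gt0.
have [dl dl0 Hd] := fc (Complex x y) _ e4.
exists (Num.min (dl / 2) (r - cabs (Complex x y))).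
  by rewrite lt_min subr_gt0 zr divr_gt0.
move=> [a b]; rewrite lt_min ltrBrDr => /andP[hd hr] /=.
have ha : `|a| <= cabs (Complex a b) := Re_le_cabs (Complex a b).
have hb : `|b| <= cabs (Complex a b) := Im_le_cabs (Complex a b).
have pr : cabs (Complex (x + a) y) < r.
  have -> : Complex (x + a) y = Complex x y + a%:C.
    by rewrite !ComplexE rmorphD /=; ring.
  by rewrite (le_lt_trans (cabsD _ _))// cabsR (le_lt_trans _ hr)// addrC lerD2r.
have qr : cabs (Complex (x + a) (y + b)) < r.
  by apply: le_lt_trans hr; rewrite [leRHS]addrC; exact: (cabsD (Complex x y) (Complex a b)).
have px : `|x| < r by apply: le_lt_trans zr; apply: (Re_le_cabs (Complex x y)).
have py : `|y| < r by apply: le_lt_trans zr; apply: (Im_le_cabs (Complex x y)).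
have pxa : `|x + a| < r by apply: le_lt_trans pr; apply: (Re_le_cabs (Complex (x + a) y)).
have pyb : `|y + b| < r by apply: le_lt_trans qr; apply: (Im_le_cabs (Complex (x + a) (y + b))).
have E1 : cabs (A y (x + a) - A y x - f (Complex x y) * a%:C) <= 2 * (e / 8) * `|a|.
  have := primitive_seg (HA y) px pxa (c := f (Complex x y)) (d := 0) (e := e / 8).
  rewrite !mul0r addr0; apply => s /andP[s0 s1]; rewrite mul0r addr0 ltW// Hd//.
  rewrite (le_lt_trans (cabs_le_ReIm _))//= subrr normr0 addr0.
  have -> : x + s * a - x = s * a by ring.
  rewrite normrM (ger0_norm s0).
  have : s * `|a| <= `|a| by rewrite ler_piMl.
  by have := normr_ge0 a; lra.
have E2 : cabs (B (x + a) (y + b) - B (x + a) y - f (Complex x y) * b%:C) <= 2 * (e / 8) * `|b|.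
  have := primitive_seg (HB (x + a)) py pyb (c := f (Complex x y)) (d := 0) (e := e / 8).
  rewrite !mul0r addr0; apply => s /andP[s0 s1]; rewrite mul0r addr0 ltW// Hd//.
  rewrite (le_lt_trans (cabs_le_ReIm _))//=.
  have -> : x + a - x = a by ring.
  have -> : y + s * b - y = s * b by ring.
  rewrite normrM (ger0_norm s0).
  have : s * `|b| <= `|b| by rewrite ler_piMl.
  by have := normr_ge0 a; lra.
have -> : G1 (x + a) (y + b) - G1 x y - f (Complex x y) * Complex a b =
  (A y (x + a) - A y x - f (Complex x y) * a%:C) +
  Ic * (B (x + a) (y + b) - B (x + a) y - f (Complex x y) * b%:C).
  have -> : G1 (x + a) (y + b) = G1 (x + a) y + Ic * (B (x + a) (y + b) - B (x + a) y).
    by rewrite /G1; ring.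
  by rewrite (G2 _ _ pr) (G2 _ _ zr) (ComplexE a b); ring.
rewrite (le_trans (cabsD _ _))// cabsM cabs_i mul1r.
have : e * `|a| <= e * cabs (Complex a b) by rewrite ler_wpM2l// ltW.
have : e * `|b| <= e * cabs (Complex a b) by rewrite ler_wpM2l// ltW.
have : 0 <= e * cabs (Complex a b) by apply: mulr_ge0; [exact: ltW|exact: cabs_ge0].
lra.
Qed.

End Goursat.

(** * Primitives of holomorphic functions and averages over circles *)

Section CauchyFormula.
Variable R : realType.
Local Notation "x %:C" := (real_complex R x) : ring_scope.
Local Notation C := R[i].

Lemma cdiff_continuous (g : C -> C) z d : cdiff g z d -> forall e : R, 0 < e ->
  exists2 dl : R, 0 < dl & forall w, cabs (w - z) < dl -> cabs (g w - g z) < e.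
Proof.
move=> H e e0; have [dl dl0 Hd] := H 1 ltr01.
have c0 : 0 < 1 + cabs d by rewrite ltr_pwDl// cabs_ge0.
exists (Num.min dl (e / (1 + cabs d))); first by rewrite lt_min dl0 divr_gt0.
move=> w; rewrite lt_min ltr_pdivlMr// => /andP[/Hd h1 h2].
move: h1; rewrite mul1r (addrC z) subrK => h1.
have := cabsB_ge (g w - g z) (d * (w - z)); rewrite cabsM.
by lra.
Qed.

Lemma cdiff_local (f g : C -> C) z d (dl : R) : 0 < dl ->
  (forall w, cabs (w - z) < dl -> f w = g w) -> cdiff g z d -> cdiff f z d.
Proof.
move=> dl0 fg H e e0; have [dl' dl'0 Hd] := H e e0.
exists (Num.min dl dl'); first by rewrite lt_min dl0.
move=> h; rewrite lt_min => /andP[h1 /Hd h2].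
by rewrite !fg// ?subrr ?cabs0// addrAC subrr add0r.
Qed.

Lemma cdiff_unique (g : C -> C) z d1 d2 : cdiff g z d1 -> cdiff g z d2 -> d1 = d2.
Proof.
move=> H1 H2; apply/eqP; rewrite -subr_eq0 -cabs_eq0.
apply/negPn/negP => n0; have K0 : 0 < cabs (d1 - d2) by rewrite lt_def n0 cabs_ge0.
have e0 : 0 < cabs (d1 - d2) / 4 by rewrite divr_gt0.
have [l1 l10 h1] := H1 _ e0; have [l2 l20 h2] := H2 _ e0.
pose t := Num.min l1 l2 / 2.
have m0 : 0 < Num.min l1 l2 by rewrite lt_min l10.
have t0 : 0 < t by rewrite divr_gt0.
have tm : t < Num.min l1 l2 by rewrite /t; lra.
move: (tm); rewrite lt_min => /andP[t1 t2].
have ct : cabs t%:C = t by rewrite cabsR ger0_norm// ltW.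
have := h1 t%:C; rewrite ct => /(_ t1) k1; have := h2 t%:C; rewrite ct => /(_ t2) k2.
have := cabsB (g (z + t%:C) - g z - d2 * t%:C) (g (z + t%:C) - g z - d1 * t%:C).
have -> : g (z + t%:C) - g z - d2 * t%:C - (g (z + t%:C) - g z - d1 * t%:C) =
  (d1 - d2) * t%:C by ring.
rewrite cabsM ct => k3.
have : cabs (d1 - d2) * t <= (cabs (d1 - d2) / 2) * t by lra.
by rewrite ler_pM2r//; lra.
Qed.

(** Composition with the radial retraction [cl] onto the closed disc of radius r, which is
    Lipschitz, makes g continuous on the plane without changing it in the disc. *)
Lemma disc_primitive (g : C -> C) (r rho : R) : 0 < r -> r < rho ->
  (forall z, cabs z < rho -> exists d, cdiff g z d) ->
  exists G, forall z, cabs z < r -> cdiff G z (g z).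
Proof.
move=> r0 rrho gd.
pose m z := Num.max r (cabs z); pose cl z := (r / m z)%:C * z.
have m0 z : 0 < m z by rewrite lt_max r0.
have clr z : cabs (cl z) <= r.
  rewrite cabsM cabsR ger0_norm; last by rewrite divr_ge0 ?ltW.
  by rewrite mulrAC ler_pdivrMr// ler_wpM2l ?(ltW r0)// le_max lexx orbT.
have clE z : cabs z <= r -> cl z = z.
  by move=> zr; rewrite /cl /m max_l// divff ?gt_eqF// rmorph1 mul1r.
have cl_lip z w : cabs (cl z - cl w) <= 2 * cabs (z - w).
  have -> : cl z - cl w = (r / m z)%:C * (z - w) + (r / m z - r / m w)%:C * w.
    by rewrite /cl rmorphB; ring.
  rewrite (le_trans (cabsD _ _))// !cabsM !cabsR mulr_natl mulr2n lerD//.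
    rewrite ler_piMl ?cabs_ge0// ger0_norm; last by rewrite divr_ge0 ?ltW.
    by rewrite ler_pdivrMr// mul1r /m le_max lexx.
  have -> : r / m z - r / m w = r * (m w - m z) / (m z * m w).
    by field; rewrite !gt_eqF.
  rewrite !normrM normfV normrM (gtr0_norm r0) (gtr0_norm (m0 z)) (gtr0_norm (m0 w)).
  have mzw : `|m w - m z| <= cabs (z - w).
    have h1 := cabsB_ge z w; have h2 := cabsB_ge w z.
    rewrite (cabsBC w) in h2; have h3 := cabs_ge0 (z - w).
    rewrite /m !maxEle ler_norml; case: ifP => k1; case: ifP => k2; apply/andP; split; lra.
  have E (D W X : R) : r * (D * X) * W = D * (r * W) * X by ring.
  rewrite -mulrA E ler_pdivrMr ?mulr_gt0//.
  rewrite ler_pM ?mulr_ge0 ?cabs_ge0 ?(ltW r0)//.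
  by rewrite ler_pM ?cabs_ge0 ?(ltW r0)// le_max lexx ?orbT.
have [||G HG] := @disc_primitive_cont R (g \o cl) r r0.
- move=> z e e0.
  have [d Hd] := gd (cl z) (le_lt_trans (clr z) rrho).
  have [dl dl0 H] := cdiff_continuous Hd e0.
  exists (dl / 2); first by rewrite divr_gt0.
  move=> w hw; apply: H; rewrite (le_lt_trans (cl_lip _ _))//; lra.
- move=> z zr; have [d Hd] := gd z (lt_trans zr rrho).
  exists d; apply: (@cdiff_local _ g _ _ (r - cabs z)) => //; first by rewrite subr_gt0.
  move=> w hw /=; rewrite clE//.
  by have := cabsD (w - z) z; rewrite subrK; lra.
by exists G => z zr; have := HG z zr; rewrite /= clE// ltW.
Qed.

Lemma rcdiff_line (G : C -> C) (a b d : C) (t : R) : cdiff G (a + t%:C * b) d ->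
  rcdiff (fun t => G (a + t%:C * b)) t (d * b).
Proof.
move=> H e e0.
have b1 : 0 < 1 + cabs b by rewrite ltr_pwDl// cabs_ge0.
have [dl dl0 Hd] := H _ (divr_gt0 e0 b1).
exists (dl / (1 + cabs b)); first by rewrite divr_gt0.
move=> h; rewrite ltr_pdivlMr// => hh.
have := Hd (h%:C * b); rewrite cabsM cabsR.
have nb : `|h| * cabs b <= `|h| * (1 + cabs b) by rewrite ler_wpM2l// lerDr.
move=> /(_ (le_lt_trans nb hh)).
have -> : a + t%:C * b + h%:C * b = a + (t + h)%:C * b by rewrite rmorphD; ring.
have -> : d * (h%:C * b) = d * b * h%:C by ring.
move/le_trans; apply.
rewrite mulrA [leLHS]mulrAC ler_wpM2r// mulrAC ler_pdivrMr//.
by rewrite ler_wpM2l ?(ltW e0)// lerDr.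
Qed.

Lemma rcdiffZ (c : C) g t d : rcdiff g t d -> rcdiff (fun t => c * g t) t (c * d).
Proof.
move=> H e e0.
have c1 : 0 < 1 + cabs c by rewrite ltr_pwDl// cabs_ge0.
have [dl dl0 Hd] := H _ (divr_gt0 e0 c1).
exists dl => // h /Hd hh.
rewrite -!mulrA -!mulrBr cabsM.
have : cabs c * cabs (g (t + h) - g t - d * h%:C) <= (1 + cabs c) * (e / (1 + cabs c) * `|h|).
  by rewrite ler_pM ?cabs_ge0// lerDr.
by rewrite mulrA mulrCA mulfV ?gt_eqF// mulr1.
Qed.

Lemma rcdiffD (g1 g2 : R -> C) (t : R) d1 d2 : rcdiff g1 t d1 -> rcdiff g2 t d2 ->
  rcdiff (fun t => g1 t + g2 t) t (d1 + d2).
Proof.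
move=> H1 H2 e e0; have e2 : 0 < e / 2 by rewrite divr_gt0.
have [l1 l10 h1] := H1 _ e2; have [l2 l20 h2] := H2 _ e2.
exists (Num.min l1 l2); first by rewrite lt_min l10.
move=> h; rewrite lt_min => /andP[/h1 k1 /h2 k2].
have -> : g1 (t + h) + g2 (t + h) - (g1 t + g2 t) - (d1 + d2) * h%:C =
  (g1 (t + h) - g1 t - d1 * h%:C) + (g2 (t + h) - g2 t - d2 * h%:C) by ring.
by rewrite (le_trans (cabsD _ _))//; lra.
Qed.

Lemma rcdiff_sum I (r : seq I) (g : I -> R -> C) t (d : I -> C) :
  (forall i, rcdiff (g i) t (d i)) ->
  rcdiff (fun t => \sum_(i <- r) g i t) t (\sum_(i <- r) d i).
Proof.
move=> H; elim: r => [|i r IH].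
  move=> e e0; exists 1 => // h _; rewrite !big_nil mul0r !subrr cabs0.
  by rewrite mulr_ge0// ltW.
rewrite big_cons; have -> : (fun t => \sum_(j <- i :: r) g j t) =
   (fun t => g i t + \sum_(j <- r) g j t) by apply/funext => s; rewrite big_cons.
exact: rcdiffD.
Qed.

(** Riemann sum of the mean of u over the circle of radius r, that is of (2 pi i)^-1 times the
    contour integral of u(z) dz / z. *)
Definition avg (N : nat) (u : C -> C) (r : R) : C :=
  (N%:R)^-1 * \sum_(j < N) u (r%:C * om R N ^+ j).

Lemma cabs_avg N u r (M : R) : (0 < N)%N ->
  (forall z, cabs z = `|r| -> cabs (u z) <= M) -> cabs (avg N u r) <= M.
Proof.
move=> N0 H; rewrite /avg cabsM cabsV cabs_nat mulrC ler_pdivrMr ?ltr0n//.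
rewrite (le_trans (cabs_sum _ _ _))// mulr_natr.
have <- : \sum_(j < N) M = M *+ N by rewrite sumr_const card_ord.
apply: ler_sum => j _; apply: H.
by rewrite cabsM cabsR cabsX cabs_om expr1n mulr1.
Qed.

Lemma avgB N u v r : avg N (fun z => u z - v z) r = avg N u r - avg N v r.
Proof. by rewrite /avg sumrB mulrBr. Qed.

Lemma avgZ N c u r : avg N (fun z => c * u z) r = c * avg N u r.
Proof. by rewrite /avg -mulr_sumr mulrCA. Qed.

Lemma avg_sum N I (s : seq I) (P : pred I) (u : I -> C -> C) r :
  avg N (fun z => \sum_(i <- s | P i) u i z) r = \sum_(i <- s | P i) avg N (u i) r.
Proof. by rewrite /avg exchange_big mulr_sumr. Qed.

Lemma eq_avg N u v r : (forall z, cabs z = `|r| -> u z = v z) -> avg N u r = avg N v r.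
Proof.
move=> uv; rewrite /avg; congr (_ * _); apply: eq_bigr => j _; apply: uv.
by rewrite cabsM cabsR cabsX cabs_om expr1n mulr1.
Qed.

Lemma avgX N a r : (0 < N)%N ->
  avg N (fun z => z ^+ a) r = if (N %| a)%N then (r ^+ a)%:C else 0.
Proof.
move=> N0; rewrite /avg; under eq_bigr do rewrite exprMn -exprM mulnC.
rewrite -mulr_sumr sum_om//; case: ifP => _; last by rewrite !mulr0.
by rewrite mulrCA mulVf ?mulr1 ?rmorphXn// pnatr_eq0 -lt0n.
Qed.

(** Conjugation inverts roots of unity, which reduces negative powers to [avgX] at radius 1 / r. *)
Lemma avgVX N a r : (0 < N)%N -> 0 < r ->
  avg N (fun z => z ^- a) r = if (N %| a)%N then (r ^- a)%:C else 0.
Proof.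
move=> N0 r0; rewrite /avg.
have -> : \sum_(j < N) (r%:C * om R N ^+ j) ^- a =
    conjc (\sum_(j < N) (r^-1%:C * om R N ^+ j) ^+ a).
  rewrite rmorph_sum; apply: eq_bigr => j _.
  rewrite rmorphXn /= -exprVn; congr (_ ^+ a).
  have -> : conjc (r^-1%:C * om R N ^+ j) = r^-1%:C * conjc (om R N ^+ j).
    by case: (_ ^+ j) => x y; apply/eqP; rewrite eq_complex /=; apply/andP; split; apply/eqP; ring.
  rewrite invfM fmorphV; congr (_ * _).
  have := mul_conjc (om R N ^+ j); rewrite cabsX cabs_om !expr1n => h.
  by apply: (mulfI (_ : om R N ^+ j != 0)); rewrite ?expf_neq0 ?om_neq0// h mulfV ?expf_neq0 ?om_neq0.
have := avgX a r^-1 N0; rewrite /avg => /(congr1 (@conjc R)); rewrite rmorphM.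
rewrite fmorphV /= conjc_nat => ->.
by case: ifP => _; rewrite ?conjc0// conjc_real exprVn.
Qed.

End CauchyFormula.

(** * The Cauchy kernel and Cauchy's formula as a limit of averages *)

Section CauchyKernel.
Variable R : realType.
Local Notation "x %:C" := (real_complex R x) : ring_scope.
Local Notation C := R[i].

Lemma cabs_kernel (r s : R) (z w : C) : s < r -> cabs z = r -> cabs w <= s ->
  z - w != 0 /\ cabs (z - w)^-1 <= (r - s)^-1.
Proof.
move=> sr zr ws; have h : r - s <= cabs (z - w).
  by have := cabsB_ge z w; rewrite zr; lra.
have d0 : 0 < cabs (z - w) by apply: lt_le_trans h; rewrite subr_gt0.
by rewrite -cabs_gt0 cabsV lef_pV2// posrE subr_gt0.
Qed.

Lemma kernel_geometric (z w : C) n : z != 0 -> z - w != 0 ->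
  z / (z - w) = \sum_(a < n) w ^+ a * z ^- a + (w / z) ^+ n * (z / (z - w)).
Proof.
move=> z0 zw; have := subrX1 (w / z) n.
under eq_bigr do rewrite exprMn exprVn.
set S := \sum_(i < n) _ => E.
have -> : (w / z) ^+ n = 1 + (w / z - 1) * S by rewrite -E addrC subrK.
by field; apply/andP.
Qed.

(** First order Taylor formula for w |-> (z - w)^-n, where x and y are the kernels at w and w + h.
    Only the resolvent identity y - x = h x y is kept, which makes the induction on n purely
    algebraic. *)
Lemma kernel_power_taylor (x y h : C) (b : R) n : 0 <= b -> cabs x <= b -> cabs y <= b ->
  y - x = h * x * y ->
  cabs (y ^+ n - x ^+ n - n%:R * h * x ^+ n.+1) <= (n ^ 2)%:R * b ^+ n.+2 * cabs h ^+ 2.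
Proof.
move=> b0 xb yb yx; elim: n => [|n IH].
  by rewrite !expr0 subrr !mul0r subrr cabs0.
have -> : y ^+ n.+1 - x ^+ n.+1 - n.+1%:R * h * x ^+ n.+2 =
    y * (y ^+ n - x ^+ n - n%:R * h * x ^+ n.+1) + n.+1%:R * (h ^+ 2 * (x ^+ n.+2 * y)).
  (* A multiple of this vanishing expression is subtracted, so that the recursion becomes an
     identity of polynomials. *)
  have E : x - y + h * x * y = 0 by rewrite -yx; ring.
  rewrite -[RHS]subr0 -[X in _ = _ - X](mulr0 (x ^+ n + n.+1%:R * h * x ^+ n.+1)) -E.
  by rewrite !exprS -natr1; ring.
rewrite (le_trans (cabsD _ _))// !(cabsX, cabsM) cabs_nat.
have h1 : cabs y * cabs (y ^+ n - x ^+ n - n%:R * h * x ^+ n.+1) <=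
   b * ((n ^ 2)%:R * b ^+ n.+2 * cabs h ^+ 2) by rewrite ler_pM ?cabs_ge0.
have h2 : n.+1%:R * (cabs h ^+ 2 * (cabs x ^+ n.+2 * cabs y)) <=
   n.+1%:R * (cabs h ^+ 2 * (b ^+ n.+2 * b)).
  rewrite ler_wpM2l// ler_wpM2l ?sqr_ge0// ler_pM ?exprn_ge0 ?cabs_ge0//.
  by rewrite lerXn2r ?nnegrE ?cabs_ge0.
apply: (le_trans (lerD h1 h2)).
have -> : b * ((n ^ 2)%:R * b ^+ n.+2 * cabs h ^+ 2) +
    n.+1%:R * (cabs h ^+ 2 * (b ^+ n.+2 * b)) =
  (n ^ 2 + n.+1)%:R * b ^+ n.+3 * cabs h ^+ 2 by rewrite natrD !exprS; ring.
rewrite ler_wpM2r ?sqr_ge0// ler_wpM2r ?exprn_ge0// ler_nat; lia.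
Qed.

(** Riemann sum of a! / (2 pi i) times the contour integral of G(z) / (z - w)^(a+1) dz; the z in the
    numerator compensates for [avg] averaging with dz / z. *)
Definition cauchy_avg (G : C -> C) (r : R) (a N : nat) (w : C) : C :=
  avg N (fun z => G z * (a`!%:R * z / (z - w) ^+ a.+1)) r.

(** [kernel_power_taylor] averaged over the circle. The constant does not depend on N; this is what
    lets differentiability in w pass to the limit. *)
Lemma cauchy_avg_taylor (G : C -> C) (r s M : R) a N (w h : C) : (0 < N)%N ->
  0 < r -> s < r ->
  (forall z, cabs z = r -> cabs (G z) <= M) -> cabs w <= s -> cabs (w + h) <= s ->
  cabs (cauchy_avg G r a N (w + h) - cauchy_avg G r a N w - cauchy_avg G r a.+1 N w * h)
   <= M * (a`!%:R * r * ((a.+1 ^ 2)%:R * (r - s)^-1 ^+ a.+3)) * cabs h ^+ 2.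
Proof.
move=> N0 r0 sr GM ws whs.
rewrite mulrC -avgZ -!avgB; apply: cabs_avg => // z; rewrite gtr0_norm// => zr.
have [zw xb] := cabs_kernel sr zr ws; have [zwh yb] := cabs_kernel sr zr whs.
set x := (z - w)^-1 in xb; set y := (z - (w + h))^-1 in yb.
have yx : y - x = h * x * y.
  by rewrite /x /y; field; rewrite zw zwh.
have -> : G z * (a`!%:R * z / (z - (w + h)) ^+ a.+1) - G z * (a`!%:R * z / (z - w) ^+ a.+1)
   - h * (G z * (a.+1`!%:R * z / (z - w) ^+ a.+2)) =
   G z * (a`!%:R * z * (y ^+ a.+1 - x ^+ a.+1 - a.+1%:R * h * x ^+ a.+2)).
  by rewrite -!exprVn -/x -/y factS natrM; ring.
have M0 : 0 <= M by rewrite (le_trans _ (GM z zr))// cabs_ge0.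
have b0 : 0 <= (r - s)^-1 by rewrite invr_ge0 subr_ge0 ltW.
set K := _ * (r - s)^-1 ^+ _.
have -> : M * (a`!%:R * r * K) * cabs h ^+ 2 = M * (a`!%:R * r * (K * cabs h ^+ 2)) by ring.
rewrite !cabsM cabs_nat zr ler_pM ?cabs_ge0 ?GM ?mulr_ge0 ?cabs_ge0 ?(ltW r0)//.
rewrite ler_wpM2l ?mulr_ge0 ?(ltW r0)//.
exact: kernel_power_taylor.
Qed.

(** Takes the place of differentiation under the integral. For a fixed small h the difference
    quotients of [F N] are within K h of [F1 N], and uniform convergence of [F N] makes them Cauchy;
    so [F1 N] converges uniformly and the quadratic error survives. The disc shrinks to s' to leave
    room for h. *)
Lemma limit_cdiff (F F1 : nat -> C -> C) (f : C -> C) (s K : R) : 0 < s -> 0 <= K ->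
  (forall N w h, (0 < N)%N -> cabs w < s -> cabs (w + h) < s ->
     cabs (F N (w + h) - F N w - F1 N w * h) <= K * cabs h ^+ 2) ->
  (forall e : R, 0 < e -> exists N0, forall N w, (N0 <= N)%N -> cabs w < s ->
     cabs (F N w - f w) <= e) ->
  exists f1, [/\ forall w, cabs w < s -> cdiff f w (f1 w),
    forall w h, cabs w < s -> cabs (w + h) < s ->
      cabs (f (w + h) - f w - f1 w * h) <= K * cabs h ^+ 2 &
    forall s', s' < s -> forall e : R, 0 < e -> exists N0, forall N w, (N0 <= N)%N ->
      cabs w < s' -> cabs (F1 N w - f1 w) <= e].
Proof.
move=> s0 K0 HF Hf.
have quot s' (e : R) : s' < s -> 0 < e -> exists N0, forall N N' w, (N0 <= N)%N -> (N0 <= N')%N ->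
    cabs w < s' -> cabs (F1 N w - F1 N' w) <= e.
  move=> s's e0.
  (* Small enough that w + h stays in the disc and that the two quadratic errors, 2 K h after
     division by h, cost at most e / 2. The four distances between [F] and f, at most e h / 8 each,
     cost the other half. *)
  pose h := Num.min ((s - s') / 2) (e / (4 * (K + 1))).
  have K1 : 0 < 4 * (K + 1) by lra.
  have h0 : 0 < h by rewrite lt_min !divr_gt0// subr_gt0.
  have hs : h < s - s'.
    have : h <= (s - s') / 2 by rewrite ge_min lexx.
    by lra.
  have hK : 2 * K * h <= e / 2.
    have : h <= e / (4 * (K + 1)) by rewrite ge_min lexx orbT.
    rewrite ler_pdivlMr// => hh; have := mulr_ge0 K0 (ltW h0); nra.
  have [N0 HN0] := Hf (e * h / 8) (divr_gt0 (mulr_gt0 e0 h0) (ltr0n _ 8)).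
  exists N0.+1 => N N' w NN NN' ws'.
  have ws : cabs w < s by apply: lt_trans s's.
  have wh : cabs (w + h%:C) < s.
    by rewrite (le_lt_trans (cabsD _ _))// cabsR gtr0_norm//; lra.
  have k1 := HF N w h%:C (leq_ltn_trans (leq0n _) NN) ws wh.
  have k2 := HF N' w h%:C (leq_ltn_trans (leq0n _) NN') ws wh.
  have a1 := HN0 N w (ltnW NN) ws; have a2 := HN0 N' w (ltnW NN') ws.
  have b1 := HN0 N _ (ltnW NN) wh; have b2 := HN0 N' _ (ltnW NN') wh.
  move: k1 k2; rewrite cabsR gtr0_norm// => k1 k2.
  rewrite -(ler_pM2r h0).
  have -> : cabs (F1 N w - F1 N' w) * h = cabs ((F1 N w - F1 N' w) * h%:C).
    by rewrite cabsM cabsR gtr0_norm.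
  have -> : (F1 N w - F1 N' w) * h%:C =
    - (F N (w + h%:C) - F N w - F1 N w * h%:C) +
    (F N' (w + h%:C) - F N' w - F1 N' w * h%:C) +
    (F N (w + h%:C) - f (w + h%:C)) - (F N' (w + h%:C) - f (w + h%:C)) -
    (F N w - f w) + (F N' w - f w) by ring.
  rewrite !(le_trans (cabsD _ _))//.
  set E1 := F N (w + _) - F N w - _ in k1 *; set E2 := F N' (w + _) - F N' w - _ in k2 *.
  set A1 := F N w - f w in a1 *; set A2 := F N' w - f w in a2 *.
  set B1 := F N _ - f _ in b1 *; set B2 := F N' _ - f _ in b2 *.
  have t1 := cabsD (- E1 + E2 + B1 - B2 - A1) A2.
  have t2 := cabsB (- E1 + E2 + B1 - B2) A1.
  have t3 := cabsB (- E1 + E2 + B1) B2.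
  have t4 := cabsD (- E1 + E2) B1.
  have t5 := cabsD (- E1) E2; have t6 := cabsN E1.
  have : K * h ^+ 2 + K * h ^+ 2 <= e * h / 2.
    have -> : K * h ^+ 2 + K * h ^+ 2 = (2 * K * h) * h by ring.
    by have := ler_wpM2r (ltW h0) hK; lra.
  lra.
have ptw w : cabs w < s -> exists l, forall e : R, 0 < e -> exists N0, forall N, (N0 <= N)%N ->
    cabs (F1 N w - l) < e.
  move=> ws; apply: cauchy_seq_lim => e e0.
  have [||N0 HN0] := quot ((cabs w + s) / 2) (e / 2); [lra|lra|].
  exists N0 => p q hp hq; have := HN0 p q w hp hq; lra.
have /choice[f1 Hf1] : forall w, exists l, cabs w < s -> forall e : R, 0 < e ->
    exists N0, forall N, (N0 <= N)%N -> cabs (F1 N w - l) < e.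
  by move=> w; have [/ptw[l Hl]|_] := ltP (cabs w) s; [exists l | exists 0].
have second w h : cabs w < s -> cabs (w + h) < s ->
    cabs (f (w + h) - f w - f1 w * h) <= K * cabs h ^+ 2.
  move=> ws wh; apply/ler_addgt0Pr => e e0.
  have e3 : 0 < e / 3 by rewrite divr_gt0.
  have h1 : 0 < 1 + cabs h by rewrite ltr_pwDl ?cabs_ge0.
  have [N1 HN1] := Hf _ e3; have [N2 HN2] := Hf1 w ws _ (divr_gt0 e3 h1).
  pose N := maxn (maxn N1 N2) 1.
  have NN1 : (N1 <= N)%N by rewrite /N; lia.
  have NN2 : (N2 <= N)%N by rewrite /N; lia.
  have NN0 : (0 < N)%N by rewrite /N; lia.
  have k := HF N w h NN0 ws wh.
  have a := HN1 N w NN1 ws; have b := HN1 N _ NN1 wh; have c := HN2 N NN2.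
  have -> : f (w + h) - f w - f1 w * h = (F N (w + h) - F N w - F1 N w * h)
    - (F N (w + h) - f (w + h)) + (F N w - f w) + (F1 N w - f1 w) * h by ring.
  set E := F N (w + h) - F N w - _ in k *; set A := F N w - f w in a *.
  set B := F N _ - f _ in b *; set D := F1 N w - f1 w in c *.
  have t1 := cabsD (E - B + A) (D * h); have t2 := cabsD (E - B) A; have t3 := cabsB E B.
  have t4 : cabs (D * h) <= e / 3.
    rewrite cabsM; have : cabs D * cabs h <= e / 3 / (1 + cabs h) * (1 + cabs h).
      by rewrite ler_pM ?cabs_ge0 ?(ltW c)// lerDr.
    by rewrite divfK// gt_eqF.
  lra.
exists f1; split => //.
- move=> w ws e e0.
  have K1 : 0 < K + 1 by lra.
  exists (Num.min (s - cabs w) (e / (K + 1))).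
    by rewrite lt_min subr_gt0 ws divr_gt0.
  move=> h; rewrite lt_min => /andP[hs he].
  apply: (le_trans (second w h ws _)).
    by rewrite (le_lt_trans (cabsD _ _))//; lra.
  rewrite expr2 mulrA ler_wpM2r ?cabs_ge0//.
  move: he; rewrite ltr_pdivlMr// => he; have := cabs_ge0 h; nra.
- move=> s' s's e e0; have [N0 HN0] := quot s' (e / 2) s's (divr_gt0 e0 (ltr0n _ 2)).
  exists N0 => N w NN ws'.
  have ws : cabs w < s by apply: lt_trans s's.
  have [N1 HN1] := Hf1 w ws (e / 2) (divr_gt0 e0 (ltr0n _ 2)).
  have := HN0 N (maxn N0 N1) w NN (leq_maxl _ _) ws'.
  have := HN1 (maxn N0 N1) (leq_maxr _ _).
  have := cabs_tri (F1 (maxn N0 N1) w) (F1 N w) (f1 w); lra.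
Qed.

Lemma cabs_line (w z : C) (r t : R) : 0 <= t <= 1 -> cabs w <= r -> cabs z <= r ->
  cabs (w + t%:C * (z - w)) <= r.
Proof.
move=> /andP[t0 t1] hp hq.
have -> : w + t%:C * (z - w) = (1 - t)%:C * w + t%:C * z.
  by rewrite rmorphB rmorph1; ring.
rewrite (le_trans (cabsD _ _))// !cabsM !cabsR !ger0_norm ?subr_ge0//.
have h1 : t * cabs z <= t * r by rewrite ler_wpM2l.
have h2 : (1 - t) * cabs w <= (1 - t) * r by rewrite ler_wpM2l ?subr_ge0.
by have := lerD h2 h1; rewrite -mulrDl subrK mul1r.
Qed.

Lemma exp_small (q e : R) : 0 <= q < 1 -> 0 < e ->
  exists N0, forall N, (N0 <= N)%N -> q ^+ N <= e.
Proof.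
move=> /andP[q0 q1] e0.
have : q ^+ n @[n --> \oo] --> (0 : R) by apply: cvg_expr; rewrite ger0_norm.
move/cvgrPdist_le/(_ e e0) => [N0 _ H]; exists N0 => N NN.
by have := H N NN; rewrite sub0r normrN ger0_norm// exprn_ge0.
Qed.

(* Deform the circle |z| = r to the point w; along the way the average of
   f (w + t (z - w)) z is a telescoping sum up to the error of differentiability. *)
Lemma cauchy_formula_uniform (G f : C -> C) (r r1 q M : R) : 0 < r -> r < r1 -> 0 <= q < 1 ->
  (forall z, cabs z < r1 -> cdiff G z (f z)) ->
  (forall e : R, 0 < e -> exists2 dl : R, 0 < dl & forall z z', cabs z <= r -> cabs z' <= r ->
     cabs (z' - z) < dl -> cabs (G z' - G z - f z * (z' - z)) <= e * cabs (z' - z)) ->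
  (forall z, cabs z <= r -> cabs (G z) <= M) ->
  forall e : R, 0 < e -> exists N0, forall N w, (N0 <= N)%N -> cabs w <= q * r ->
    cabs (cauchy_avg G r 0 N w - G w) <= e.
Proof.
move=> r0 rr1 /andP[q0 q1] Gd UD GM e e0.
have q1' : 0 < 1 - q by rewrite subr_gt0.
have M0 : 0 <= M by apply: le_trans (GM 0 _); rewrite ?cabs_ge0// cabs0 ltW.
pose e' := e / (4 * r).
have e'0 : 0 < e' by rewrite divr_gt0// mulr_gt0.
have [dl dl0 Hdl] := UD e' e'0.
have [N1 HN1] := om_near1 (divr_gt0 dl0 r0).
have [||N2 HN2] := @exp_small q (e * (1 - q) / (2 * (M + 1))); first by rewrite q0.
  by rewrite divr_gt0 ?mulr_gt0//; lra.
exists (maxn (maxn N1 N2) 2) => N w; rewrite !geq_max => /andP[/andP[h1 h2] N_2] wq.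
have N0 : (0 < N)%N by apply: leq_trans N_2.
have qr : q * r < r by rewrite gtr_pMl.
have wr : cabs w <= r by rewrite (le_trans wq)// ltW.
have circ z : cabs z = r -> [/\ z != 0, z - w != 0 & cabs (z / (z - w)) <= (1 - q)^-1].
  move=> zr; have [zw zb] := cabs_kernel qr zr wq.
  have z0 : z != 0 by rewrite -cabs_eq0 zr gt_eqF.
  split => //; rewrite cabsM zr.
  have -> : (1 - q)^-1 = r * (r - q * r)^-1.
    by field; rewrite !gt_eqF// subr_gt0.
  by rewrite ler_wpM2l// ltW.
(* Among the terms a < N of the geometric expansion of z / (z - w), averaging keeps only a = 0; the
   remainder is at most q^N / (1 - q). *)
have k1 : cabs (avg N (fun z => z / (z - w)) r - 1) <= q ^+ N / (1 - q).
  have -> : avg N (fun z => z / (z - w)) r = avg N (fun z => \sum_(a < N) w ^+ a * z ^- a) r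
      + avg N (fun z => (w / z) ^+ N * (z / (z - w))) r.
    rewrite -[X in _ = _ + X]opprK -[X in _ - X]mulN1r -avgZ -avgB.
    apply: eq_avg => z; rewrite gtr0_norm// => zr.
    have [z0 zw _] := circ z zr; rewrite {1}(kernel_geometric N z0 zw).
    by rewrite mulN1r opprK.
  have -> : avg N (fun z => \sum_(a < N) w ^+ a * z ^- a) r = 1.
    rewrite avg_sum (eq_bigr (fun a : 'I_N => if (N %| a)%N then 1 else 0)) => [|a _].
      rewrite (bigD1 (Ordinal N0))//= dvdn0 big1 ?addr0// => a an.
      rewrite gtnNdvd// lt0n; apply: contra an => /eqP a0; exact/eqP/val_inj.
    rewrite avgZ avgVX//; case: ifP => [|_]; last by rewrite mulr0.
    have [->|an] := posnP a; first by rewrite !expr0 mul1r invr1.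
    by rewrite gtnNdvd.
  rewrite addrAC subrr add0r; apply: cabs_avg => // z; rewrite gtr0_norm// => zr.
  have [_ _ kb] := circ z zr.
  rewrite cabsM cabsX (cabsM w) cabsV zr.
  have wr0 : 0 <= cabs w / r by rewrite divr_ge0 ?cabs_ge0 ?(ltW r0).
  apply: ler_pM => //; rewrite ?exprn_ge0 ?cabs_ge0//.
  by apply: lerXn2r; rewrite ?nnegrE// ler_pdivrMr.
(* [phi 1] is the Cauchy average at w and [phi 0] is G w times the average of z / (z - w), which is
   near 1. The derivative of [phi] is [psi], since the factor z - w cancels. *)
pose phi (t : R) : C := avg N (fun z => G (w + t%:C * (z - w)) * (z / (z - w))) r.
pose psi (t : R) : C := avg N (fun z => f (w + t%:C * (z - w)) * z) r.
have circ_om j : cabs (r%:C * om R N ^+ j) = r.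
  by rewrite cabsM cabsR cabsX cabs_om expr1n mulr1 gtr0_norm.
have dphi (t : R) : 0 <= t <= 1 -> rcdiff phi t (psi t).
  move=> t01; rewrite /phi /psi /avg; apply: rcdiffZ; apply: rcdiff_sum => j.
  set z := _ * _; have zr : cabs z = r by apply: circ_om.
  have [z0 zw _] := circ z zr.
  have -> : f (w + t%:C * (z - w)) * z = z / (z - w) * (f (w + t%:C * (z - w)) * (z - w)).
    by field.
  have -> : (fun t => G (w + t%:C * (z - w)) * (z / (z - w))) =
     (fun t => z / (z - w) * G (w + t%:C * (z - w))).
    by apply/funext => u; rewrite mulrC.
  apply: rcdiffZ; apply: rcdiff_line; apply: Gd.
  by rewrite (le_lt_trans _ rr1)// cabs_line// zr.
have om1 : om R N - 1 != 0 by rewrite subr_eq0 -[om R N]expr1 om_neq1.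
have psib (t : R) : 0 <= t <= 1 -> cabs (psi t - 0) <= e' * r.
  (* The telescoping identity has to be divided by t. At t = 0 the average of z itself vanishes, as
     N >= 2. *)
  move=> t01; rewrite subr0; have [->|tn0] := eqVneq t 0.
    rewrite /psi (@eq_avg R N _ (fun z => f w * z ^+ 1)); last first.
      by move=> z _; rewrite rmorph0 mul0r addr0 expr1.
    rewrite avgZ avgX// dvdn1 gtn_eqF// mulr0 cabs0.
    by rewrite mulr_ge0// ltW.
  have /andP[t0 t1] := t01; have tp : 0 < t by rewrite lt_def tn0.
  pose a j := G (w + t%:C * (r%:C * om R N ^+ j - w)).
  have tel : \sum_(0 <= j < N) (a j.+1 - a j) = 0.
    by rewrite telescope_sumr// /a om_N// expr0 subrr.
  pose S := \sum_(j < N) f (w + t%:C * (r%:C * om R N ^+ j - w)) * (r%:C * om R N ^+ j).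
  have bS : cabs (t%:C * (om R N - 1) * S) <= e' * (t * (r * cabs (om R N - 1))) * N%:R.
    have -> : t%:C * (om R N - 1) * S =
      - \sum_(j < N) (a j.+1 - a j - f (w + t%:C * (r%:C * om R N ^+ j - w)) *
         (t%:C * (r%:C * om R N ^+ j * (om R N - 1)))).
      rewrite sumrB -(big_mkord xpredT (fun j => a j.+1 - a j)) tel sub0r opprK.
      by rewrite /S mulr_sumr; apply: eq_bigr => j _; ring.
    rewrite cabsN (le_trans (cabs_sum _ _ _))// mulr_natr.
    rewrite -[X in _ *+ X]card_ord -sumr_const; apply: ler_sum => j _.
    pose zj := w + t%:C * (r%:C * om R N ^+ j - w).
    pose zj' := w + t%:C * (r%:C * om R N ^+ j.+1 - w).
    have E : t%:C * (r%:C * om R N ^+ j * (om R N - 1)) = zj' - zj.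
      by rewrite /zj /zj' exprSr; ring.
    have cE : cabs (zj' - zj) = t * (r * cabs (om R N - 1)).
      by rewrite -E cabsM cabsM circ_om cabsR gtr0_norm.
    rewrite E -cE; apply: Hdl; rewrite ?cabs_line ?circ_om//.
    rewrite cE; have := HN1 N h1; rewrite ltr_pdivlMr// [X in X < _]mulrC => h.
    by rewrite (le_lt_trans _ h)// ler_piMl// mulr_ge0 ?cabs_ge0// ltW.
  rewrite /psi /avg -/S cabsM cabsV cabs_nat mulrC ler_pdivrMr ?ltr0n//.
  have p : 0 < t * cabs (om R N - 1) by rewrite mulr_gt0// cabs_gt0.
  rewrite -(ler_pM2l p); move: bS; rewrite !cabsM cabsR gtr0_norm// => /le_trans; apply.
  by apply/eqW; ring.
have := rcdiff_mvt dphi psib; rewrite subr0 => mv.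
have phi1 : phi 1 = cauchy_avg G r 0 N w.
  apply: eq_avg => z _; rewrite rmorph1 mul1r [w + _]addrC subrK fact0 mul1r expr1//.
have phi0 : phi 0 = G w * avg N (fun z => z / (z - w)) r.
  by rewrite -avgZ; apply: eq_avg => z _; rewrite rmorph0 mul0r addr0.
have -> : cauchy_avg G r 0 N w - G w = (phi 1 - phi 0) + G w * (avg N (fun z => z / (z - w)) r - 1).
  by rewrite phi1 phi0; ring.
rewrite (le_trans (cabsD _ _))//.
have b1 : 2 * (e' * r) = e / 2 by rewrite /e'; field; rewrite gt_eqF.
have b2 : cabs (G w * (avg N (fun z => z / (z - w)) r - 1)) <= e / 2.
  rewrite cabsM; have := HN2 N h2; rewrite ler_pdivlMr; last lra.
  move=> hq; have : cabs (G w) * cabs (avg N (fun z => z / (z - w)) r - 1) <=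
    (M + 1) * (q ^+ N / (1 - q)).
    rewrite ler_pM ?cabs_ge0//; have := GM w wr; lra.
  move/le_trans; apply; rewrite mulrA ler_pdivrMr//; lra.
lra.
Qed.

(** Compactness by bisection: if no dl works, violating pairs z, z' at ever smaller distance
    accumulate at a point of modulus below r1. There f is continuous, and the mean value inequality
    along the segment from z to z' excludes them. *)
Lemma unif_diff (G f : C -> C) (r r1 : R) : 0 < r -> r < r1 ->
  (forall z, cabs z < r1 -> cdiff G z (f z)) ->
  (forall z, cabs z < r1 -> exists d, cdiff f z d) ->
  (forall e : R, 0 < e -> exists2 dl : R, 0 < dl & forall z z', cabs z <= r -> cabs z' <= r ->
     cabs (z' - z) < dl -> cabs (G z' - G z - f z * (z' - z)) <= e * cabs (z' - z)).
Proof.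
move=> r0 rr1 Gd fd e e0; apply: contrapT => no.
pose vio (dl : R) z z' := [/\ cabs z <= r, cabs z' <= r, cabs (z' - z) < dl &
  e * cabs (z' - z) < cabs (G z' - G z - f z * (z' - z))].
(* Maps the unit interval of [bisection] onto [-r, r], so that the unit square covers the disc. *)
pose cd (u : R) := - r + 2 * r * u.
have [||u0 [v0 Hb]] := @bisection R (fun u v n => forall dl : R, 0 < dl -> exists z z',
   [/\ vio dl z z', cd u <= complex.Re z <= cd (u + 2^-1 ^+ n)
     & cd v <= complex.Im z <= cd (v + 2^-1 ^+ n)]).
- move=> dl dl0; apply: contrapT => no'; apply: no; exists dl => // z z' zr z'r zz'.
  rewrite leNgt; apply/negP => lt; apply: no'; exists z, z'; split => //.
  + have := le_trans (Re_le_cabs z) zr; rewrite ler_norml /cd expr0; lra.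
  + have := le_trans (Im_le_cabs z) zr; rewrite ler_norml /cd expr0; lra.
- move=> u v n H; apply: contrapT => no'.
  have {}no' (i j : bool) : exists dl : R, 0 < dl /\ forall z z', vio dl z z' ->
     cd (u + i%:R * 2^-1 ^+ n.+1) <= complex.Re z <= cd (u + i%:R * 2^-1 ^+ n.+1 + 2^-1 ^+ n.+1) ->
     cd (v + j%:R * 2^-1 ^+ n.+1) <= complex.Im z <= cd (v + j%:R * 2^-1 ^+ n.+1 + 2^-1 ^+ n.+1)
       -> False.
    apply: contrapT => no2; apply: no'; exists i, j => dl dl0.
    apply: contrapT => no3; apply: no2; exists dl; split => // z z' h1 h2 h3.
    by apply: no3; exists z, z'.
  have [d1 [d10 H1]] := no' false false; have [d2 [d20 H2]] := no' false true.
  have [d3 [d30 H3]] := no' true false; have [d4 [d40 H4]] := no' true true.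
  have [|z [z' [[zr z'r zd vi] /andP[a1 a2] /andP[b1 b2]]]] :=
    H (Num.min (Num.min d1 d2) (Num.min d3 d4)); first by rewrite !lt_min d10 d20 d30.
  move: zd; rewrite !lt_min => /andP[/andP[l1 l2] /andP[l3 l4]].
  rewrite !mul0r !mul1r !addr0 in H1 H2 H3 H4.
  have hS : 2^-1 ^+ n = 2^-1 ^+ n.+1 + 2^-1 ^+ n.+1 :> R.
    by rewrite exprS; set t := _ ^+ n; lra.
  rewrite hS !addrA in a2 b2.
  have [c1|/ltW c1] := leP (complex.Re z) (cd (u + 2^-1 ^+ n.+1));
  have [c2|/ltW c2] := leP (complex.Im z) (cd (v + 2^-1 ^+ n.+1)).
  + by apply: (H1 z z'); rewrite ?a1 ?b1//; split.
  + by apply: (H2 z z'); rewrite ?a1 ?c2//; split.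
  + by apply: (H3 z z'); rewrite ?c1 ?b1//; split.
  + by apply: (H4 z z'); rewrite ?c1 ?c2//; split.
pose z0 := Complex (cd u0) (cd v0).
have near_z0 (t : R) : 0 < t -> exists z z', vio t z z' /\ cabs (z - z0) < t.
  move=> t0; have [n Hn] := half_pow_lt (divr_gt0 t0 (mulr_gt0 (ltr0n R 4) r0)).
  have [u [v [/(_ t t0)[z [z' [vi /andP[a1 a2] /andP[b1 b2]]]] /andP[c1 c2] /andP[d1 d2] _]]] := Hb n.
  exists z, z'; split => //; move: Hn; rewrite ltr_pdivlMr ?mulr_gt0// => Hn.
  rewrite (le_lt_trans (cabs_le_ReIm _))//; case: z {vi} a1 a2 b1 b2 => x y /= a1 a2 b1 b2.
  have aux (w p x0 : R) : p <= x0 -> x0 <= p + 2^-1 ^+ n -> cd p <= w -> w <= cd (p + 2^-1 ^+ n) ->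
      `|w - cd x0| <= 2 * r * 2^-1 ^+ n.
    move=> k1 k2 k3 k4; have r2 : 0 <= 2 * r by lra.
    have := ler_wpM2l r2 k1; have := ler_wpM2l r2 k2; rewrite /cd in k3 k4 *.
    by rewrite ler_norml; lra.
  have := aux x u u0 c1 c2 a1 a2; have := aux y v v0 d1 d2 b1 b2; lra.
have z0r : cabs z0 < r1.
  have rr : 0 < r1 - r by rewrite subr_gt0.
  have [z [z' [[zr _ _ _] zz]]] := near_z0 _ rr.
  by have := cabsB_ge z0 z; rewrite (cabsBC z0); lra.
have [d Hd] := fd z0 z0r.
have [dl dl0 Hdl] := cdiff_continuous Hd (divr_gt0 e0 (ltr0n R 4)).
have [z [z' [[zr z'r zd vi] zz]]] := near_z0 _ (divr_gt0 dl0 (ltr0n R 2)).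
have := @rcdiff_mvt R (fun t => G (z + t%:C * (z' - z))) (fun t => f (z + t%:C * (z' - z)) * (z' - z))
  (f z * (z' - z)) (e / 2 * cabs (z' - z)).
rewrite rmorph1 rmorph0 mul1r mul0r addr0 (addrC z) subrK => mv.
have : cabs (G z' - G z - f z * (z' - z)) <= 2 * (e / 2 * cabs (z' - z)).
  apply: mv => t t01.
    by apply: rcdiff_line; apply: Gd; rewrite (le_lt_trans _ rr1)// cabs_line.
  rewrite -mulrBl cabsM ler_wpM2r ?cabs_ge0//.
  have h1 : cabs (f (z + t%:C * (z' - z)) - f z0) < e / 4.
    apply: Hdl; have -> : z + t%:C * (z' - z) - z0 = (z - z0) + t%:C * (z' - z) by ring.
    rewrite (le_lt_trans (cabsD _ _))// cabsM cabsR.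
    have /andP[t0 t1] := t01; rewrite ger0_norm//.
    have : t * cabs (z' - z) <= cabs (z' - z) by rewrite ler_piMl ?cabs_ge0.
    lra.
  have h2 : cabs (f z - f z0) < e / 4 by apply: Hdl; lra.
  have := cabs_tri (f z0) (f (z + t%:C * (z' - z))) (f z); rewrite (cabsBC (f z0)); lra.
have -> : 2 * (e / 2 * cabs (z' - z)) = e * cabs (z' - z) by field.
by rewrite leNgt vi.
Qed.

End CauchyKernel.

(** * Taylor expansion in one variable *)

Section Taylor.
Variable R : realType.
Local Notation "x %:C" := (real_complex R x) : ring_scope.
Local Notation C := R[i].

Definition hol (rho M : R) (g : C -> C) :=
  (forall z, cabs z < rho -> exists d, cdiff g z d) /\
  (forall z, cabs z < rho -> cabs (g z) <= M).

Lemma taylor_const_ge0 (M r s : R) a : 0 <= M -> 0 <= r -> s < r ->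
  0 <= M * (a`!%:R * r * ((a.+1 ^ 2)%:R * (r - s)^-1 ^+ a.+3)).
Proof.
move=> M0 r0 sr; apply: mulr_ge0 => //; apply: mulr_ge0; apply: mulr_ge0 => //.
by apply: exprn_ge0; rewrite invr_ge0 subr_ge0 ltW.
Qed.

(* Goursat gives a primitive, Cauchy's formula for the primitive shows that g is
   locally Lipschitz-differentiable, and this yields Cauchy's formula for g. *)
Lemma cauchy_formula (g : C -> C) (rho M r q e : R) : hol rho M g ->
  0 < r -> r < rho -> 0 <= q < 1 -> 0 < e ->
  exists N0, forall N w, (N0 <= N)%N -> cabs w <= q * r ->
    cabs (cauchy_avg g r 0 N w - g w) <= e.
Proof.
move=> [gd gM] r0 rrho q01 e0.
have M0 : 0 <= M by apply: le_trans (gM 0 _); rewrite ?cabs_ge0// cabs0 (lt_trans r0).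
(* Nested radii r < s2 < s1 < r2 < r3 < rho with gaps t: the primitive G lives on r3, its Cauchy
   formula is taken on the circle r2, its first derivative g is reached on s1, and the derivative of
   g on s2. *)
pose t := (rho - r) / 5.
have t0 : 0 < t by rewrite divr_gt0// subr_gt0.
pose r2 := r + 3 * t; pose r3 := r + 4 * t; pose s1 := r + 2 * t; pose s2 := r + t.
have r30 : 0 < r3 by rewrite /r3; lra.
have r3rho : r3 < rho by rewrite /r3 /t; lra.
have [G HG] := disc_primitive r30 r3rho gd.
have r20 : 0 < r2 by rewrite /r2; lra.
have r23 : r2 < r3 by rewrite /r2 /r3; lra.
have gd3 z : cabs z < r3 -> exists d, cdiff g z d.
  by move=> zr; apply: gd; apply: lt_trans r3rho.
have UDG := unif_diff r20 r23 HG gd3.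
pose MG := cabs (G 0) + 2 * (M * r2).
have GM z : cabs z <= r2 -> cabs (G z) <= MG.
  move=> zr2.
  have := @rcdiff_mvt R (fun t => G (0 + t%:C * (z - 0))) (fun t => g (0 + t%:C * (z - 0)) * (z - 0))
    0 (M * r2).
  rewrite rmorph1 rmorph0 mul1r mul0r !add0r !subr0 => mv.
  have := cabsB_ge (G z) (G 0).
  have : cabs (G z - G 0) <= 2 * (M * r2).
    apply: mv => u u01.
      by apply: rcdiff_line; apply: HG; rewrite (le_lt_trans _ r23)// -[z in X in cabs X]subr0 cabs_line ?cabs0 ?(ltW r20).
    rewrite !add0r !subr0 cabsM ler_pM ?cabs_ge0// gM// (lt_trans _ r3rho)// (le_lt_trans _ r23)//.
    have := @cabs_line R 0 z r2 u u01; rewrite add0r subr0; apply => //.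
    by rewrite cabs0 ltW.
  rewrite /MG; lra.
have s10 : 0 < s1 by rewrite /s1; lra.
have s1r2 : s1 < r2 by rewrite /s1 /r2; lra.
have qs : 0 <= s1 / r2 < 1.
  by rewrite divr_ge0 ?ltW//= ltr_pdivrMr// mul1r.
have CG := cauchy_formula_uniform r20 r23 qs HG UDG GM.
have MG0 : 0 <= MG by rewrite /MG addr_ge0 ?cabs_ge0// !mulr_ge0// ltW.
have lip (s : R) a : s < r2 -> 0 <= MG * (a`!%:R * r2 * ((a.+1 ^ 2)%:R * (r2 - s)^-1 ^+ a.+3)).
  by move=> sr; apply: taylor_const_ge0 => //; exact: ltW.
have GMc z : cabs z = r2 -> cabs (G z) <= MG by move=> zr; apply: GM; rewrite zr.
have [|G1 [G1d _ G1c]] := limit_cdiff s10 (lip s1 0%N s1r2)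
  (fun N w h N0 ws whs => cauchy_avg_taylor 0 N0 r20 s1r2 GMc (ltW ws) (ltW whs)) (f := G).
  move=> e' e'0; have [N0 HN0] := CG e' e'0; exists N0 => N w NN ws; apply: HN0 => //.
  by rewrite divfK ?gt_eqF// ltW.
have s20 : 0 < s2 by rewrite /s2; lra.
have s2r2 : s2 < r2 by rewrite /s2 /r2; lra.
have s2s1 : s2 < s1 by rewrite /s2 /s1; lra.
have [|g1 [g1d g1t _]] := limit_cdiff s20 (lip s2 1%N s2r2)
  (fun N w h N0 ws whs => cauchy_avg_taylor 1 N0 r20 s2r2 GMc (ltW ws) (ltW whs)) (f := g).
  move=> e' e'0; have [N0 HN0] := G1c s2 s2s1 e' e'0; exists N0 => N w NN ws.
  have := HN0 N w NN ws; suff -> : G1 w = g w by [].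
  have ws1 : cabs w < s1 by apply: lt_trans s2s1.
  by apply: (cdiff_unique (G1d w ws1) (HG w _)); rewrite (lt_trans ws1)// /s1 /r3; lra.
move: g1t; set K := MG * _ => g1t.
have K0 : 0 <= K by apply: lip.
have rs2 : r < s2 by rewrite /s2; lra.
apply: (cauchy_formula_uniform r0 rs2 q01 g1d (M := M)) => //; last first.
  by move=> z zr; apply: gM; apply: le_lt_trans rrho.
move=> e' e'0; exists (e' / (K + 1)); first by rewrite divr_gt0//; lra.
move=> z z' zr z'r; rewrite ltr_pdivlMr; last lra.
move=> zz; have := g1t z (z' - z); rewrite (addrC z) subrK => h.
apply: (le_trans (h _ _)); [exact: le_lt_trans rs2|exact: le_lt_trans rs2|].
rewrite expr2 mulrA ler_wpM2r ?cabs_ge0//.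
have := cabs_ge0 (z' - z); nra.
Qed.

Definition cder (g : C -> C) (z : C) : C := xget 0 [set d | cdiff g z d].

Lemma cderP g z d : cdiff g z d -> cder g z = d.
Proof.
move=> H; rewrite /cder; case: xgetP => [d' _ H'|/(_ d)//].
exact: cdiff_unique H' H.
Qed.

(** Induction on a, starting from Cauchy's formula: if the averages of order a converge to the a-th
    derivative, [limit_cdiff] shows that this limit is differentiable and that the averages of order
    a + 1 converge to its derivative. *)
Lemma iter_cder_cvg (g : C -> C) (rho M r : R) a : hol rho M g -> 0 < r -> r < rho ->
  (forall s e : R, s < r -> 0 < e -> exists N0, forall N w, (N0 <= N)%N -> cabs w < s ->
    cabs (cauchy_avg g r a N w - iter a cder g w) <= e) /\
  (forall w, cabs w < r -> cdiff (iter a cder g) w (iter a.+1 cder g w)).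
Proof.
move=> gh r0 rrho.
have gM z : cabs z = r -> cabs (g z) <= M by move=> zr; apply: gh.2; rewrite zr.
have M0 : 0 <= M.
  by apply: le_trans (gM r%:C _); rewrite ?cabs_ge0// cabsR gtr0_norm.
have step a' (f : C -> C) : (forall s e : R, s < r -> 0 < e -> exists N0, forall N w, (N0 <= N)%N ->
    cabs w < s -> cabs (cauchy_avg g r a' N w - f w) <= e) ->
  (forall w, cabs w < r -> cdiff f w (cder f w)) /\
  (forall s e : R, s < r -> 0 < e -> exists N0, forall N w, (N0 <= N)%N ->
    cabs w < s -> cabs (cauchy_avg g r a'.+1 N w - cder f w) <= e).
  move=> cv.
  have main (s : R) : 0 < s -> s < r -> (forall w, cabs w < s -> cdiff f w (cder f w)) /\
    (forall s' e : R, s' < s -> 0 < e -> exists N0, forall N w, (N0 <= N)%N ->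
    cabs w < s' -> cabs (cauchy_avg g r a'.+1 N w - cder f w) <= e).
    move=> s0 sr.
    have lip : 0 <= M * (a'`!%:R * r * ((a'.+1 ^ 2)%:R * (r - s)^-1 ^+ a'.+3)).
      by apply: taylor_const_ge0 => //; exact: ltW.
    have [|f1 [f1d _ f1c]] := limit_cdiff s0 lip
     (fun N w h N0 ws whs => cauchy_avg_taylor a' N0 r0 sr gM (ltW ws) (ltW whs)) (f := f).
      by move=> e e0; have [N0 HN0] := cv s e sr e0; exists N0.
    split=> [w ws|s' e s's e0]; first by rewrite (cderP (f1d w ws)); apply: f1d.
    have [N0 HN0] := f1c s' s's e e0; exists N0 => N w NN ws'.
    by rewrite (cderP (f1d w (lt_trans ws' s's))); apply: HN0.
  split=> [w wr|s e sr e0].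
    have c0 := cabs_ge0 w.
    have [||h _] := main ((cabs w + r) / 2); [lra|lra|]; apply: h; lra.
  have [s1|s1] := leP s 0.
    exists 0%N => N w _ ws; have := cabs_ge0 w; lra.
  have [||_ h] := main ((s + r) / 2); [lra|lra|]; apply: h => //; lra.
elim: a => [|a [IH _]]; last first.
  have [d1 c1] := step a _ IH; split; first exact: c1.
  by have [d2 c2] := step a.+1 _ c1.
have c0 (s e : R) : s < r -> 0 < e -> exists N0, forall N w, (N0 <= N)%N ->
    cabs w < s -> cabs (cauchy_avg g r 0 N w - iter 0 cder g w) <= e.
  move=> sr e0 /=; have [s1|s1] := leP s 0.
    exists 0%N => N w _ ws; have := cabs_ge0 w; lra.
  have q01 : 0 <= s / r < 1 by rewrite divr_ge0 ?ltW//= ltr_pdivrMr// mul1r.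
  have [N0 HN0] := cauchy_formula gh r0 rrho q01 e0.
  exists N0 => N w NN ws; apply: HN0 => //.
  by rewrite divfK ?gt_eqF// ltW.
by split => //; have [] := step 0%N _ c0.
Qed.

Lemma iter_cder_cdiff (g : C -> C) (rho M : R) a w : hol rho M g -> cabs w < rho ->
  cdiff (iter a cder g) w (iter a.+1 cder g w).
Proof.
move=> gh wr; have c0 := cabs_ge0 w.
have [||_ h] := @iter_cder_cvg g rho M ((cabs w + rho) / 2) a gh; [lra|lra|].
apply: h; lra.
Qed.

Definition tcoef (g : C -> C) a : C := iter a cder g 0 / a`!%:R.

Lemma fact_neq0 a : a`!%:R != 0 :> C.
Proof. by rewrite pnatr_eq0 -lt0n fact_gt0. Qed.

Lemma avg_cvg_tcoef (g : C -> C) (rho M r : R) a (e : R) : hol rho M g -> 0 < r -> r < rho ->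
  0 < e -> exists N0, forall N, (N0 <= N)%N ->
    cabs (avg N (fun z => g z * z ^- a) r - tcoef g a) <= e.
Proof.
move=> gh r0 rrho e0; have [h _] := iter_cder_cvg a gh r0 rrho.
have [||N0 HN0] := h (r / 2) e => //; first lra.
exists N0 => N NN.
have := HN0 N 0 NN; rewrite cabs0 => /(_ (divr_gt0 r0 (ltr0n _ 2))).
have -> : cauchy_avg g r a N 0 = a`!%:R * avg N (fun z => g z * z ^- a) r.
  rewrite -avgZ; apply: eq_avg => z; rewrite gtr0_norm// => zr.
  have z0 : z != 0 by rewrite -cabs_eq0 zr gt_eqF.
  by rewrite subr0 exprS; field; rewrite z0 expf_neq0.
have -> : iter a cder g 0 = a`!%:R * tcoef g a.
  by rewrite /tcoef mulrCA mulfV ?mulr1// fact_neq0.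
rewrite -mulrBr cabsM cabs_nat; apply: le_trans.
by rewrite ler_peMl ?cabs_ge0// ler1n fact_gt0.
Qed.

Lemma tcoef_bound (g : C -> C) (rho M r : R) a : hol rho M g -> 0 < r -> r < rho ->
  cabs (tcoef g a) <= M * r ^- a.
Proof.
move=> gh r0 rrho; apply/ler_addgt0Pr => e e0.
have [N0 HN0] := avg_cvg_tcoef a gh r0 rrho e0.
have := HN0 (maxn N0 1) (leq_maxl _ _).
set A := avg _ _ _ => h1.
have h2 : cabs A <= M * r ^- a.
  apply: cabs_avg => [|z]; first by rewrite leq_maxr.
  rewrite gtr0_norm// => zr; rewrite cabsM cabsV cabsX zr ler_wpM2r ?invr_ge0 ?exprn_ge0 ?(ltW r0)//.
  by apply: gh.2; rewrite zr.
have := cabsB_ge (tcoef g a) A; rewrite (cabsBC (tcoef g a)); lra.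
Qed.

Lemma cvg_sum_finite n (u : nat -> nat -> C) (l : nat -> C) :
  (forall a (e : R), 0 < e -> exists N0, forall N, (N0 <= N)%N -> cabs (u a N - l a) <= e) ->
  forall e : R, 0 < e -> exists N0, forall N, (N0 <= N)%N ->
    cabs (\sum_(a < n) u a N - \sum_(a < n) l a) <= e.
Proof.
move=> H; elim: n => [|n IH] e e0.
  by exists 0%N => N _; rewrite !big_ord0 subrr cabs0 ltW.
have e2 : 0 < e / 2 by rewrite divr_gt0.
have [N1 H1] := IH _ e2; have [N2 H2] := H n _ e2.
exists (maxn N1 N2) => N; rewrite geq_max => /andP[/H1 h1 /H2 h2].
rewrite !big_ord_recr /= opprD addrACA (le_trans (cabsD _ _))//; lra.
Qed.

(** In the discrete Cauchy formula the kernel is expanded to n terms with its exact remainder, which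
    is at most q^n / (1 - q) on the circle; N then tends to infinity with n fixed. *)
Lemma taylor_error (g : C -> C) (rho M r q : R) n w : hol rho M g -> 0 < r -> r < rho ->
  0 <= q < 1 -> cabs w <= q * r ->
  cabs (g w - \sum_(a < n) tcoef g a * w ^+ a) <= M * q ^+ n / (1 - q).
Proof.
move=> gh r0 rrho q01 wq; have /andP[q0 q1] := q01.
apply/ler_addgt0Pr => e e0; have e2 : 0 < e / 2 by rewrite divr_gt0.
have [N1 H1] := cauchy_formula gh r0 rrho q01 e2.
have [|N2 H2] := @cvg_sum_finite n (fun a N => avg N (fun z => g z * z ^- a) r * w ^+ a)
  (fun a => tcoef g a * w ^+ a) _ _ e2.
  move=> a e' e'0; have w1 : 0 < 1 + cabs (w ^+ a) by rewrite ltr_pwDl ?cabs_ge0.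
  have [N0 HN0] := avg_cvg_tcoef a gh r0 rrho (divr_gt0 e'0 w1).
  exists N0 => N /HN0 h; rewrite -mulrBl cabsM.
  move: h; rewrite ler_pdivlMr// => h; apply: le_trans h.
  by rewrite ler_wpM2l ?cabs_ge0// lerDr.
pose N := maxn (maxn N1 N2) 1.
have NN1 : (N1 <= N)%N by rewrite /N; lia.
have NN2 : (N2 <= N)%N by rewrite /N; lia.
have N0 : (0 < N)%N by rewrite /N; lia.
have h1 := H1 N w NN1 wq; have h2 := H2 N NN2.
have qr : q * r < r by rewrite gtr_pMl.
have E : cauchy_avg g r 0 N w = \sum_(a < n) avg N (fun z => g z * z ^- a) r * w ^+ a +
    avg N (fun z => g z * ((w / z) ^+ n * (z / (z - w)))) r.
  rewrite -[X in _ = _ + X]opprK -[X in _ - X]mulN1r -avgZ.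
  have -> : \sum_(a < n) avg N (fun z => g z * z ^- a) r * w ^+ a =
      avg N (fun z => \sum_(a < n) w ^+ a * (g z * z ^- a)) r.
    by rewrite avg_sum; apply: eq_bigr => a _; rewrite avgZ mulrC.
  rewrite -avgB; apply: eq_avg => z; rewrite gtr0_norm// => zr.
  have [zw _] := cabs_kernel qr zr wq.
  have z0 : z != 0 by rewrite -cabs_eq0 zr gt_eqF.
  rewrite fact0 mul1r expr1 {1}(kernel_geometric n z0 zw) mulN1r opprK mulrDr mulr_sumr.
  by congr (_ + _); apply: eq_bigr => a _; rewrite mulrCA.
have h3 : cabs (avg N (fun z => g z * ((w / z) ^+ n * (z / (z - w)))) r) <= M * q ^+ n / (1 - q).
  apply: cabs_avg => // z; rewrite gtr0_norm// => zr.
  have [zw zb] := cabs_kernel qr zr wq.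
  rewrite cabsM -mulrA ler_pM ?cabs_ge0 ?gh.2 ?zr//.
  rewrite cabsM cabsX (cabsM w) cabsV zr cabsM zr.
  have wr0 : 0 <= cabs w / r by rewrite divr_ge0 ?cabs_ge0 ?(ltW r0).
  apply: ler_pM; [exact: exprn_ge0|by rewrite mulr_ge0 ?cabs_ge0 ?(ltW r0)| |].
    by apply: lerXn2r; rewrite ?nnegrE// ler_pdivrMr.
  have -> : (1 - q)^-1 = r * (r - q * r)^-1.
    by field; rewrite !gt_eqF// subr_gt0.
  by rewrite ler_wpM2l// ltW.
rewrite E in h1.
set S1 := \sum_(a < n) _ in h1 h2 E; set T := avg _ _ _ in h1 h3 E.
set S2 := \sum_(a < n) _ in h2 *.
have -> : g w - S2 = - (S1 + T - g w) + (S1 - S2) + T by ring.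
have t1 := cabsD (- (S1 + T - g w) + (S1 - S2)) T.
have t2 := cabsD (- (S1 + T - g w)) (S1 - S2); have t3 := cabsN (S1 + T - g w).
lra.
Qed.

(** A rate depending on g only through M, hence uniform in a parameter as [tcoef_param] requires. On
    the smaller circle of radius q r the Taylor polynomial of degree below N is close to g, and of
    its terms the average keeps only that of degree a. *)
Lemma avg_tcoef_error (g : C -> C) (rho M r q : R) a N : hol rho M g -> 0 < r -> r < rho ->
  0 < q < 1 -> (a < N)%N ->
  cabs (avg N (fun z => g z * z ^- a) (q * r) - tcoef g a)
    <= M * q ^+ N / (1 - q) * (q * r) ^- a.
Proof.
move=> gh r0 rrho /andP[q0 q1] aN; have N0 : (0 < N)%N by apply: leq_ltn_trans aN.
have qr0 : 0 < q * r by rewrite mulr_gt0.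
have E : tcoef g a = avg N (fun z => (\sum_(b < N) tcoef g b * z ^+ b) * z ^- a) (q * r).
  have -> : avg N (fun z => (\sum_(b < N) tcoef g b * z ^+ b) * z ^- a) (q * r) =
     avg N (fun z => \sum_(b < N) tcoef g b * (z ^+ b * z ^- a)) (q * r).
    by apply: eq_avg => z _; rewrite mulr_suml; apply: eq_bigr => b _; rewrite mulrA.
  rewrite avg_sum (bigD1 (Ordinal aN))//= big1 ?addr0 => [|b ba]; last first.
    rewrite avgZ; have [ab|bla] := leqP a b.
      rewrite (@eq_avg R N _ (fun z => z ^+ (b - a))) => [|z].
        rewrite avgX// gtnNdvd ?mulr0//; last by rewrite (leq_ltn_trans (leq_subr _ _)).
        by rewrite subn_gt0 ltn_neqAle ab andbT eq_sym.
      rewrite gtr0_norm// => zr; have z0 : z != 0 by rewrite -cabs_eq0 zr gt_eqF.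
      have {1}-> : nat_of_ord b = (b - a + a)%N by rewrite subnK.
      by rewrite exprD mulfK ?expf_neq0.
    rewrite (@eq_avg R N _ (fun z => z ^- (a - b))) => [|z].
      rewrite avgVX// gtnNdvd ?mulr0//; last by rewrite (leq_ltn_trans (leq_subr _ _)).
      by rewrite subn_gt0.
    rewrite gtr0_norm// => zr; have z0 : z != 0 by rewrite -cabs_eq0 zr gt_eqF.
    by rewrite -[a in LHS](subnK (ltnW bla)) exprD invfM mulrCA mulfV ?mulr1 ?expf_neq0.
  rewrite avgZ (@eq_avg R N _ (fun z => z ^+ 0)) ?avgX ?dvdn0 ?expr0 ?mulr1// => z.
  rewrite gtr0_norm// => zr; have z0 : z != 0 by rewrite -cabs_eq0 zr gt_eqF.
  by rewrite mulfV// expf_neq0.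
rewrite E -avgB; apply: cabs_avg => // z; rewrite gtr0_norm// => zr.
rewrite -mulrBl cabsM cabsV cabsX zr ler_wpM2r ?invr_ge0 ?exprn_ge0 ?(ltW qr0)//.
by apply: (taylor_error _ gh r0 rrho); rewrite ?zr// ltW.
Qed.

End Taylor.

(** * Separately holomorphic functions and their Taylor polynomials *)

Section SeveralVariables.
Variable R : realType.
Local Notation "x %:C" := (real_complex R x) : ring_scope.
Local Notation C := R[i].

Lemma norm_cabs (z : C) : `|z| = (cabs z)%:C.
Proof. by rewrite normc_def; case: z. Qed.

(** A positive element of [R[i]] has imaginary part 0, so limits in the sense of the library reduce
    to real e and dl. *)
Lemma cvg_dnbhs0_cabs (u : C -> C^o) (l : C) :
  ((fun h : C^o => u h) @ (0 : C^o)^' --> (l : C^o)) <->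
  (forall e : R, 0 < e -> exists2 dl : R, 0 < dl & forall h, h != 0 -> cabs h < dl ->
     cabs (u h - l) <= e).
Proof.
split.
  move=> /cvgrPdist_le H e e0.
  have e0' : 0 < e%:C by rewrite ltcR.
  have [dl /= dl0 Hd] := H _ e0'.
  move: dl0; rewrite ltcE /= => /andP[/eqP dI dR].
  exists (complex.Re dl) => // h h0 hd.
  have := Hd h; rewrite /= sub0r normrN norm_cabs => /(_ _ h0).
  rewrite distrC norm_cabs lecR; apply.
  by rewrite ltcE /= dI eqxx.
move=> H; apply/cvgrPdist_le => e; rewrite ltcE /= => /andP[/eqP eI eR].
have [dl dl0 Hd] := H _ eR.
exists dl%:C; first by rewrite /= ltcR.
move=> h /=; rewrite sub0r normrN norm_cabs ltcR => hd h0.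
by rewrite distrC norm_cabs lecE /= eI eqxx Hd.
Qed.

Lemma cdiff_quotient (g : C -> C) z d : cdiff g z d <->
  (forall e : R, 0 < e -> exists2 dl : R, 0 < dl & forall h, h != 0 -> cabs h < dl ->
     cabs (h^-1 * (g (h + z) - g z) - d) <= e).
Proof.
have E h : h != 0 -> h^-1 * (g (h + z) - g z) - d = h^-1 * (g (z + h) - g z - d * h).
  by move=> h0; rewrite (addrC h); field.
split=> H e e0; have [dl dl0 Hd] := H e e0; exists dl => // h.
  move=> h0 /Hd hd; rewrite E// cabsM cabsV mulrC ler_pdivrMr// cabs_gt0//.
have [->|h0] := eqVneq h 0; first by rewrite addr0 subrr mulr0 subrr cabs0 mulr0.
by move=> /(Hd h h0); rewrite E// cabsM cabsV mulrC ler_pdivrMr// cabs_gt0.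
Qed.

Lemma cdiff_derive n (f : 'rV[C]_n -> C^o) (z v : 'rV[C]_n) d :
  cdiff (fun t => f (z + t *: v)) 0 d -> derive f (z : cvec R n) (v : cvec R n) = d.
Proof.
move=> /cdiff_quotient H; apply/cvg_lim => //.
apply/cvg_dnbhs0_cabs => e e0; have [dl dl0 Hd] := H e e0.
exists dl => // h h0 hd; have := Hd h h0 hd.
by rewrite addr0 scale0r addr0 /= (addrC z).
Qed.

Lemma differentiable_cdiff n (f : 'rV[C]_n -> C^o) (z v : 'rV[C]_n) :
  differentiable f (z : cvec R n) -> exists d, cdiff (fun t => f (z + t *: v)) 0 d.
Proof.
move=> H; have /cvg_ex[d Hd] := diff_derivable (v := (v : cvec R n)) H; exists d.
apply/cdiff_quotient => e e0; have [dl dl0 {}H] := (cvg_dnbhs0_cabs _ _).1 Hd e e0.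
exists dl => // h h0 hd; have := H h h0 hd.
by rewrite addr0 scale0r addr0 /= (addrC z).
Qed.

Lemma cdiff_shift (g : C -> C) z d : cdiff g z d <-> cdiff (fun t => g (z + t)) 0 d.
Proof. by split=> H e /H[dl dl0 Hd]; exists dl => // h /Hd; rewrite add0r addr0. Qed.

Lemma cdiffZ (c : C) (g : C -> C) z d : cdiff g z d -> cdiff (fun t => c * g t) z (c * d).
Proof.
move=> Hd e e0; have c1 : 0 < 1 + cabs c by rewrite ltr_pwDl// cabs_ge0.
have [dl dl0 H] := Hd _ (divr_gt0 e0 c1); exists dl => // h /H hh.
rewrite -!mulrA -!mulrBr cabsM.
have : cabs c * cabs (g (z + h) - g z - d * h) <= (1 + cabs c) * (e / (1 + cabs c) * cabs h).
  by rewrite ler_pM ?cabs_ge0// lerDr.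
by rewrite mulrA mulrCA mulfV ?gt_eqF// mulr1.
Qed.

Section Polydiscs.
Variable n : nat.
Implicit Types (z : 'rV[C]_n) (f : 'rV[C]_n -> C) (rho : 'I_n -> R) (s : seq 'I_n).

Definition subst z (i : 'I_n) (t : C) : 'rV[C]_n := \row_j if j == i then t else z 0 j.

Definition polydisc rho z := forall i, cabs (z 0 i) < rho i.

(** Holomorphy in each variable separately, with one bound M on the whole polydisc. This is enough
    here, since [dpartial] differentiates in one variable at a time. *)
Definition sephol rho M f :=
  forall i z, polydisc rho z -> hol (rho i) M (fun t => f (subst z i t)).

Lemma subst_id z i : subst z i (z 0 i) = z.
Proof. by apply/rowP => j; rewrite mxE; case: eqP => [->|]. Qed.

Lemma subst_subst z i t u : subst (subst z i t) i u = subst z i u.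
Proof. by apply/rowP => j; rewrite !mxE; case: eqP. Qed.

Lemma substC z i j t u : i != j -> subst (subst z i t) j u = subst (subst z j u) i t.
Proof.
move=> ij; apply/rowP => k; rewrite !mxE.
by case: (eqVneq k j) => [->|//]; rewrite eq_sym (negbTE ij).
Qed.

Lemma substD z i t h : subst z i t + h *: delta_mx 0 i = subst z i (t + h).
Proof.
apply/rowP => j; rewrite !mxE eqxx /=.
by case: (eqVneq j i) => _; rewrite ?mulr1 ?mulr0 ?addr0.
Qed.

Lemma polydisc_subst rho z i t : polydisc rho z -> cabs t < rho i -> polydisc rho (subst z i t).
Proof. by move=> zr tr j; rewrite mxE; case: eqP => [->|_]. Qed.

(** Moving z inside the polydisc in direction i does not change the one-variable function t |-> f
    (subst z i t), so the derivatives of [taylor_coef] become those of the one-variable theory. *)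
Lemma iter_partial rho M f i a z : sephol rho M f -> polydisc rho z ->
  iter a (partial i) f z = iter a (@cder R) (fun t => f (subst z i t)) (z 0 i).
Proof.
move=> Hf; elim: a z => [|a IH] z zr; first by rewrite /= subst_id.
rewrite iterS; apply: cdiff_derive.
pose dl := rho i - cabs (z 0 i); have dl0 : 0 < dl by rewrite subr_gt0.
apply: (@cdiff_local _ _ (fun t => iter a (@cder R) (fun t => f (subst z i t)) (z 0 i + t)) _ _ dl) => //.
  move=> t; rewrite subr0 => tdl.
  have zE : z + t *: delta_mx 0 i = subst z i (z 0 i + t) by rewrite -substD subst_id.
  rewrite zE IH.
    rewrite [subst _ _ _ 0 i]mxE eqxx; congr (iter a _ _ _).
    by apply/funext => u; rewrite subst_subst.
  apply: polydisc_subst => //; rewrite (le_lt_trans (cabsD _ _))//.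
  by rewrite addrC -ltrBrDr.
apply/(cdiff_shift (iter a (@cder R) (fun t => f (subst z i t)))).
exact: (iter_cder_cdiff a (Hf i z zr) (zr i)).
Qed.

(** The constant depends on g only through M, and so is uniform over the family of functions
    averaged in [tcoef_param]. *)
Lemma hol_second (rho M r s : R) (g : C -> C) (w h : C) : hol rho M g -> 0 < s -> s < r -> r < rho ->
  cabs w < s -> cabs (w + h) < s ->
  cabs (g (w + h) - g w - cder g w * h)
    <= M * (0`!%:R * r * ((1 ^ 2)%:R * (r - s)^-1 ^+ 3)) * cabs h ^+ 2.
Proof.
move=> gh s0 sr rrho ws whs; have r0 : 0 < r by apply: lt_trans sr.
have gM (z : C) : cabs z = r -> cabs (g z) <= M by move=> zr; apply: gh.2; rewrite zr.
have M0 : 0 <= M by apply: le_trans (gM r%:C _); rewrite ?cabs_ge0// cabsR gtr0_norm.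
have q01 : 0 <= s / r < 1 by rewrite divr_ge0 ?ltW//= ltr_pdivrMr// mul1r.
have [|g1 [g1d g1t _]] := limit_cdiff s0 (taylor_const_ge0 0 M0 (ltW r0) sr)
  (fun N w h N0 ws whs => cauchy_avg_taylor 0 N0 r0 sr gM (ltW ws) (ltW whs)) (f := g).
  move=> e e0; have [N0 HN0] := cauchy_formula gh r0 rrho q01 e0.
  by exists N0 => N u NN us; apply: HN0; rewrite ?divfK ?gt_eqF// ltW.
by rewrite (cderP (g1d w ws)) g1t.
Qed.

(** A Taylor coefficient in t is a limit of averages of [k u z], uniform in u by [avg_tcoef_error];
    the averages have a uniform quadratic error in u by [hol_second], so [limit_cdiff] applies. The
    bound is Cauchy's estimate. *)
Lemma tcoef_param (k : C -> C -> C) (ri rj r M : R) a :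
  0 < r -> r < ri ->
  (forall u, cabs u < rj -> hol ri M (k u)) ->
  (forall t, cabs t < ri -> hol rj M (fun u => k u t)) ->
  hol rj (M * r ^- a) (fun u => tcoef (k u) a).
Proof.
move=> r0 rri Hk Hk'; split=> [u0 ur|u ur]; last exact: tcoef_bound (Hk u ur) r0 rri.
have c0 := cabs_ge0 u0.
have M0 : 0 <= M.
  by apply: le_trans ((Hk u0 ur).2 0 _); rewrite ?cabs_ge0// cabs0 (lt_trans r0).
pose s := (2 * cabs u0 + rj) / 3; pose r' := (cabs u0 + 2 * rj) / 3.
have us : cabs u0 < s by rewrite /s; lra.
have s0 : 0 < s by apply: le_lt_trans us.
have sr : s < r' by rewrite /s /r'; lra.
have rr : r' < rj by rewrite /r'; lra.
have r'0 : 0 < r' by apply: lt_trans sr.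
pose q : R := 2^-1; have q01 : 0 < q < 1 by rewrite /q; apply/andP; split; lra.
have /andP[q0 q1] := q01.
have qr0 : 0 < q * r by rewrite mulr_gt0.
have qri : q * r < ri by rewrite (lt_trans _ rri)// gtr_pMl.
pose K := M * (0`!%:R * r' * ((1 ^ 2)%:R * (r' - s)^-1 ^+ 3)) * (q * r) ^- a.
have K0 : 0 <= K.
  by apply: mulr_ge0; [exact: taylor_const_ge0 (ltW _) _|rewrite invr_ge0 exprn_ge0// ltW].
have [||f1 [f1d _ _]] := @limit_cdiff R (fun N u => avg N (fun z : C => k u z * z ^- a) (q * r))
  (fun N u => avg N (fun z : C => cder (fun u => k u z) u * z ^- a) (q * r))
  (fun u => tcoef (k u) a) s K s0 K0; last by exists (f1 u0); apply: f1d.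
- move=> N w h N0 ws whs; rewrite [avg _ _ _ * h]mulrC -avgZ -!avgB.
  rewrite /K mulrAC; apply: cabs_avg => // z; rewrite gtr0_norm// => zr.
  have -> : k (w + h) z * z ^- a - k w z * z ^- a - h * (cder (fun u => k u z) w * z ^- a) =
    (k (w + h) z - k w z - cder (fun u => k u z) w * h) * z ^- a by ring.
  rewrite cabsM cabsV cabsX zr ler_wpM2r ?invr_ge0 ?exprn_ge0 ?(ltW qr0)//.
  apply: (@hol_second rj M r' s (fun u => k u z)) => //.
  by apply: Hk'; rewrite zr.
- move=> e e0; pose D := M / (1 - q) * (q * r) ^- a + 1.
  have D0 : 0 < D.
    by rewrite ltr_wpDl// mulr_ge0 ?divr_ge0 ?invr_ge0 ?exprn_ge0 ?(ltW qr0)// subr_ge0 ltW.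
  have [||N0 HN0] := @exp_small _ q (e / D); [by rewrite ltW|exact: divr_gt0|].
  exists (maxn N0 a.+1) => N w; rewrite geq_max => /andP[h1 h2] ws.
  have wr : cabs w < rj by apply: lt_trans ws (lt_trans sr rr).
  apply: (le_trans (avg_tcoef_error (Hk w wr) r0 rri q01 h2)).
  have := HN0 N h1; rewrite ler_pdivlMr// => hq.
  have -> : M * q ^+ N / (1 - q) * (q * r) ^- a = q ^+ N * (M / (1 - q) * (q * r) ^- a) by ring.
  apply: le_trans hq; rewrite ler_wpM2l ?exprn_ge0 ?(ltW q0)// /D; lra.
Qed.

Lemma sephol_tcoef rho M f i a (r : R) : 0 < r -> r < rho i -> sephol rho M f ->
  (forall j, 0 < rho j) -> 0 <= M ->
  sephol rho (M * r ^- a) (fun z => tcoef (fun t => f (subst z i t)) a).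
Proof.
move=> r0 rrho Hf rho0 M0 j z zr; have [<-|ij] := eqVneq i j.
  have -> : (fun t => tcoef (fun t0 => f (subst (subst z i t) i t0)) a) =
     (fun=> tcoef (fun t0 => f (subst z i t0)) a).
    apply/funext => t; congr tcoef; apply/funext => u; by rewrite subst_subst.
  split=> [u _|u _]; last exact: tcoef_bound (Hf i z zr) r0 rrho.
  exists 0 => e e0; exists 1 => // h _.
  by rewrite subrr mul0r subrr cabs0 mulr_ge0 ?cabs_ge0 ?ltW.
apply: (@tcoef_param (fun u t => f (subst (subst z j u) i t)) (rho i)) => //.
  by move=> u ur; apply: Hf; apply: polydisc_subst.
move=> t tr; have := Hf j (subst z i t) (polydisc_subst zr tr).
by congr hol; apply/funext => u; rewrite substC.
Qed.

Lemma hol_scale (rho M : R) (c : C) g : hol rho M g -> hol rho (cabs c * M) (fun t => c * g t).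
Proof.
move=> [gd gM]; split=> z zr; last by rewrite cabsM ler_wpM2l ?cabs_ge0// gM.
by have [d Hd] := gd z zr; exists (c * d); apply: cdiffZ.
Qed.

Definition zeroed s z : 'rV[C]_n := \row_j if j \in s then 0 else z 0 j.

Definition dps s (a : 'I_n -> nat) f := foldr (fun i g => iter (a i) (partial i) g) f s.

(* the Taylor coefficients of f with respect to the variables in s *)
Definition scoef f s (a : 'I_n -> nat) z := dps s a f (zeroed s z) / (\prod_(i <- s) (a i)`!)%:R.

(** The variables in s are frozen at 0 and i is not among them, so a derivative in direction i may
    be taken before or after freezing. *)
Lemma iter_partial_zeroed f s i a z : i \notin s ->
  iter a (partial i) f (zeroed s z) = iter a (partial i) (f \o zeroed s) z.
Proof.
move=> is_; elim: a z => [//|a IH] z; rewrite !iterS /partial /derive.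
apply: (congr1 (fun u : C -> C^o => lim (u @ (0 : C^o)^'))).
apply/funext => h /=; rewrite -!IH; congr (_ *: (_ - _)).
congr (iter a _ _ _); apply/rowP => j; rewrite !mxE eqxx /=.
by case: ifPn => [js|//]; case: eqP => [ji|]; rewrite ?mulr0 ?addr0// -ji js in is_ *.
Qed.

(** Peels off one variable: once s is frozen at 0, the derivatives in direction i act on a function
    of one variable, and the factorials belonging to s come out as a constant. *)
Lemma scoef_cons rho M f s i a z : (forall j, 0 < rho j) -> i \notin s ->
  sephol rho M (scoef f s a) -> polydisc rho z ->
  scoef f (i :: s) a z = tcoef (fun t => scoef f s a (subst z i t)) (a i).
Proof.
move=> rho0 is_ H zr; rewrite /scoef /=.
have -> : zeroed (i :: s) z = zeroed s (subst z i 0).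
  by apply/rowP => j; rewrite !mxE inE; case: (eqVneq j i) => [->|]; rewrite ?(negbTE is_).
rewrite iter_partial_zeroed//.
set c := (\prod_(i <- s) _)%N.
have c0 : c%:R != 0 :> C.
  by rewrite pnatr_eq0 -lt0n prodn_gt0// => j; rewrite fact_gt0.
have H' : sephol rho (cabs c%:R * M) (dps s a f \o zeroed s).
  move=> j y yr; have := hol_scale c%:R (H j y yr); congr hol.
  by apply/funext => t; rewrite /scoef /= mulrC divfK.
have zr' : polydisc rho (subst z i 0) by apply: polydisc_subst; rewrite ?cabs0.
rewrite (iter_partial i (a i) H' zr') [subst _ _ _ 0 i]mxE eqxx.
have -> : (fun t => (dps s a f \o zeroed s) (subst (subst z i 0) i t)) =
   (fun t => c%:R * (dps s a f (zeroed s (subst z i t)) / c%:R)).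
  by apply/funext => t; rewrite subst_subst /= mulrC divfK.
have scal b w : cabs w < rho i -> iter b (@cder R) (fun t => c%:R *
     (dps s a f (zeroed s (subst z i t)) / c%:R)) w =
   c%:R * iter b (@cder R) (fun t => dps s a f (zeroed s (subst z i t)) / c%:R) w.
  elim: b w => [//|b IH] w wr; rewrite iterS; apply: cderP.
  have dl0 : 0 < rho i - cabs w by rewrite subr_gt0.
  apply: (@cdiff_local _ _ (fun w => c%:R * iter b (@cder R) (fun t =>
     dps s a f (zeroed s (subst z i t)) / c%:R) w) _ _ (rho i - cabs w)) => //.
    move=> u uw; apply: IH; have := cabsD (u - w) w; rewrite subrK; lra.
  exact: cdiffZ (iter_cder_cdiff b (H i z zr) wr).
rewrite scal ?cabs0// /tcoef big_cons natrM.
by field; rewrite fact_neq0 c0.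
Qed.

(** One Cauchy estimate per variable; holomorphy in the other variables persists by
    [sephol_tcoef]. *)
Lemma sephol_scoef rho M f (r : 'I_n -> R) s a : sephol rho M f -> uniq s ->
  (forall j, 0 < r j < rho j) -> 0 <= M ->
  sephol rho (M * \prod_(i <- s) r i ^- a i) (scoef f s a).
Proof.
move=> Hf us Hr M0.
have rho0 j : 0 < rho j by have /andP[h1 h2] := Hr j; apply: lt_trans h2.
elim: s us => [_|i s IH /= /andP[is_ us]].
  have -> : scoef f [::] a = f.
    apply/funext => z; rewrite /scoef /= big_nil divr1; congr f.
    by apply/rowP => j; rewrite mxE in_nil.
  by rewrite big_nil mulr1.
have /andP[r0 rrho] := Hr i.
have B0 : 0 <= M * \prod_(i <- s) r i ^- a i.
  rewrite mulr_ge0// prodr_ge0// => j _; rewrite invr_ge0 exprn_ge0// ltW//.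
  by have /andP[] := Hr j.
have := sephol_tcoef (a i) r0 rrho (IH us) rho0 B0.
have E z : polydisc rho z -> tcoef (fun t => scoef f s a (subst z i t)) (a i) = scoef f (i :: s) a z.
  by move=> zr; rewrite (scoef_cons rho0 is_ (IH us)).
have bE : M * \prod_(i <- s) r i ^- a i * r i ^- a i = M * \prod_(j <- i :: s) r j ^- a j.
  by rewrite big_cons -mulrA [X in M * X]mulrC.
rewrite bE => H j z zr; have [Hd HM] := H j z zr; split=> w wr.
  have [d Hwd] := Hd w wr; exists d.
  apply: (@cdiff_local _ _ _ _ _ (rho j - cabs w) _ _ Hwd); first by rewrite subr_gt0.
  move=> u uw; rewrite E//; apply: polydisc_subst => //.
  by have := cabsD (u - w) w; rewrite subrK; lra.
by rewrite -E; [apply: HM|apply: polydisc_subst].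
Qed.

Section Box.
Variable N : nat.
Implicit Types b : {ffun 'I_n -> 'I_N.+1}.

Definition upd b (i : 'I_n) (k : 'I_N.+1) : {ffun 'I_n -> 'I_N.+1} :=
  [ffun j => if j == i then k else b j].

(** Multi-indices in the variables s are encoded as functions on all of ['I_n] that vanish off s, so
    that one summation type serves the induction on s. *)
Definition supported s b := [forall j, (j \notin s) ==> (b j == ord0)].

Lemma sum_supported_cons (V : nmodType) s i (F : {ffun 'I_n -> 'I_N.+1} -> V) : i \notin s ->
  \sum_(b | supported (i :: s) b) F b =
  \sum_(b | supported s b) \sum_(k < N.+1) F (upd b i k).
Proof.
move=> is_; rewrite pair_big_dep /=.
rewrite (reindex_onto (fun b => (upd b i ord0, b i)) (fun p => upd p.1 i p.2)) /=; last first.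
  move=> [b k] /= /andP[/forallP sb _]; rewrite /upd /= ffunE eqxx; congr pair.
  apply/ffunP => j; rewrite !ffunE; case: eqP => // ->.
  by have := sb i; rewrite is_ => /eqP.
apply: eq_big => [b|b _]; last first.
  by congr F; apply/ffunP => j; rewrite !ffunE; case: eqP => // ->.
rewrite andbT; apply/forallP/andP => [sb|[/forallP sb _] j].
  split; last by apply/eqP/ffunP => j; rewrite !ffunE; case: eqP => // ->.
  apply/forallP => j; rewrite ffunE; case: (eqVneq j i) => [->|ji]; first by rewrite eqxx implybT.
  by have := sb j; rewrite inE (negbTE ji).
apply/implyP; rewrite inE negb_or => /andP[ji js].
by have := sb j; rewrite js ffunE (negbTE ji).
Qed.

Lemma supported_nil b : supported [::] b = (b == [ffun=> ord0]).
Proof.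
apply/forallP/eqP => [H|-> j]; last by rewrite ffunE eqxx.
by apply/ffunP => j; rewrite ffunE; have := H j => /= /eqP.
Qed.

Lemma upd_prod (K : comPzSemiRingType) s i b k (F : 'I_n -> nat -> K) : i \notin s ->
  \prod_(j <- s) F j (upd b i k j) = \prod_(j <- s) F j (b j).
Proof.
move=> is_; rewrite !big_seq; apply: eq_bigr => j js; rewrite ffunE.
by case: eqP => // ji; rewrite -ji js in is_.
Qed.

Lemma sum_supported_geometric s (q : R) : uniq s -> 0 <= q < 1 ->
  \sum_(b | supported s b) \prod_(i <- s) q ^+ b i <= (1 - q)^-1 ^+ size s.
Proof.
move=> us /andP[q0 q1]; have q1' : 0 < 1 - q by rewrite subr_gt0.
elim: s us => [_|i s IH /= /andP[is_ us]].
  rewrite (eq_bigl (pred1 [ffun=> ord0])) => [|b]; last exact: supported_nil.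
  by rewrite big_pred1_eq big_nil expr0.
rewrite sum_supported_cons//.
under eq_bigr => b _ do under eq_bigr => k _ do
  rewrite big_cons ffunE eqxx (@upd_prod R s i b k (fun _ m => q ^+ m) is_).
under eq_bigr => b _ do rewrite -mulr_suml.
rewrite -mulr_sumr exprS ler_pM ?IH//.
- by apply: sumr_ge0 => k _; rewrite exprn_ge0.
- by apply: sumr_ge0 => b _; rewrite prodr_ge0// => j _; rewrite exprn_ge0.
rewrite -[leRHS]mul1r ler_pdivlMr// mulrC.
have := subrX1 q N.+1; rewrite -opprB -[X in _ = X * _]opprB mulNr => /oppr_inj <-.
by rewrite gerBl exprn_ge0.
Qed.

Definition nbox b : {ffun 'I_n -> nat} := [ffun i => nat_of_ord (b i)].

(** Induction on the variables: a new variable i replaces every coefficient by its Taylor polynomial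
    in z_i. For the coefficient b the error is at most M q^(N+1) / (1 - q) times the product of the
    r_j^(-b_j), while |z_j^(b_j)| <= (q r_j)^(b_j); the sum over b is a product of geometric
    series. *)
Lemma scoef_error rho M f (r : 'I_n -> R) (q : R) s z : sephol rho M f -> uniq s ->
  (forall j, 0 < r j < rho j) -> 0 <= M -> 0 <= q < 1 -> (forall i, cabs (z 0 i) <= q * r i) ->
  cabs (f z - \sum_(b | supported s b) scoef f s (nbox b) z * \prod_(i <- s) z 0 i ^+ b i)
   <= (size s)%:R * (M * q ^+ N.+1 * (1 - q)^-1 ^+ size s).
Proof.
move=> Hf us Hr M0 q01 zq; have /andP[q0 q1] := q01; have q1' : 0 < 1 - q by rewrite subr_gt0.
have r0 j : 0 < r j by have /andP[] := Hr j.
have rho0 j : 0 < rho j by have /andP[h1 h2] := Hr j; apply: lt_trans h2.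
have zrho : polydisc rho z.
  move=> j; rewrite (le_lt_trans (zq j))//; have /andP[h1 h2] := Hr j.
  by rewrite (le_lt_trans _ h2)// ler_piMl// ltW.
elim: s us => [_|i s IH /= /andP[is_ us]].
  rewrite (eq_bigl (pred1 [ffun=> ord0])) => [|b]; last exact: supported_nil.
  rewrite big_pred1_eq big_nil mulr1 /scoef /= big_nil divr1.
  have -> : zeroed [::] z = z by apply/rowP => j; rewrite mxE in_nil.
  by rewrite subrr cabs0 mul0r.
rewrite sum_supported_cons//.
set A := \sum_(b | supported s b) scoef f s (nbox b) z * \prod_(i <- s) z 0 i ^+ b i in IH.
set B := \sum_(b | _) _.
have step : cabs (A - B) <= M * q ^+ N.+1 * (1 - q)^-1 ^+ (size s).+1.
  rewrite /A /B -sumrB (le_trans (cabs_sum _ _ _))//.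
  have -> : M * q ^+ N.+1 * (1 - q)^-1 ^+ (size s).+1 =
    M * q ^+ N.+1 / (1 - q) * (1 - q)^-1 ^+ size s by rewrite [(1 - q)^-1 ^+ _.+1]exprS mulrA.
  have X0 : 0 <= M * q ^+ N.+1 / (1 - q) by rewrite mulr_ge0 ?mulr_ge0 ?exprn_ge0 ?invr_ge0 ?(ltW q1').
  apply: le_trans (ler_wpM2l X0 (sum_supported_geometric us q01)).
  rewrite mulr_sumr; apply: ler_sum => b _.
  have Hs := sephol_scoef (nbox b) Hf us Hr M0.
  have -> : \sum_(k < N.+1) scoef f (i :: s) (nbox (upd b i k)) z *
      \prod_(j <- i :: s) z 0 j ^+ (upd b i k) j =
     (\sum_(k < N.+1) tcoef (fun t => scoef f s (nbox b) (subst z i t)) k * z 0 i ^+ k) *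
     \prod_(j <- s) z 0 j ^+ b j.
    rewrite mulr_suml; apply: eq_bigr => k _.
    rewrite big_cons ffunE eqxx (@upd_prod C s i b k (fun j m => z 0 j ^+ m) is_) mulrA; congr (_ * _ * _).
    have Hs' := sephol_scoef (nbox (upd b i k)) Hf us Hr M0.
    rewrite (scoef_cons rho0 is_ Hs' zrho) !ffunE eqxx; congr tcoef.
    apply/funext => t; rewrite /scoef; congr (_ / _%:R); last first.
      by rewrite !big_seq; apply: eq_bigr => j js; rewrite !ffunE; case: eqP => // ji; rewrite -ji js in is_.
    congr (_ _); rewrite /dps.
    elim: s is_ {us IH A B Hs Hs' t} => //= j s IHs; rewrite inE negb_or => /andP[ij js].
    by rewrite IHs// !ffunE eq_sym (negbTE ij).
  rewrite -mulrBl cabsM cabs_prod.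
  have /andP[ri0 rirho] := Hr i.
  have h1 := taylor_error N.+1 (Hs i z zrho) ri0 rirho q01 (zq i).
  rewrite subst_id in h1.
  have h2 : \prod_(j <- s) cabs (z 0 j ^+ b j) <= \prod_(j <- s) (q ^+ b j * r j ^+ b j).
    apply: ler_prod => j _; rewrite cabs_ge0 cabsX -exprMn /=.
    by apply: lerXn2r; rewrite ?nnegrE ?cabs_ge0// mulr_ge0// ltW.
  have p0 : 0 <= \prod_(j <- s) cabs (z 0 j ^+ b j) by apply: prodr_ge0 => j _; apply: cabs_ge0.
  apply: le_trans (ler_pM (cabs_ge0 _) p0 h1 h2) _.
  rewrite big_split /=; apply/eqW.
  have E : (\prod_(j <- s) r j ^- nbox b j) * \prod_(j <- s) r j ^+ b j = 1.
    rewrite -big_split /= big1// => j _.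
    by rewrite ffunE mulVf// expf_neq0// gt_eqF.
  rewrite -[RHS]mulr1 -[X in _ = _ * X]E; ring.
have := cabs_tri A (f z) B; have := IH us.
have mono : (size s)%:R * (M * q ^+ N.+1 * (1 - q)^-1 ^+ size s) <=
    (size s)%:R * (M * q ^+ N.+1 * (1 - q)^-1 ^+ (size s).+1).
  rewrite ler_wpM2l// ler_wpM2l ?mulr_ge0 ?exprn_ge0// exprS ler_peMl//.
    by rewrite exprn_ge0// invr_ge0 ltW.
  by rewrite invf_ge1//; lra.
rewrite -natr1 mulrDl mul1r; lra.
Qed.

Lemma taylor_polynomial_error rho M (f : 'rV[C]_n -> C) (r : 'I_n -> R) (q : R) z : sephol rho M f ->
  (forall j, 0 < r j < rho j) -> 0 <= M -> 0 <= q < 1 -> (forall i, cabs (z 0 i) <= q * r i) ->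
  cabs (f z - \sum_b taylor_coef f (nbox b) * monomial z (nbox b))
   <= n%:R * (M * q ^+ N.+1 * (1 - q)^-1 ^+ n).
Proof.
move=> Hf Hr M0 q01 zq.
have := scoef_error Hf (enum_uniq 'I_n) Hr M0 q01 zq.
rewrite size_enum_ord; congr (cabs (_ - _) <= _).
apply: eq_big => [b|b _].
  by apply/forallP => j; rewrite mem_enum.
have -> : monomial z (nbox b) = \prod_(i <- enum 'I_n) z 0 i ^+ b i.
  by rewrite big_enum /monomial; apply: eq_big => // i _; rewrite ffunE.
rewrite /taylor_coef /scoef big_enum /=; congr (_ / _ * _).
have -> : zeroed (enum 'I_n) z = 0 by apply/rowP => j; rewrite !mxE mem_enum.
by [].
Qed.

End Box.
End Polydiscs.
End SeveralVariables.

(** * Elementary inequalities for finite sums *)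

Section FiniteSums.
Variable R : realType.

Lemma sum_inj_le (I J : finType) (h : I -> J) (P : pred I) (F : J -> R) :
  {in P &, injective h} -> (forall j, 0 <= F j) -> \sum_(i | P i) F (h i) <= \sum_j F j.
Proof.
move=> hi F0; rewrite -(big_imset F hi) /=.
rewrite [leRHS](bigID (mem (h @: P)))/= lerDl; exact: sumr_ge0.
Qed.

Lemma sqr_sum_le (I : finType) (A : pred I) (x : I -> R) :
  (\sum_(i in A) x i) ^+ 2 <= #|A|%:R * \sum_(i in A) x i ^+ 2.
Proof.
have -> : (\sum_(i in A) x i) ^+ 2 = \sum_(i in A) \sum_(j in A) x i * x j.
  by rewrite expr2 mulr_suml; apply: eq_bigr => i _; rewrite mulr_sumr.
have le : \sum_(i in A) \sum_(j in A) x i * x j <=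
    \sum_(i in A) \sum_(j in A) (x i ^+ 2 / 2 + x j ^+ 2 / 2).
  apply: ler_sum => i _; apply: ler_sum => j _.
  by have := sqr_ge0 (x i - x j); rewrite sqrrB; lra.
rewrite (le_trans le)//.
rewrite (eq_bigr (fun i => x i ^+ 2 / 2 *+ #|A| + \sum_(j in A) x j ^+ 2 / 2)); last first.
  by move=> i _; rewrite big_split /= sumr_const.
rewrite big_split /= sumr_const sumrMnl.
have -> : \sum_(i in A) x i ^+ 2 = \sum_(i in A) x i ^+ 2 / 2 + \sum_(i in A) x i ^+ 2 / 2.
  by rewrite -mulr_suml; lra.
by rewrite mulrDr !mulr_natl.
Qed.

(** Fractional powers appear below only as numbers y with y^(k+1) = x, so that all exponents remain
    natural numbers. *)
Lemma root_exists (x : R) k : 0 <= x -> exists2 y, 0 <= y & y ^+ k.+1 = x.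
Proof.
move=> x0; exists (x `^ (k.+1%:R^-1)); first exact: powR_ge0.
by rewrite -powR_mulrn ?powR_ge0// -powRrM mulVf ?pnatr_eq0// powRr1.
Qed.

Lemma bernoulli (t : R) k : 0 <= t -> 1 + k%:R * (t - 1) <= t ^+ k.
Proof.
move=> t0; elim: k => [|k IH]; first by rewrite mul0r addr0 expr0.
rewrite exprS; have := ler_wpM2l t0 IH; apply: le_trans.
rewrite -natr1; have := mulr_ge0 (ler0n R k) (sqr_ge0 (t - 1)); nra.
Qed.

(* Log-convexity of the L^p norms between p = 2k/(k+1), 2 and 4, where U = |Q|^(2/(k+1)). *)
Lemma interpolation (I : finType) (U : I -> R) k (B c : R) : 0 < c -> 0 <= B ->
  (forall i, 0 <= U i) ->
  let S := c * \sum_i U i ^+ k.+1 in let V := c * \sum_i U i ^+ k in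
  c * \sum_i (U i ^+ k.+1) ^+ 2 <= B * S ^+ 2 -> (0 < k)%N ->
  S ^+ k <= B * V ^+ k.+1.
Proof.
move=> c0 B0 U0 S V H k0.
have S0 : 0 <= S by rewrite mulr_ge0 ?(ltW c0)// sumr_ge0// => i _; rewrite exprn_ge0.
have V0 : 0 <= V by rewrite mulr_ge0 ?(ltW c0)// sumr_ge0// => i _; rewrite exprn_ge0.
have [->|Sn] := eqVneq S 0; first by rewrite expr0n eqn0Ngt k0 mulr_ge0// exprn_ge0.
have Sp : 0 < S by rewrite lt_def Sn.
have Bp : 0 < B.
  rewrite lt_def B0 andbT; apply/negP => /eqP B_; move: H; rewrite B_ mul0r leNgt => /negP; apply.
  have [i Ui] : exists i, U i != 0.
    apply/existsP; apply: contraNT Sn; rewrite negb_exists => /forallP Ui.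
    rewrite /S big1 ?mulr0// => i _; have := Ui i; rewrite negbK => /eqP ->.
    by rewrite expr0n.
  rewrite mulr_gt0// (bigD1 i)//= ltr_wpDr//.
    by rewrite sumr_ge0// => j _; rewrite sqr_ge0.
  by rewrite exprn_gt0// exprn_gt0// lt_def Ui U0.
(* The choice A^(k+1) = B S turns the bound for the last term of [pw], after summation, into exactly
   S. *)
have [A A0 AE] := root_exists k (mulr_ge0 B0 S0).
have Ap : 0 < A.
  rewrite lt_def A0 andbT; apply/negP => /eqP A_; move: AE; rewrite A_ expr0n /= => /esym/eqP.
  by rewrite mulf_eq0 !gt_eqF.
(* Bernoulli's inequality at U_i / A with exponent k + 2, multiplied by A U_i^k. *)
have pw i : k.+2%:R * U i ^+ k.+1 <= k.+1%:R * A * U i ^+ k + (A ^+ k.+1)^-1 * (U i ^+ k.+1) ^+ 2.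
  have t0 : 0 <= U i / A by rewrite divr_ge0.
  have := bernoulli k.+2 t0; rewrite -[1 + _]addrC => h.
  have {}h : k.+2%:R * (U i / A) <= k.+1%:R + (U i / A) ^+ k.+2.
    by move: h; rewrite -!natr1; lra.
  have := ler_wpM2r (mulr_ge0 A0 (exprn_ge0 k (U0 i))) h.
  have -> : k.+2%:R * (U i / A) * (A * U i ^+ k) = k.+2%:R * U i ^+ k.+1.
    by rewrite exprS; field; rewrite gt_eqF.
  move/le_trans; apply; apply/eqW; rewrite mulrDl mulrA; congr (_ + _).
  rewrite expr_div_n -exprM [_.+2]lock mulrCA mulrAC -lock.
  have -> : (k.+1 * 2 = k.+2 + k)%N by rewrite muln2 doubleS -addnn !addSn.
  rewrite exprD [A ^+ k.+2]exprS; field.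
  by rewrite !expf_neq0 gt_eqF.
have : k.+2%:R * S <= k.+1%:R * A * V + (A ^+ k.+1)^-1 * (B * S ^+ 2).
  rewrite /S mulrCA /V.
  have s1 : k.+2%:R * \sum_i U i ^+ k.+1 <= k.+1%:R * A * (\sum_i U i ^+ k) +
      (A ^+ k.+1)^-1 * \sum_i (U i ^+ k.+1) ^+ 2.
    by rewrite !mulr_sumr -big_split /=; apply: ler_sum => i _.
  have := ler_wpM2l (ltW c0) s1; move/le_trans; apply.
  rewrite mulrDr lerD//; first by apply/eqW; ring.
  rewrite mulrCA ler_wpM2l// invr_ge0 AE.
  by rewrite mulr_ge0.
have -> : (A ^+ k.+1)^-1 * (B * S ^+ 2) = S.
  by rewrite AE; field; rewrite !gt_eqF.
move=> h; have {}h : S <= A * V.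
  have k1 : 0 < k.+1%:R :> R by rewrite ltr0n.
  rewrite -(ler_pM2l k1); move: h; rewrite -[k.+2%:R]natr1; lra.
have : S ^+ k.+1 <= (A * V) ^+ k.+1.
  by apply: lerXn2r; rewrite ?nnegrE// mulr_ge0.
rewrite [(A * V) ^+ _]exprMn AE [S ^+ k.+1]exprS => h'.
by rewrite -(ler_pM2l Sp) (le_trans h')//; apply/eqW; ring.
Qed.

End FiniteSums.

(** * Parseval's identity and hypercontractivity on a grid of the torus *)

Section ExponentialSums.
Variables (R : realType) (n : nat).
Local Notation C := R[i].
Implicit Types (z w v : 'I_n -> C) (e : 'I_n -> nat).

Definition mon z e : C := \prod_(i < n) z i ^+ e i.

Definition wt e : nat := (\sum_(i < n) e i)%N.

Lemma monZ (t : C) z e : mon (fun i => t * z i) e = t ^+ wt e * mon z e.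
Proof.
rewrite /mon (eq_bigr (fun i => t ^+ e i * z i ^+ e i)) => [|i _]; last by rewrite exprMn.
by rewrite big_split /= -expr_sum.
Qed.

Lemma monD z e e' : mon z (fun i => (e i + e' i)%N) = mon z e * mon z e'.
Proof. by rewrite /mon -big_split /=; apply: eq_bigr => i _; rewrite exprD. Qed.

Definition expsum (I : finType) (q : I -> C) (e : I -> 'I_n -> nat) z : C :=
  \sum_t q t * mon z (e t).

Variable L : nat.
Hypothesis L0 : (0 < L)%N.

Definition gpt (g : {ffun 'I_n -> 'I_L}) : 'I_n -> C := fun i => om R L ^+ g i.

Lemma cabs_gpt g i : cabs (gpt g i) = 1.
Proof. by rewrite cabsX cabs_om expr1n. Qed.

Definition gavg (u : ('I_n -> C) -> R) : R := (L%:R ^+ n)^-1 * \sum_g u (gpt g).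

Lemma gavg_le (u v : ('I_n -> C) -> R) :
  (forall z, (forall i, cabs (z i) = 1) -> u z <= v z) -> gavg u <= gavg v.
Proof.
move=> uv; rewrite ler_wpM2l ?invr_ge0 ?exprn_ge0//; apply: ler_sum => g _.
by apply: uv => i; apply: cabs_gpt.
Qed.

Lemma gavg_cst (c : R) : gavg (fun=> c) = c.
Proof.
rewrite /gavg sumr_const card_ffun !card_ord.
have -> : c *+ (L ^ n) = c * L%:R ^+ n by rewrite -natrX mulr_natr.
rewrite mulrCA mulVf ?mulr1//.
by rewrite expf_neq0// pnatr_eq0 -lt0n.
Qed.

Lemma gavg_bound (u : ('I_n -> C) -> R) (M : R) :
  (forall z, (forall i, cabs (z i) = 1) -> u z <= M) -> gavg u <= M.
Proof. by move=> uM; rewrite -[leRHS]gavg_cst; apply: gavg_le. Qed.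

Lemma gavg_sum (I : finType) (P : pred I) (u : I -> ('I_n -> C) -> R) :
  gavg (fun z => \sum_(i | P i) u i z) = \sum_(i | P i) gavg (u i).
Proof. by rewrite /gavg exchange_big mulr_sumr. Qed.

Lemma mul_om_conj (k : nat) : om R L ^+ k * conjc (om R L ^+ k) = 1.
Proof. by rewrite mul_conjc cabsX cabs_om !expr1n rmorph1. Qed.

Lemma conjcX (x : C) k : conjc (x ^+ k) = conjc x ^+ k.
Proof. by rewrite rmorphXn. Qed.

Lemma conjc_prod (I : Type) (r : seq I) (F : I -> C) :
  conjc (\prod_(i <- r) F i) = \prod_(i <- r) conjc (F i).
Proof. by rewrite rmorph_prod. Qed.

Lemma sum_om_conj a b : (a < L)%N -> (b < L)%N ->
  \sum_(k < L) (om R L ^+ k) ^+ a * conjc ((om R L ^+ k) ^+ b) = if a == b then L%:R else 0.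
Proof.
move=> aL bL.
wlog ab : a b aL bL / (b <= a)%N => [hw|].
  have [|/ltnW ba] := leqP b a; first exact: hw.
  have := hw b a bL aL ba => /(congr1 (@conjc R)).
  rewrite rmorph_sum /= (eq_bigr (fun k : 'I_L => (om R L ^+ k) ^+ a * conjc ((om R L ^+ k) ^+ b))).
    by move=> ->; rewrite eq_sym; case: ifP => _; rewrite ?conjc_nat ?conjc0.
  by move=> k _; rewrite rmorphM /= conjcK mulrC.
rewrite (eq_bigr (fun k : 'I_L => om R L ^+ ((a - b) * k))) => [|k _].
  rewrite sum_om//; have [->|anb] := eqVneq a b; first by rewrite subnn dvdn0.
  rewrite gtnNdvd//; last by rewrite (leq_ltn_trans (leq_subr _ _)).
  by rewrite subn_gt0 ltn_neqAle ab andbT eq_sym.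
rewrite -[a in LHS](subnK ab) exprD -mulrA -(exprM _ k b) mul_om_conj mulr1.
by rewrite -exprM mulnC.
Qed.

Lemma sum_mon_conj e e' : (forall i, (e i < L)%N) -> (forall i, (e' i < L)%N) ->
  \sum_g mon (gpt g) e * conjc (mon (gpt g) e') =
  if [forall i, e i == e' i] then (L ^ n)%:R else 0.
Proof.
move=> eL e'L.
rewrite (eq_bigr (fun g : {ffun 'I_n -> 'I_L} =>
   \prod_(i < n) ((om R L ^+ g i) ^+ e i * conjc ((om R L ^+ g i) ^+ e' i)))); last first.
  by move=> g _; rewrite /mon conjc_prod -big_split.
rewrite -(bigA_distr_bigA (fun i (k : 'I_L) => (om R L ^+ k) ^+ e i * conjc ((om R L ^+ k) ^+ e' i))).
rewrite (eq_bigr (fun i => if e i == e' i then L%:R else 0)); last first.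
  by move=> i _; rewrite sum_om_conj.
case: ifPn => [/forallP H|].
  rewrite (eq_bigr (fun=> L%:R)) => [|i _]; last by rewrite H.
  by rewrite prodr_const card_ord natrX.
rewrite negb_forall => /existsP[i /negbTE ne].
by rewrite (bigD1 i)//= ne mul0r.
Qed.

Lemma gavg_sqr (I : finType) (q : I -> C) (e : I -> 'I_n -> nat) :
  (forall t i, (e t i < L)%N) ->
  gavg (fun z => cabs (expsum q e z) ^+ 2) =
  complex.Re (\sum_t \sum_(t' | [forall i, e t i == e t' i]) q t * conjc (q t')).
Proof.
move=> eL; set S := \sum_t _.
suff E : real_complex R (gavg (fun z => cabs (expsum q e z) ^+ 2)) = S by rewrite -E.
rewrite /gavg rmorphM /= fmorphV rmorphXn /= rmorph_nat rmorph_sum /=.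
have E g : real_complex R (cabs (expsum q e (gpt g)) ^+ 2) =
    \sum_t \sum_t' q t * conjc (q t') * (mon (gpt g) (e t) * conjc (mon (gpt g) (e t'))).
  rewrite -mul_conjc /expsum mulr_suml; apply: eq_bigr => t _.
  rewrite rmorph_sum /= mulr_sumr; apply: eq_bigr => t' _.
  by rewrite rmorphM /=; ring.
have -> : \sum_g real_complex R (cabs (expsum q e (gpt g)) ^+ 2) =
   \sum_t \sum_t' q t * conjc (q t') * (\sum_g mon (gpt g) (e t) * conjc (mon (gpt g) (e t'))).
  under eq_bigr do rewrite E.
  rewrite exchange_big /=; apply: eq_bigr => t _.
  rewrite exchange_big /=; apply: eq_bigr => t' _.
  by rewrite mulr_sumr.
rewrite mulr_sumr; apply: eq_bigr => t _.
rewrite mulr_sumr [RHS]big_mkcond /=; apply: eq_bigr => t' _.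
rewrite sum_mon_conj//; case: ifP => _; last by rewrite !mulr0.
by rewrite natrX mulrCA mulVf ?mulr1// expf_neq0// pnatr_eq0 -lt0n.
Qed.

(** Parseval. Exponents need to be distinct only where q does not vanish: the exponents a - b of
    [deriv] are truncated differences, which determine a only on the support. *)
Lemma gavg_sqr_inj (I : finType) (q : I -> C) (e : I -> 'I_n -> nat) :
  (forall t i, (e t i < L)%N) ->
  (forall t t', q t != 0 -> q t' != 0 -> e t =1 e t' -> t = t') ->
  gavg (fun z => cabs (expsum q e z) ^+ 2) = \sum_t cabs (q t) ^+ 2.
Proof.
move=> eL inj; rewrite gavg_sqr//; apply: (@complexI R).
have -> : \sum_t \sum_(t' | [forall i, e t i == e t' i]) q t * conjc (q t') =
   \sum_t real_complex R (cabs (q t) ^+ 2).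
  apply: eq_bigr => t _; rewrite (bigD1 t)/=; last by apply/forallP.
  rewrite mul_conjc big1 ?addr0// => t' /andP[/forallP ee t't].
  have [->|qt] := eqVneq (q t) 0; first by rewrite mul0r.
  have [->|qt'] := eqVneq (q t') 0; first by rewrite conjc0 mulr0.
  by case/eqP: t't; apply/esym/inj => // i; apply/eqP.
by rewrite -rmorph_sum.
Qed.

(** At most K coefficients share an exponent, so the inequality 2 |q_t q_t'| <= |q_t|^2 + |q_t'|^2
    over coinciding pairs loses at most the factor K. *)
Lemma gavg_sqr_le (I : finType) (q : I -> C) (e : I -> 'I_n -> nat) (K : nat) :
  (forall t i, (e t i < L)%N) ->
  (forall t, q t != 0 -> (#|[pred t' | (q t' != 0)%R && [forall i, e t i == e t' i]]| <= K)%N) ->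
  gavg (fun z => cabs (expsum q e z) ^+ 2) <= K%:R * \sum_t cabs (q t) ^+ 2.
Proof.
move=> eL fib; rewrite gavg_sqr//.
pose A t t' := (q t != 0) && (q t' != 0) && [forall i, e t i == e t' i].
have bnd : complex.Re (\sum_t \sum_(t' | [forall i, e t i == e t' i]) q t * conjc (q t')) <=
   \sum_t \sum_(t' | A t t') (cabs (q t) ^+ 2 / 2 + cabs (q t') ^+ 2 / 2).
  rewrite raddf_sum; apply: ler_sum => t _; rewrite raddf_sum /=.
  rewrite [leLHS]big_mkcond [leRHS]big_mkcond /=; apply: ler_sum => t' _.
  rewrite /A; have [->|qt] := eqVneq (q t) 0; first by rewrite mul0r /=; case: ifP.
  have [->|qt'] := eqVneq (q t') 0; first by rewrite conjc0 mulr0 /=; case: ifP.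
  rewrite /=; case: ifP => // _.
  have := le_trans (ler_norm _) (Re_le_cabs (q t * conjc (q t'))).
  rewrite cabsM cabs_conj; have := sqr_ge0 (cabs (q t) - cabs (q t')); rewrite sqrrB; lra.
apply: (le_trans bnd).
under eq_bigr do rewrite big_split /=.
rewrite big_split /=.
have -> : \sum_t \sum_(t' | A t t') cabs (q t') ^+ 2 / 2 = \sum_t \sum_(t' | A t t') cabs (q t) ^+ 2 / 2.
  rewrite (exchange_big_dep xpredT)//=; apply: eq_bigr => t _; apply: eq_bigl => t'.
  rewrite /A [(q t' != 0) && _]andbC; congr (_ && _).
  by apply: eq_forallb => i; rewrite eq_sym.
rewrite -big_split mulr_sumr /=; apply: ler_sum => t _.
rewrite sumr_const -mulrnDl -splitr -[leLHS]mulr_natl.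
have [qt0|qt] := eqVneq (q t) 0; first by rewrite qt0 cabs0 expr2 !mulr0.
rewrite ler_wpM2r ?sqr_ge0// ler_nat (leq_trans _ (fib t qt))//.
Qed.

Lemma esum_sqr (I : finType) (q : I -> C) (e : I -> 'I_n -> nat) z :
  expsum q e z ^+ 2 = expsum (fun p : I * I => q p.1 * q p.2) (fun p i => (e p.1 i + e p.2 i)%N) z.
Proof.
rewrite expr2 /expsum mulr_suml.
rewrite -(pair_bigA _ (fun t t' => q t * q t' * mon z (fun i => (e t i + e t' i)%N))) /=.
apply: eq_bigr => t _; rewrite mulr_sumr; apply: eq_bigr => t' _.
by rewrite monD; ring.
Qed.

(* |Q|^2 = |Q^2| has at most prod (d_i + 1) <= 2^(2d) ways of producing each exponent. *)
Lemma hypercontractive4 (I : finType) (q : I -> C) (e : I -> 'I_n -> nat) d :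
  (forall t i, ((e t i).*2 < L)%N) ->
  (forall t t', q t != 0 -> q t' != 0 -> e t =1 e t' -> t = t') ->
  (forall t, q t != 0 -> wt (e t) = d) ->
  gavg (fun z => (cabs (expsum q e z) ^+ 2) ^+ 2) <=
    4 ^+ d * gavg (fun z => cabs (expsum q e z) ^+ 2) ^+ 2.
Proof.
move=> eL inj hom.
have eL1 t i : (e t i < L)%N by apply: leq_ltn_trans (eL t i); rewrite -addnn leq_addr.
have -> : gavg (fun z => (cabs (expsum q e z) ^+ 2) ^+ 2) =
    gavg (fun z => cabs (expsum (fun p : I * I => q p.1 * q p.2) (fun p i => (e p.1 i + e p.2 i)%N) z) ^+ 2).
  by congr gavg; apply/funext => z; rewrite -esum_sqr cabsX.
rewrite (gavg_sqr_inj eL1 inj).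
have -> : (\sum_t cabs (q t) ^+ 2) ^+ 2 = \sum_(p : I * I) cabs (q p.1 * q p.2) ^+ 2.
  rewrite -(pair_bigA _ (fun t t' => cabs (q t * q t') ^+ 2)) /= expr2 mulr_suml.
  apply: eq_bigr => t _; rewrite mulr_sumr; apply: eq_bigr => t' _.
  by rewrite cabsM exprMn.
rewrite -[4]/((4%N)%:R) -natrX; apply: gavg_sqr_le => [p i|p].
  rewrite -ltn_double doubleD -[L.*2]addnn.
  by have := leq_add (eL p.1 i) (eL p.2 i); rewrite addSn addnS; apply: ltnW.
rewrite mulf_eq0 negb_or => /andP[q1 q2].
pose D i := (e p.1 i + e p.2 i)%N.
have wD : wt D = d.*2 by rewrite /wt big_split /= -!/(wt _) !hom// addnn.
(* A pair with total exponent D is determined by the exponent of its first member, which lies in the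
   box below D. *)
pose h (p' : I * I) : {ffun 'I_n -> 'I_L} := [ffun i => Ordinal (eL1 p'.1 i)].
apply: (@leq_trans #|family (fun i : 'I_n => [pred a : 'I_L | (a <= D i)%N])|).
  rewrite -(card_in_imset (f := h)).
    apply: subset_leq_card; apply/fintype.subsetP => _ /imsetP[p' + ->].
    rewrite inE => /andP[_ /forallP Hp']; apply/familyP => i.
    by rewrite !inE ffunE /= /D (eqP (Hp' i)) leq_addr.
  move=> [a b] [a' b']; rewrite !inE /= !mulf_eq0 !negb_or.
  move=> /andP[/andP[qa qb] /forallP Hab] /andP[/andP[qa' qb'] /forallP Hab'].
  move=> /ffunP hh.
  have ea : e a =1 e a' by move=> i; have := hh i; rewrite !ffunE => -[].
  have aa := inj _ _ qa qa' ea; subst a'; congr pair; apply: inj => // i.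
  by have := Hab i; rewrite (eqP (Hab' i)) eqn_add2l => /eqP.
rewrite card_family foldrE big_map big_enum /=.
have -> : (4 ^ d = \prod_(i < n) 2 ^ D i)%N.
  by rewrite -expn_sum -/(wt D) wD -mul2n expnM.
apply: leq_prod => i _; apply: leq_trans (ltn_expl (D i) (isT : (1 < 2)%N)).
have [DL|LD] := ltnP (D i) L.
  rewrite -[X in (_ <= X)%N]card_ord -(card_in_imset (f := fun a : 'I_L => inord a : 'I_(D i).+1)).
    exact: max_card.
  move=> a b aD bD /(congr1 val); rewrite /= !inordK; [exact: val_inj|exact: bD|exact: aD].
by rewrite (leq_trans (max_card _))// card_ord leqW.
Qed.

(* hypercontractivity in the form ||Q||_2 <= 2^(d/k) ||Q||_p with p = 2k/(k+1) *)
Lemma hypercontractive (I : finType) (q : I -> C) (e : I -> 'I_n -> nat) d k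
    (U : ('I_n -> C) -> R) :
  (forall t i, ((e t i).*2 < L)%N) ->
  (forall t t', q t != 0 -> q t' != 0 -> e t =1 e t' -> t = t') ->
  (forall t, q t != 0 -> wt (e t) = d) -> (0 < k)%N ->
  (forall z, 0 <= U z) -> (forall z, U z ^+ k.+1 = cabs (expsum q e z) ^+ 2) ->
  (\sum_t cabs (q t) ^+ 2) ^+ k <= 4 ^+ d * gavg (fun z => U z ^+ k) ^+ k.+1.
Proof.
move=> eL inj hom k0 U0 UE.
have eL1 t i : (e t i < L)%N by apply: leq_ltn_trans (eL t i); rewrite -addnn leq_addr.
have := hypercontractive4 eL inj hom.
rewrite -[\sum_t _](gavg_sqr_inj eL1 inj).
have -> : (fun z => cabs (expsum q e z) ^+ 2) = (fun z => U z ^+ k.+1).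
  by apply/funext => z; rewrite UE.
have -> : (fun z => (cabs (expsum q e z) ^+ 2) ^+ 2) = (fun z => (U z ^+ k.+1) ^+ 2).
  by apply/funext => z; rewrite UE.
rewrite /gavg => H.
have c0 : 0 < (L%:R ^+ n : R)^-1 by rewrite invr_gt0 exprn_gt0// ltr0n.
have B0 : 0 <= 4 ^+ d :> R by rewrite exprn_ge0.
exact: (interpolation c0 B0 (fun g => U0 (gpt g)) H k0).
Qed.

End ExponentialSums.

(** * Coefficient sums of homogeneous polynomials *)

Section Sidon.
Variables (R : realType) (n N : nat).
Local Notation "x %:C" := (real_complex R x) : ring_scope.
Local Notation C := R[i].
Local Notation T := {ffun 'I_n -> 'I_N.+2}.
Implicit Types (b : T) (i j : 'I_n) (c : T -> C) (z w v : 'I_n -> C).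

(** Exponents range over ['I_N.+2], so that the value 1 is always available and the unit
    multi-indices [unit_mi] exist. *)
Definition mi b : 'I_n -> nat := fun i => b i.

Lemma mi_inj b b' : mi b =1 mi b' -> b = b'.
Proof. by move=> H; apply/ffunP => i; apply/val_inj/H. Qed.

Lemma mi_lt b i : (mi b i < N.+2)%N. Proof. exact: ltn_ord. Qed.

Definition dec j b : T := [ffun i => if i == j then inord (b i).-1 else b i].

Lemma mi_dec j b i : mi (dec j b) i = if i == j then (b i).-1 else b i.
Proof.
rewrite /mi ffunE; case: eqP => // _.
by rewrite inordK// (leq_ltn_trans (leq_pred _)).
Qed.

Lemma dec_inj j : {in [pred b : T | (0 < b j)%N] &, injective (dec j)}.
Proof.
move=> b b'; rewrite !inE => bj bj' E; apply: mi_inj => i.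
have := mi_dec j b i; rewrite E mi_dec /mi; case: eqP => // ->.
by move=> h; rewrite -(prednK bj) -h (prednK bj').
Qed.

Lemma wt_dec j b : (0 < b j)%N -> wt (mi b) = (wt (mi (dec j b))).+1.
Proof.
move=> bj; rewrite /wt (bigD1 j)//= [in RHS](bigD1 j)//= mi_dec eqxx -addSn prednK//.
by congr addn; apply: eq_bigr => i ij; rewrite mi_dec (negbTE ij).
Qed.

Lemma wt_gt0 (e : 'I_n -> nat) : (0 < wt e)%N -> exists j, (0 < e j)%N.
Proof.
move=> w0; apply/existsP; apply: contraLR w0; rewrite negb_exists => /forallP H.
rewrite -eqn0Ngt /wt big1// => i _; apply/eqP; have := H i.
by rewrite -eqn0Ngt.
Qed.

(** Every monomial of degree k occurs in the expansion of the k-th power. By induction a factor g_j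
    with b_j > 0 is split off, and decrementing at j is injective. *)
Lemma sum_mon_le_exp (g : 'I_n -> R) k : (forall j, 0 <= g j) ->
  \sum_(b | wt (mi b) == k) \prod_j g j ^+ mi b j <= (\sum_j g j) ^+ k.
Proof.
move=> g0; have p0 b : 0 <= \prod_j g j ^+ mi b j by apply: prodr_ge0 => j _; rewrite exprn_ge0.
elim: k => [|k IH].
  rewrite expr0; apply: (@le_trans _ _ (\sum_(b | b == [ffun=> ord0]) \prod_j g j ^+ mi b j)).
    apply/eqW; apply: eq_bigl => b; apply/eqP/eqP => [w0|->]; last first.
      by rewrite /wt big1// => i _; rewrite /mi ffunE.
    apply: mi_inj => i; rewrite /mi ffunE; apply/eqP.
    by have /eqP := w0; rewrite /wt sum_nat_eq0 => /forallP/(_ i).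
  by rewrite big_pred1_eq big1// => j _; rewrite /mi ffunE expr0.
rewrite exprS mulr_suml.
apply: (@le_trans _ _ (\sum_j \sum_(b | (wt (mi b) == k.+1) && (0 < b j)%N) \prod_j g j ^+ mi b j)).
  rewrite (exchange_big_dep (fun b => wt (mi b) == k.+1))/=; last by move=> j b _ /andP[].
  apply: ler_sum => b /eqP wb; have [|j bj] := @wt_gt0 (mi b); first by rewrite wb.
  rewrite [leRHS](bigD1 j)/=; last by rewrite wb eqxx.
  by rewrite lerDl sumr_ge0.
apply: ler_sum => j _; have := ler_wpM2l (g0 j) IH; apply: le_trans.
rewrite mulr_sumr.
pose F b := if wt (mi b) == k then g j * \prod_j g j ^+ mi b j else 0.
have -> : \sum_(b | wt (mi b) == k) g j * \prod_j g j ^+ mi b j = \sum_b F b by rewrite -big_mkcond.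
have -> : \sum_(b | (wt (mi b) == k.+1) && (0 < b j)%N) \prod_j g j ^+ mi b j =
   \sum_(b | (wt (mi b) == k.+1) && (0 < b j)%N) F (dec j b).
  apply: eq_bigr => b /andP[wb bj]; rewrite /F.
  move: wb; rewrite (wt_dec bj) eqSS => ->.
  rewrite (bigD1 j)//= [in RHS](bigD1 j)//= mi_dec eqxx mulrA -exprS prednK//.
  by congr (_ * _); apply: eq_bigr => i ij; rewrite mi_dec (negbTE ij).
apply: sum_inj_le.
  by move=> b b' /andP[_ h1] /andP[_ h2]; apply: dec_inj.
by move=> b; rewrite /F; case: ifP => // _; rewrite mulr_ge0.
Qed.

Lemma exists_sub_mi b k : (k <= wt (mi b))%N ->
  exists b', (forall i, (mi b' i <= mi b i)%N) /\ wt (mi b') = k.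
Proof.
move: {2}(wt (mi b) - k)%N (erefl (wt (mi b) - k)%N) => d; elim: d b => [|d IH] b E kb.
  exists b; split => //; apply/eqP; rewrite eqn_leq kb andbT.
  by rewrite -subn_eq0 E.
have [|j bj] := @wt_gt0 (mi b); first by apply: leq_trans (leq_subr k _); rewrite E.
have w := wt_dec bj.
have kd : (k <= wt (mi (dec j b)))%N.
  by rewrite -ltnS -w ltn_neqAle kb andbT; apply/eqP => kE; rewrite kE subnn in E.
have [|b' [h1 h2]] := IH (dec j b) _ kd; first by apply/eqP; rewrite -eqSS -E w subSn.
exists b'; split => // i; apply: leq_trans (h1 i) _; rewrite mi_dec /mi.
by case: ifP => // _; apply: leq_pred.
Qed.

Definition blei_weight (a : T -> R) k j : R :=
  Num.sqrt (\sum_(b | (wt (mi b) == k) && (0 < b j)%N) a b ^+ 2).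

(* Blei's inequality, by splitting |a|^(2k) into k+1 factors. *)
Lemma blei (a u : T -> R) k : (0 < k)%N -> (forall b, 0 <= a b) -> (forall b, 0 <= u b) ->
  (forall b, u b ^+ k.+1 = a b ^+ 2) ->
  \sum_(b | wt (mi b) == k) u b ^+ k <= \sum_j blei_weight a k j + (\sum_j blei_weight a k j) ^+ k.
Proof.
move=> k0 a0 u0 uE; set g := blei_weight a k; set M := \sum_j g j.
have g0 j : 0 <= g j by apply: sqrtr_ge0.
pose G b := \prod_j g j ^+ mi b j.
have G0 b : 0 <= G b by apply: prodr_ge0 => j _; rewrite exprn_ge0.
(* For b of degree k, [a b] to the power 2k is the product of k + 1 factors: [a b ^+ 2 / g j] with
   multiplicity b_j, and [G b]. [F b] is a sum that dominates each of them. *)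
pose F b := \sum_(j | (0 < b j)%N) a b ^+ 2 / g j + G b.
have F0 b : 0 <= F b.
  by rewrite addr_ge0// sumr_ge0// => j _; rewrite divr_ge0// sqr_ge0.
have sg j : g j ^+ 2 = \sum_(b | (wt (mi b) == k) && (0 < b j)%N) a b ^+ 2.
  by rewrite sqr_sqrtr// sumr_ge0// => b _; rewrite sqr_ge0.
have main b : wt (mi b) == k -> u b ^+ k <= F b.
  move=> wb; have [ab|ab] := eqVneq (a b) 0.
    have /eqP : u b ^+ k.+1 = 0 by rewrite uE ab expr0n.
    by rewrite expf_eq0 /= => /eqP ->; rewrite expr0n eqn0Ngt k0.
  have ap : 0 < a b by rewrite lt_def ab a0.
  have gp j : (0 < b j)%N -> 0 < g j.
    move=> bj; rewrite lt_def g0 andbT; suff : 0 < g j ^+ 2.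
      by apply: contraTneq => ->; rewrite expr2 mul0r ltxx.
    rewrite sg (bigD1 b)/=; last by rewrite wb.
    by rewrite ltr_pwDl ?exprn_gt0// sumr_ge0// => b' _; rewrite sqr_ge0.
  have Fj j : (0 < b j)%N -> a b ^+ 2 / g j <= F b.
    move=> bj; rewrite /F (bigD1 j)//= -addrA lerDl addr_ge0// sumr_ge0// => i _.
    by rewrite divr_ge0// sqr_ge0.
  rewrite -(@ler_pXn2r _ k.+1)// ?nnegrE ?exprn_ge0//.
  rewrite -exprM mulnC exprM uE.
  have -> : (a b ^+ 2) ^+ k = (\prod_j (a b ^+ 2 / g j) ^+ mi b j) * G b.
    rewrite /G -big_split /= -[in LHS](eqP wb) /wt expr_sum; apply: eq_bigr => j _.
    rewrite /mi -exprMn; have [->|bj] := posnP (b j); first by rewrite !expr0.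
    by rewrite divfK// gt_eqF// gp.
  rewrite [F b ^+ k.+1]exprSr ler_pM//; last 2 first.
  - rewrite -[in leRHS](eqP wb) /wt expr_sum; apply: ler_prod => j _.
    rewrite exprn_ge0 ?divr_ge0 ?sqr_ge0//=.
    rewrite /mi; have [->|bj] := posnP (b j); first by rewrite !expr0.
    by apply: lerXn2r; rewrite ?nnegrE ?divr_ge0 ?sqr_ge0 ?Fj.
  - by rewrite /F lerDr sumr_ge0// => j _; rewrite divr_ge0// sqr_ge0.
  by apply: prodr_ge0 => j _; rewrite exprn_ge0// divr_ge0// sqr_ge0.
apply: (le_trans (ler_sum _ main)).
rewrite big_split /= lerD ?sum_mon_le_exp//.
rewrite (exchange_big_dep xpredT)//=; apply: ler_sum => j _.
have -> : \sum_(b | (wt (mi b) == k) && (0 < b j)%N) a b ^+ 2 / g j = g j ^+ 2 / g j.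
  by rewrite sg mulr_suml.
have [->|gj] := eqVneq (g j) 0; first by rewrite expr2 !mul0r.
by rewrite expr2 mulfK.
Qed.

Lemma avg_ratio (L a b : nat) (r : R) : (a < L)%N -> (b < L)%N -> 0 < r ->
  avg L (fun z : C => z ^+ a * z ^- b) r = (a == b)%:R.
Proof.
move=> aL bL r0; have L0 : (0 < L)%N by apply: leq_ltn_trans aL.
have nz (z : C) : cabs z = `|r| -> z != 0.
  by move=> zr; rewrite -cabs_eq0 zr normr_eq0 gt_eqF.
have [ba|ab] := leqP b a.
  rewrite (@eq_avg R L _ (fun z : C => z ^+ (a - b))) => [|z /nz z0]; last first.
    by rewrite -[in LHS](subnK ba) exprD mulfK ?expf_neq0.
  rewrite avgX//; have [->|anb] := eqVneq a b; first by rewrite subnn dvdn0 expr0 rmorph1.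
  rewrite gtnNdvd//; last by rewrite (leq_ltn_trans (leq_subr _ _)).
  by rewrite subn_gt0 ltn_neqAle ba andbT eq_sym.
rewrite (@eq_avg R L _ (fun z : C => z ^- (b - a))) => [|z /nz z0]; last first.
  by rewrite -[in LHS](subnK (ltnW ab)) exprD invfM mulrCA mulfV ?mulr1 ?expf_neq0.
rewrite avgVX// gtnNdvd ?subn_gt0//; last by rewrite (leq_ltn_trans (leq_subr _ _)).
by rewrite ltn_eqF.
Qed.

Definition mbin b b' : nat := (\prod_i 'C(b i, b' i))%N.

(* coefficients of w^b in the Taylor expansion of sum_b c_b (z + w)^b at z *)
Definition deriv c b z : C :=
  expsum (fun a => c a * (mbin a b)%:R) (fun a i => (a i - b i)%N) z.

Lemma esum_shift c z w (t : C) : expsum c mi (fun i => z i + t * w i) =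
  \sum_b t ^+ wt (mi b) * (deriv c b z * mon w (mi b)).
Proof.
have E a : mon (fun i => z i + t * w i) (mi a) =
    \sum_b (mbin a b)%:R * mon z (fun i => (a i - b i)%N) * (t ^+ wt (mi b) * mon w (mi b)).
  rewrite /mon (eq_bigr (fun i => \sum_(g < N.+2) 'C(a i, g)%:R * z i ^+ (a i - g) * (t * w i) ^+ g)).
    rewrite bigA_distr_bigA /=; apply: eq_bigr => b _.
    by rewrite !big_split /= -monZ /mon natr_prod.
  move=> i _; rewrite exprDn.
  rewrite (big_ord_widen N.+2 (fun g => z i ^+ (mi a i - g) * (t * w i) ^+ g *+ 'C(mi a i, g))); last exact: mi_lt.
  rewrite big_mkcond; apply: eq_bigr => g _; case: ifP => [_|/negbT].
    by rewrite -mulr_natl mulrA.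
  by rewrite -leqNgt => lt; rewrite bin_small// !mul0r.
transitivity (\sum_a \sum_b c a * ((mbin a b)%:R * mon z (fun i => (a i - b i)%N) *
    (t ^+ wt (mi b) * mon w (mi b)))).
  by apply: eq_bigr => a _; rewrite E mulr_sumr.
rewrite exchange_big /=; apply: eq_bigr => b _.
rewrite /deriv /expsum mulr_suml mulr_sumr; apply: eq_bigr => a _; ring.
Qed.

Lemma esum_hom c m z (t : C) : (forall b, c b != 0 -> wt (mi b) = m) ->
  expsum c mi (fun i => t * z i) = t ^+ m * expsum c mi z.
Proof.
move=> hom; rewrite /expsum mulr_sumr; apply: eq_bigr => b _; rewrite monZ.
have [->|cb] := eqVneq (c b) 0; first by rewrite !mul0r mulr0.
by rewrite hom//; ring.
Qed.

Lemma wt_lt b : (wt (mi b) < (n * N.+2).+1)%N.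
Proof.
rewrite ltnS -[n in (n * _)%N]card_ord -sum_nat_const; apply: leq_sum => i _.
exact/ltnW/mi_lt.
Qed.

(** Cauchy's estimate for s |-> P (z + s w) on the circle |s| = t, where homogeneity bounds P by B
    (1 + t)^m. The parameter t is left free: 1 for gradients, 1 / m to keep the loss polynomial in
    m. *)
Lemma deriv_bound c m k z w (B t : R) : (forall b, c b != 0 -> wt (mi b) = m) ->
  (forall y, (forall i, cabs (y i) <= 1) -> cabs (expsum c mi y) <= B) ->
  (forall i, cabs (z i) <= 1) -> (forall i, cabs (w i) <= 1) -> 0 < t ->
  cabs (\sum_(b | wt (mi b) == k) deriv c b z * mon w (mi b)) <= B * (1 + t) ^+ m * t ^- k.
Proof.
move=> hom cB z1 w1 t0.
have t1 : 0 < 1 + t by rewrite addr_gt0.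
pose L := (maxn (n * N.+2) k).+1.
have kL : (k < L)%N by rewrite ltnS leq_maxr.
have wL b : (wt (mi b) < L)%N by rewrite (leq_trans (wt_lt b))// ltnS leq_maxl.
have -> : \sum_(b | wt (mi b) == k) deriv c b z * mon w (mi b) =
   avg L (fun s => expsum c mi (fun i => z i + s * w i) * s ^- k) t.
  have -> : avg L (fun s => expsum c mi (fun i => z i + s * w i) * s ^- k) t =
     avg L (fun s => \sum_b (deriv c b z * mon w (mi b)) * (s ^+ wt (mi b) * s ^- k)) t.
    by apply: eq_avg => s _; rewrite esum_shift mulr_suml; apply: eq_bigr => b _; ring.
  rewrite avg_sum [LHS]big_mkcond; apply: eq_bigr => b _; rewrite avgZ avg_ratio//.
  by case: eqP => _; rewrite ?mulr1 ?mulr0.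
apply: cabs_avg => // s; rewrite gtr0_norm// => st.
rewrite cabsM cabsV cabsX st ler_wpM2r ?invr_ge0 ?exprn_ge0 ?(ltW t0)//.
have tn : (1 + t)%:C != 0 by rewrite -cabs_eq0 cabsR gtr0_norm// gt_eqF.
have -> : (fun i => z i + s * w i) = (fun i => (1 + t)%:C * ((z i + s * w i) / (1 + t)%:C)).
  by apply/funext => i; rewrite mulrCA mulfV ?mulr1.
rewrite (esum_hom _ _ hom) cabsM cabsX cabsR gtr0_norm// mulrC ler_wpM2r ?exprn_ge0 ?(ltW t1)//.
apply: cB => i; rewrite cabsM cabsV cabsR gtr0_norm// ler_pdivrMr// mul1r.
rewrite (le_trans (cabsD _ _))// cabsM st lerD// -[leRHS]mulr1 ler_wpM2l// ltW//.
Qed.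

Definition unit_mi j : T := [ffun i => inord (i == j)].

Lemma mi_unit j i : mi (unit_mi j) i = (i == j).
Proof. by rewrite /mi ffunE inordK//; case: (i == j). Qed.

Lemma wt_unit j : wt (mi (unit_mi j)) = 1%N.
Proof.
rewrite /wt (bigD1 j)//= mi_unit eqxx big1// => i ij.
by rewrite mi_unit (negbTE ij).
Qed.

Lemma unit_mi_inj : injective unit_mi.
Proof. by move=> j j' E; have := mi_unit j j; rewrite E mi_unit eqxx; case: eqP. Qed.

Lemma wt1P b : (wt (mi b) == 1%N) = (b \in unit_mi @: [set: 'I_n]%SET).
Proof.
apply/eqP/imsetP => [w1|[j _ ->]]; last exact: wt_unit.
have [|j bj] := @wt_gt0 (mi b); first by rewrite w1.
exists j; first by rewrite inE.
apply: mi_inj => i; rewrite mi_unit.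
move: w1; rewrite /wt (bigD1 j)//= => /eqP; move: bj; rewrite /mi.
case: (eqVneq i j) => [->|ij] bj E.
  by move: E; case: (nat_of_ord (b j)) bj => [//|[|]].
have : (b j + b i <= 1)%N.
  by rewrite -(eqP E) leq_add2l (bigD1 i)//= leq_addr.
by case: (nat_of_ord (b j)) bj => // x _; rewrite addSn ltnS leqn0 addn_eq0 => /andP[_ /eqP].
Qed.

Lemma mon_unit v j : mon v (mi (unit_mi j)) = v j.
Proof.
rewrite /mon (bigD1 j)//= mi_unit eqxx expr1 big1 ?mulr1// => i ij.
by rewrite mi_unit (negbTE ij) expr0.
Qed.

(** The linear part of P (w + v) in v is tested at the v_j that are the phases of the partial
    derivatives, with t = 1 in [deriv_bound]. *)
Lemma gradient_bound c k w (B : R) : (forall b, c b != 0 -> wt (mi b) = k) ->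
  (forall y, (forall i, cabs (y i) <= 1) -> cabs (expsum c mi y) <= B) ->
  (forall i, cabs (w i) <= 1) ->
  \sum_j cabs (deriv c (unit_mi j) w) <= 2 ^+ k * B.
Proof.
move=> hom cB w1.
have /choice[v Hv] : forall j, exists x, cabs x = 1 /\
    x * deriv c (unit_mi j) w = (cabs (deriv c (unit_mi j) w))%:C.
  by move=> j; have [x x1 x2] := cabs_phase (deriv c (unit_mi j) w); exists x.
have v1 j : cabs (v j) <= 1 by rewrite (Hv j).1.
have := deriv_bound 1 hom cB w1 v1 ltr01.
rewrite expr1 invr1 mulr1 [B * _]mulrC.
rewrite (eq_bigl _ _ wt1P) big_imset /=; last by move=> j j' _ _; apply: unit_mi_inj.
have -> : \sum_(j in [set: 'I_n]%SET) deriv c (unit_mi j) w * mon v (mi (unit_mi j)) =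
   (\sum_j cabs (deriv c (unit_mi j) w))%:C.
  rewrite rmorph_sum; apply: eq_big => [j|j _]; first by rewrite inE.
  by rewrite mon_unit mulrC (Hv j).2.
by rewrite cabsR ger0_norm ?sumr_ge0// => j _; apply: cabs_ge0.
Qed.

Lemma mbin_neq0 (a b : T) : mbin a b != 0%N -> forall i, (b i <= a i)%N.
Proof.
rewrite -lt0n => h i; rewrite leqNgt; apply/negP => lt.
by move: h; rewrite /mbin (bigD1 i)//= bin_small.
Qed.

Lemma mbin_gt0 (a b : T) : (forall i, (b i <= a i)%N) -> (0 < mbin a b)%N.
Proof. by move=> h; rewrite prodn_gt0// => i; rewrite bin_gt0. Qed.

Section DerivProps.
Variables (c : T -> C) (b : T) (m : nat).
Hypothesis hom : forall a, c a != 0 -> wt (mi a) = m.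
Let q a := c a * (mbin a b)%:R.
Let e (a : T) i := (a i - b i)%N.

Lemma deriv_le a : q a != 0 -> forall i, (b i <= a i)%N.
Proof.
by rewrite mulf_eq0 negb_or pnatr_eq0 => /andP[_ h]; apply: mbin_neq0.
Qed.

Lemma deriv_inj a a' : q a != 0 -> q a' != 0 -> e a =1 e a' -> a = a'.
Proof.
move=> qa qa' ee; apply: mi_inj => i; rewrite /mi.
by rewrite -(subnK (deriv_le qa i)) -(subnK (deriv_le qa' i)) -!/(e _ i) ee.
Qed.

Lemma deriv_hom a : q a != 0 -> wt (e a) = (m - wt (mi b))%N.
Proof.
move=> qa; have := qa; rewrite mulf_eq0 negb_or => /andP[/hom <- _].
rewrite /wt -sumnB// => i _; exact: deriv_le.
Qed.

Lemma deriv_exp_lt a i : ((e a i).*2 < (N.+2).*2)%N.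
Proof. by rewrite ltn_double (leq_ltn_trans (leq_subr _ _)). Qed.

End DerivProps.

Lemma exp_bound m : (0 < m)%N -> (1 + (m%:R : R)^-1) ^+ m <= expR 1.
Proof.
move=> m0; have h : 1 + (m%:R : R)^-1 <= expR m%:R^-1 by apply: expR_ge1Dx.
have : (1 + (m%:R : R)^-1) ^+ m <= expR m%:R^-1 ^+ m.
  by apply: lerXn2r; rewrite ?nnegrE ?expR_ge0// addr_ge0// invr_ge0.
by rewrite -expRM_natl mulfV ?pnatr_eq0 -?lt0n//.
Qed.

(** The factor e m^k bounds the part of degree k in w of P (z + w), 2^k comes from [gradient_bound],
    and 2^(k-1) from comparing L^2 with L^1 in degree k - 1. For fixed k it is polynomial in m. *)
Definition sidon_const k m : R := 2 ^+ k.-1 * (2 ^+ k * (expR 1 * m%:R ^+ k)).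

(* At each point z of the torus, a polynomial Bohnenblust-Hille inequality for the
   k-homogeneous part in w of P(z + w); k is kept fixed. *)
Lemma deriv_blei c m k z (u : T -> R) : (0 < k)%N -> (0 < m)%N ->
  (forall b, c b != 0 -> wt (mi b) = m) ->
  (forall y, (forall i, cabs (y i) <= 1) -> cabs (expsum c mi y) <= 1) ->
  (forall i, cabs (z i) <= 1) ->
  (forall b, 0 <= u b) -> (forall b, u b ^+ k.+1 = cabs (deriv c b z) ^+ 2) ->
  \sum_(b | wt (mi b) == k) u b ^+ k <= sidon_const k m + sidon_const k m ^+ k.
Proof.
move=> k0 m0 hom cB z1 u0 uE.
have := blei k0 (fun b => cabs_ge0 (deriv c b z)) u0 uE.
set g := blei_weight _ _; set M := \sum_j g j => h.
suff MM : M <= sidon_const k m.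
  have M0 : 0 <= M by apply: sumr_ge0 => j _; apply: sqrtr_ge0.
  rewrite (le_trans h)// lerD//; apply: lerXn2r; rewrite ?nnegrE//.
  exact: le_trans MM.
(* The part of degree k in w of P (z + w). Its supremum is controlled by [deriv_bound] at t = 1 / m,
   where (1 + 1/m)^m <= e. *)
pose c' b := if wt (mi b) == k then deriv c b z else 0.
have hom' b : c' b != 0 -> wt (mi b) = k.
  by rewrite /c'; case: ifP => [/eqP//|_]; rewrite eqxx.
pose K : R := expR 1 * m%:R ^+ k.
have mp : 0 < m%:R :> R by rewrite ltr0n.
have cB' w : (forall i, cabs (w i) <= 1) -> cabs (expsum c' mi w) <= K.
  move=> w1; have mi0 : 0 < (m%:R : R)^-1 by rewrite invr_gt0.
  have := deriv_bound k hom cB z1 w1 mi0.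
  rewrite mul1r exprVn invrK => hb.
  have -> : expsum c' mi w = \sum_(b | wt (mi b) == k) deriv c b z * mon w (mi b).
    rewrite /expsum [RHS]big_mkcond; apply: eq_bigr => b _; rewrite /c'.
    by case: ifP => // _; rewrite mul0r.
  by rewrite (le_trans hb)// ler_wpM2r ?exprn_ge0 ?(ltW mp)// exp_bound.
have L0 : (0 < (N.+2).*2)%N by [].
(* [hypercontractive] with exponent 1 for the derivative in direction j, of degree k - 1; its
   coefficients are those of [c'] with b_j > 0, times integers at least 1. *)
have gj j : g j <= 2 ^+ k.-1 * gavg ((N.+2).*2) (fun w => cabs (deriv c' (unit_mi j) w)).
  have V0 : 0 <= gavg ((N.+2).*2) (fun w => cabs (deriv c' (unit_mi j) w)).
    rewrite -[leLHS](gavg_cst n L0 (0 : R)); apply: gavg_le => // w _; exact: cabs_ge0.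
  rewrite -(@ler_pXn2r _ 2)// ?nnegrE ?sqrtr_ge0//; last by rewrite mulr_ge0// exprn_ge0.
  rewrite sqr_sqrtr; last by rewrite sumr_ge0// => b _; rewrite sqr_ge0.
  have := @hypercontractive R n _ L0 _ _ _ k.-1 1 (fun w => cabs (deriv c' (unit_mi j) w))
    (deriv_exp_lt (unit_mi j)) (deriv_inj (c := c') (b := unit_mi j)) _ isT (fun w => cabs_ge0 _)
    (fun w => erefl).
  rewrite expr1 => H; have {H} := H _.
  have hh a : c' a * (mbin a (unit_mi j))%:R != 0 -> wt (fun i => (a i - unit_mi j i)%N) = k.-1.
    by move=> qa; rewrite (deriv_hom hom' qa) wt_unit subn1.
  move=> /(_ hh) H.
  have -> : (2 ^+ k.-1 * gavg (N.+2).*2 (fun w => cabs (deriv c' (unit_mi j) w))) ^+ 2 =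
      4 ^+ k.-1 * gavg (N.+2).*2 (fun w => cabs (deriv c' (unit_mi j) w)) ^+ 2.
    by rewrite exprMn -exprM mulnC exprM; congr (_ ^+ _ * _); rewrite expr2; ring.
  rewrite (le_trans _ H)//.
  rewrite big_mkcond /=; apply: ler_sum => b _; case: ifP => [/andP[wb bj]|_]; last exact: sqr_ge0.
  rewrite /c' wb cabsM exprMn ler_peMr ?sqr_ge0//.
  rewrite cabs_nat exprn_ege1// ler1n mbin_gt0// => i.
  by rewrite -[unit_mi j i : nat]/(mi (unit_mi j) i) mi_unit; case: eqP => [->|].
apply: (le_trans (ler_sum _ (fun j _ => gj j))).
rewrite -mulr_sumr -gavg_sum ler_wpM2l ?exprn_ge0//.
apply: gavg_bound => // w w1; apply: (gradient_bound hom') => // i.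
by rewrite w1.
Qed.

Definition nmon d : nat := #|[pred b : T | wt (mi b) == d]|.

(** The coefficients are recovered from the derivatives [deriv c b] of order k: Cauchy-Schwarz over
    at most [nmon (m - k)] monomials, [hypercontractive] from L^2 to L^p with p = 2k/(k+1), and
    [deriv_blei] at each grid point, which bounds the sum over b of the p-th powers. [D] is
    4^((m-k)/(k+1)). *)
Lemma sidon c m k (D : R) : (0 < k)%N -> (k <= m)%N -> (0 < n)%N ->
  (forall b, c b != 0 -> wt (mi b) = m) ->
  (forall y, (forall i, cabs (y i) <= 1) -> cabs (expsum c mi y) <= 1) ->
  0 <= D -> D ^+ k.+1 = 4 ^+ (m - k) ->
  \sum_b cabs (c b) <= Num.sqrt (nmon (m - k)%N)%:R * (Num.sqrt n%:R ^+ k.-1 *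
     (1 + D * (sidon_const k m + sidon_const k m ^+ k))).
Proof.
move=> k0 km n0 hom cB D0 DE; have m0 : (0 < m)%N by apply: leq_trans km.
pose L := (N.+2).*2; have L0 : (0 < L)%N by [].
have /choice[U HU] : forall b, exists f : ('I_n -> C) -> R, forall z, 0 <= f z /\
    f z ^+ k.+1 = cabs (deriv c b z) ^+ 2.
  move=> b; have /choice[f Hf] : forall z, exists y : R, 0 <= y /\ y ^+ k.+1 = cabs (deriv c b z) ^+ 2.
    by move=> z; have [y y0 yE] := root_exists k (sqr_ge0 (cabs (deriv c b z))); exists y.
  by exists f.
pose q b a := c a * (mbin a b)%:R.
pose S b := \sum_a cabs (q b a) ^+ 2.
have S0 b : 0 <= S b by apply: sumr_ge0 => a _; apply: sqr_ge0.
pose V b := gavg L (fun z => U b z ^+ k).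
have V0 b : 0 <= V b.
  rewrite -[leLHS](gavg_cst n L0 (0 : R)); apply: gavg_le => // z _.
  by rewrite exprn_ge0// (HU b z).1.
have hyp b : wt (mi b) = k -> S b ^+ k <= 4 ^+ (m - k) * V b ^+ k.+1.
  move=> wb; apply: (hypercontractive L0 (deriv_exp_lt b) (deriv_inj (b := b)) _ k0
    (fun z => (HU b z).1) (fun z => (HU b z).2)).
  by move=> a qa; rewrite (deriv_hom hom qa) wb.
pose A := sidon_const k m + sidon_const k m ^+ k.
have VA : \sum_(b | wt (mi b) == k) V b <= A.
  rewrite -gavg_sum; apply: gavg_bound => // z z1.
  apply: (deriv_blei k0 m0 hom cB (z := z)) => [i|b|b]; first by rewrite z1.
    exact: (HU b z).1.
  exact: (HU b z).2.
(* A coefficient c_a reappears in [deriv c b] for each b <= a, with an integer factor at least 1,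
   and some such b has degree k. *)
have step1 : \sum_b cabs (c b) <= \sum_(b | wt (mi b) == k) \sum_a cabs (q b a).
  rewrite exchange_big /=; apply: ler_sum => a _.
  have [->|ca] := eqVneq (c a) 0; first by rewrite cabs0 sumr_ge0// => b _; apply: cabs_ge0.
  have [|b [ba wb]] := @exists_sub_mi a k; first by rewrite hom.
  rewrite (bigD1 b) ?wb//= ler_wpDr ?sumr_ge0// => [b' _|]; first exact: cabs_ge0.
  by rewrite cabsM cabs_nat ler_peMr ?cabs_ge0// ler1n mbin_gt0.
have step2 b : wt (mi b) = k -> \sum_a cabs (q b a) <= Num.sqrt (nmon (m - k)%N)%:R * Num.sqrt (S b).
  move=> wb; rewrite -sqrtrM// -[leLHS]ger0_norm; last by rewrite sumr_ge0// => a _; apply: cabs_ge0.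
  rewrite -sqrtr_sqr ler_sqrt; last by rewrite mulr_ge0.
  have E (F : R -> R) : F 0 = 0 -> \sum_a F (cabs (q b a)) = \sum_(a in [pred a | q b a != 0]) F (cabs (q b a)).
    move=> F0; rewrite [RHS]big_mkcond; apply: eq_bigr => a _; rewrite inE.
    by case: eqP => // ->; rewrite cabs0.
  rewrite (E id)// (le_trans (sqr_sum_le _ _))// -(E (fun x => x ^+ 2)) ?expr0n//.
  rewrite ler_wpM2r ?S0// ler_nat /nmon.
  pose h (a : T) : T := [ffun i => inord (a i - b i)].
  have hE a i : mi (h a) i = (a i - b i)%N.
    by rewrite /mi ffunE inordK// (leq_ltn_trans (leq_subr _ _)).
  rewrite -(card_in_imset (f := h)).
    apply: subset_leq_card; apply/fintype.subsetP => _ /imsetP[a + ->].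
    rewrite !inE => qa; rewrite -wb -(deriv_hom hom qa); apply/eqP.
    by apply: eq_bigr => i _; rewrite hE.
  move=> a a'; rewrite !inE => qa qa' hh; apply: (deriv_inj qa qa') => i.
  by rewrite -!hE hh.
pose nu : R := Num.sqrt n%:R.
have nu0 : 0 < nu by rewrite sqrtr_gt0 ltr0n.
have nuE : nu ^+ 2 = n%:R by rewrite sqr_sqrtr.
(* Pointwise substitute for Hoelder's inequality in the sum over b. Put s = [Num.sqrt (S b)]. Below
   the threshold n^(-(k+1)/2) the first summand suffices; above it, s = s^p s^(1-p), where s^(1-p)
   <= n^((k-1)/2) because 1 - p = -(k-1)/(k+1). *)
have step3 b : wt (mi b) = k -> Num.sqrt (S b) <= nu ^- k.+1 + nu ^+ k.-1 * (D * V b).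
  move=> wb; set s := Num.sqrt (S b); have s0 : 0 <= s by apply: sqrtr_ge0.
  have sE : s ^+ 2 = S b by rewrite sqr_sqrtr.
  have DV0 : 0 <= nu ^+ k.-1 * (D * V b).
    by apply: mulr_ge0; [rewrite exprn_ge0// ltW|exact: mulr_ge0 (V0 b)].
  have nk0 : 0 < nu ^- k.+1 by rewrite invr_gt0 exprn_gt0.
  have [le|lt] := leP s (nu ^- k.+1); first by rewrite (le_trans le)// lerDl.
  rewrite ler_wpDl ?(ltW nk0)//.
  have [sig sig0 sigE] := root_exists k (S0 b).
  have sigV : sig ^+ k <= D * V b.
    have DV : 0 <= D * V b by exact: mulr_ge0 (V0 b).
    rewrite -(@ler_pXn2r _ k.+1)// ?nnegrE ?exprn_ge0//.
    by rewrite -exprM mulnC exprM sigE exprMn DE hyp.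
  apply: (@le_trans _ _ (nu ^+ k.-1 * sig ^+ k)); last by rewrite ler_wpM2l ?exprn_ge0 ?(ltW nu0).
  have big1 : 1 <= nu ^+ 2 * sig.
    have ns0 : 0 <= nu ^+ 2 * sig by rewrite mulr_ge0// exprn_ge0// ltW.
    rewrite -(@ler_pXn2r _ k.+1)// ?nnegrE// expr1n exprMn sigE -sE.
    rewrite -exprM mulnC exprM -exprMn.
    rewrite exprn_ege1// ltW// -ltr_pdivrMl ?exprn_gt0// mulr1//.
  rewrite -(@ler_pXn2r _ 2)// ?nnegrE ?mulr_ge0 ?exprn_ge0 ?(ltW nu0)//.
  rewrite sE -sigE exprMn -!exprM.
  have -> : (k * 2 = k.+1 + k.-1)%N by rewrite muln2 addSn -addnS prednK// addnn.
  rewrite exprD mulrCA ler_peMr ?exprn_ge0//.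
  by rewrite mulnC exprM -exprMn exprn_ege1.
apply: (le_trans step1).
apply: (@le_trans _ _ (\sum_(b | wt (mi b) == k) Num.sqrt (nmon (m - k)%N)%:R *
   (nu ^- k.+1 + nu ^+ k.-1 * (D * V b)))).
  apply: ler_sum => b /eqP wb; rewrite (le_trans (step2 b wb))//.
  by rewrite ler_wpM2l ?sqrtr_ge0// step3.
rewrite -mulr_sumr ler_wpM2l ?sqrtr_ge0// big_split /= mulrDr mulr1 lerD//.
  (* There are at most n^k multi-indices of degree k, so the thresholds add up to at most
     n^((k-1)/2). *)
  have -> : nu ^+ k.-1 = nu ^- k.+1 * n%:R ^+ k.
    have kk : (k.+1 + k.-1 = 2 * k)%N by rewrite addSn -addnS prednK// addnn mul2n.
    by rewrite -nuE -exprM -kk exprD mulKf// expf_neq0// gt_eqF.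
  have := sum_mon_le_exp k (fun _ : 'I_n => ler01).
  rewrite sumr_const card_ord => /(ler_wpM2l (_ : 0 <= nu ^- k.+1)).
  rewrite invr_ge0 exprn_ge0 ?(ltW nu0)// => /(_ isT); apply: le_trans.
  rewrite mulr_sumr; apply: ler_sum => b _.
  by rewrite big1 ?mulr1// => j _; rewrite expr1n.
rewrite -mulr_sumr ler_wpM2l ?exprn_ge0 ?(ltW nu0)// -mulr_sumr ler_wpM2l//.
Qed.

(** Generating function: each monomial of degree d contributes x^d to a product of n geometric sums.
    The two ranges of degrees will choose x differently. *)
Lemma nmon_bound d (x : R) : 0 < x < 1 -> (nmon d)%:R <= x ^- d * (1 - x)^-1 ^+ n.
Proof.
move=> /andP[x0 x1]; have x1' : 0 < 1 - x by rewrite subr_gt0.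
rewrite mulrC ler_pdivlMr ?exprn_gt0//.
apply: (@le_trans _ _ (\sum_(b : T) \prod_i x ^+ b i)).
  rewrite /nmon -sum1_card natr_sum mulr_suml big_mkcond /=; apply: ler_sum => b _.
  rewrite inE; case: eqP => [<-|_]; first by rewrite mul1r /wt expr_sum.
  by apply: prodr_ge0 => i _; rewrite exprn_ge0// ltW.
rewrite -(bigA_distr_bigA (fun i (k : 'I_N.+2) => x ^+ k)).
rewrite -[n in leRHS]card_ord -prodr_const; apply: ler_prod => i _.
apply/andP; split; first by apply: sumr_ge0 => k _; rewrite exprn_ge0// ltW.
rewrite -[leRHS]mul1r ler_pdivlMr// mulrC.
have := subrX1 x N.+2; rewrite -opprB -[X in _ = X * _]opprB mulNr => /oppr_inj <-.
by rewrite gerBl exprn_ge0// ltW.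
Qed.

End Sidon.

Arguments mi {n N} b i.

(** * Wiener's inequality and the reduction to homogeneous polynomials *)

Section Wiener.
Variables (R : realType) (n N : nat).
Local Notation "x %:C" := (real_complex R x) : ring_scope.
Local Notation C := R[i].
Local Notation T := {ffun 'I_n -> 'I_N.+2}.
Implicit Types (b : T) (c : T -> C).

Definition hpart c m : T -> C := fun b => if wt (mi b) == m then c b else 0.

Lemma hpart_hom c m b : hpart c m b != 0 -> wt (mi b) = m.
Proof. by rewrite /hpart; case: ifP => [/eqP//|_]; rewrite eqxx. Qed.

Lemma wt_eq0 b : (wt (mi b) == 0%N) = (b == [ffun=> ord0]).
Proof.
apply/eqP/eqP => [w0|->]; last by rewrite /wt big1// => i _; rewrite /mi ffunE.
apply: mi_inj => i; rewrite /mi ffunE; apply/eqP.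
by have /eqP := w0; rewrite /wt sum_nat_eq0 => /forallP/(_ i).
Qed.

(* Test z |-> P (l z) on the circle against the positive kernel 1 + Re (th l^-m). *)
Lemma wiener c m z : (0 < m)%N ->
  (forall y, (forall i, cabs (y i) <= 1) -> cabs (expsum c mi y) <= 1) ->
  (forall i, cabs (z i) <= 1) ->
  cabs (expsum (hpart c m) mi z) <= 2 * (1 - cabs (c [ffun=> ord0])).
Proof.
move=> m0 cB z1; set c0 := c _; set Pm := expsum _ _ _.
have [u u1 uE] := cabs_phase c0; have [v v1 vE] := cabs_phase Pm.
have un : u != 0 by rewrite -cabs_eq0 u1 oner_eq0.
(* With this phase c_0 and P_m point in the same direction, so the average against the kernel has
   modulus |c_0| + |P_m| / 2. *)
pose th := v / u; have th1 : cabs th = 1 by rewrite cabsM cabsV u1 v1 divr1.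
(* Exceeds every degree of P plus m, so no aliasing occurs in any of the averages below. *)
pose L := (n * N.+2 + m).+1.
have wmL b : (wt (mi b) + m < L)%N by rewrite ltnS leq_add2r -ltnS wt_lt.
have wL b : (wt (mi b) < L)%N by apply: leq_ltn_trans (wmL b); rewrite leq_addr.
have mL : (m < L)%N by rewrite ltnS leq_addl.
have L0 : (0 < L)%N by [].
pose K (l : C) : C := 1 + (th * l ^- m + conjc th * l ^+ m) / 2.
have KE (l : C) : cabs l = 1 -> K l = (1 + complex.Re (th * l ^- m))%:C.
  move=> l1; have lc : conjc l = l^-1.
    have ln : l != 0 by rewrite -cabs_eq0 l1 oner_eq0.
    by apply: (mulfI ln); rewrite mul_conjc l1 expr1n mulfV.
  have -> : (1 + complex.Re (th * l ^- m))%:C = 1 + (complex.Re (th * l ^- m))%:C.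
    by rewrite rmorphD rmorph1.
  rewrite /K ReJ_add; congr (_ + (_ + _) / _).
  have h : l ^+ m = conjc (l ^- m) by rewrite -exprVn -lc -conjcX conjcK.
  by rewrite {1}h; apply/esym/rmorphM.
have K0 (l : C) : cabs l = 1 -> cabs (K l) = complex.Re (K l).
  move=> l1; rewrite KE// cabsR ger0_norm//.
  have := Re_le_cabs (th * l ^- m); rewrite cabsM cabsV cabsX l1 expr1n invr1 mulr1 th1.
  by rewrite ler_norml; lra.
pose F (l : C) := expsum c mi (fun i => l * z i).
have FE l : F l = \sum_b l ^+ wt (mi b) * (c b * mon z (mi b)).
  by apply: eq_bigr => b _; rewrite monZ mulrCA.
have avgF k : (k < L)%N -> avg L (fun l => F l * l ^- k) 1 =
    \sum_(b | wt (mi b) == k) c b * mon z (mi b).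
  move=> kL; rewrite (@eq_avg R L _ (fun l => \sum_b (c b * mon z (mi b)) *
     (l ^+ wt (mi b) * l ^- k))) => [|l _]; last first.
    by rewrite FE mulr_suml; apply: eq_bigr => b _; ring.
  rewrite avg_sum [RHS]big_mkcond; apply: eq_bigr => b _.
  by rewrite avgZ avg_ratio//; case: eqP => _; rewrite ?mulr1 ?mulr0.
have avgF' : avg L (fun l => F l * l ^+ m) 1 = 0.
  rewrite (@eq_avg R L _ (fun l => \sum_b (c b * mon z (mi b)) *
     l ^+ (wt (mi b) + m))) => [|l _]; last first.
    by rewrite FE mulr_suml; apply: eq_bigr => b _; rewrite exprD; ring.
  rewrite avg_sum big1// => b _; rewrite avgZ avgX// gtnNdvd ?mulr0//.
  by rewrite addn_gt0 m0 orbT.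
have avgFK : avg L (fun l => F l * K l) 1 = c0 + Pm * th / 2.
  have -> : avg L (fun l => F l * K l) 1 = avg L (fun l => F l * l ^- 0) 1 +
     (th / 2) * avg L (fun l => F l * l ^- m) 1 + (conjc th / 2) * avg L (fun l => F l * l ^+ m) 1.
    rewrite -!avgZ /avg -!mulrDr -!big_split /=; congr (_ * _); apply: eq_bigr => j _.
    by rewrite /K expr0 invr1; ring.
  rewrite avgF' mulr0 addr0 !avgF//; congr (_ + _).
    rewrite (eq_bigl _ _ wt_eq0) big_pred1_eq /mon big1 ?mulr1// => i _.
    by rewrite /mi ffunE expr0.
  have -> : \sum_(b | wt (mi b) == m) c b * mon z (mi b) = Pm.
    rewrite big_mkcond; apply: eq_bigr => b _; rewrite /hpart; case: ifP => // _.
    by rewrite mul0r.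
  by ring.
have avgK : avg L K 1 = 1.
  have -> : avg L K 1 = avg L (fun l => l ^+ 0 * l ^- 0) 1 + (th / 2) * avg L (fun l => l ^+ 0 * l ^- m) 1
      + (conjc th / 2) * avg L (fun l => l ^+ m) 1.
    rewrite -!avgZ /avg -!mulrDr -!big_split /=; congr (_ * _); apply: eq_bigr => j _.
    by rewrite /K expr0 invr1; ring.
  by rewrite avgX// !avg_ratio// gtnNdvd// eqxx (ltn_eqF m0) !mulr0 !addr0.
have bnd : cabs (avg L (fun l => F l * K l) 1) <= 1.
  have l1 j : cabs (1%:C * om R L ^+ j) = 1 by rewrite rmorph1 mul1r cabsX cabs_om expr1n.
  rewrite /avg cabsM cabsV cabs_nat.
  apply: (@le_trans _ _ (L%:R^-1 * \sum_(j < L) complex.Re (K (1%:C * om R L ^+ j)))).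
    rewrite ler_wpM2l ?invr_ge0// (le_trans (cabs_sum _ _ _))//; apply: ler_sum => j _.
    rewrite cabsM -K0// ler_piMl ?cabs_ge0//; apply: cB => i.
    by rewrite cabsM l1 mul1r.
  move: avgK; rewrite /avg => /(congr1 (@complex.Re R)).
  have -> : (L%:R^-1 : C) = (L%:R^-1)%:C by rewrite fmorphV rmorph_nat.
  have ReZ (x : R) (w : C) : complex.Re (x%:C * w) = x * complex.Re w.
    by case: w => a b /=; rewrite mul0r subr0.
  by rewrite ReZ raddf_sum /= => ->.
have : cabs (u * (c0 + Pm * th / 2)) <= 1 by rewrite cabsM u1 mul1r -avgFK.
have -> : u * (c0 + Pm * th / 2) = (cabs c0 + cabs Pm / 2)%:C.
  have -> : (cabs c0 + cabs Pm / 2)%:C = (cabs c0)%:C + (cabs Pm)%:C / 2.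
    by rewrite rmorphD rmorphM fmorphV rmorph_nat.
  rewrite -uE -vE /th; field.
  by rewrite un.
rewrite cabsR ger0_norm; first lra.
by rewrite addr_ge0 ?divr_ge0 ?cabs_ge0.
Qed.

(* Bohr's argument: homogeneous parts are controlled by 2 (1 - |c_0|). *)
Lemma bohr_from_homogeneous (r : R) (t : nat -> R) c : 0 <= r -> (forall m, 0 <= t m) ->
  (forall m, (\sum_(k < m) t k.+1 <= 1 / 2)) ->
  (forall m c', (0 < m)%N -> (forall b, c' b != 0 -> wt (mi b) = m) ->
     (forall y, (forall i, cabs (y i) <= 1) -> cabs (expsum c' mi y) <= 1) ->
     (\sum_b cabs (c' b)) * r ^+ m <= t m) ->
  (forall y, (forall i, cabs (y i) <= 1) -> cabs (expsum c mi y) <= 1) ->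
  \sum_b cabs (c b) * r ^+ wt (mi b) <= 1.
Proof.
move=> r0 t0 tsum H cB; set c0 := cabs (c [ffun=> ord0]).
have c01 : c0 <= 1.
  have := cB (fun=> 0); rewrite /expsum (bigD1 [ffun=> ord0])//= big1 ?addr0.
    rewrite /mon big1 ?mulr1 => [->//|i _]; first by move=> i; rewrite cabs0 ler01.
    by rewrite /mi ffunE expr0.
  move=> b b0; rewrite -wt_eq0 -lt0n in b0; have [j bj] := wt_gt0 b0.
  by rewrite /mon (bigD1 j)//= expr0n eqn0Ngt bj mul0r mulr0.
pose W := (n * N.+2).+1.
have -> : \sum_b cabs (c b) * r ^+ wt (mi b) =
    \sum_(m < W) (\sum_b cabs (hpart c m b)) * r ^+ m.
  under [RHS]eq_bigr do rewrite mulr_suml.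
  rewrite exchange_big /=; apply: eq_bigr => b _.
  rewrite (bigD1 (Ordinal (wt_lt b)))//= big1 ?addr0 => [|m mb].
    by rewrite /hpart eqxx.
  rewrite /hpart; case: eqP => [E|_]; last by rewrite cabs0 mul0r.
  by case/eqP: mb; apply: val_inj.
rewrite big_ord_recl expr0 mulr1.
have -> : \sum_b cabs (hpart c 0 b) = c0.
  rewrite (bigD1 [ffun=> ord0])//= big1 ?addr0 => [|b b0].
    by rewrite /hpart wt_eq0 eqxx.
  by rewrite /hpart wt_eq0 (negbTE b0) cabs0.
have part m : (0 < m)%N -> (\sum_b cabs (hpart c m b)) * r ^+ m <= 2 * (1 - c0) * t m.
  move=> m0; apply/ler_addgt0Pr => e e0.
  pose d := e / (t m + 1).
  have tm1 : 0 < t m + 1 by have := t0 m; lra.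
  have d0 : 0 < d by rewrite divr_gt0.
  (* Padded by d because 1 - |c_0| may vanish, while the homogeneous part is to be divided by its
     bound. *)
  pose B := 2 * (1 - c0) + d; have B0 : 0 < B by rewrite ltr_wpDl// mulr_ge0// subr_ge0.
  have Bn : B%:C != 0 by rewrite -cabs_eq0 cabsR gtr0_norm// gt_eqF.
  have h := H m (fun b => hpart c m b / B%:C) m0 _ _.
  have {h} : (\sum_b cabs (hpart c m b / B%:C)) * r ^+ m <= t m.
    apply: h => [b|y y1].
      by rewrite mulf_eq0 negb_or => /andP[/hpart_hom].
    have -> : expsum (fun b => hpart c m b / B%:C) mi y = expsum (hpart c m) mi y / B%:C.
      by rewrite /expsum mulr_suml; apply: eq_bigr => b _; rewrite mulrAC.
    rewrite cabsM cabsV cabsR gtr0_norm// ler_pdivrMr// mul1r.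
    by rewrite (le_trans (wiener m0 cB y1))// lerDl ltW.
  have -> : \sum_b cabs (hpart c m b / B%:C) = (\sum_b cabs (hpart c m b)) / B.
    by rewrite mulr_suml; apply: eq_bigr => b _; rewrite cabsM cabsV cabsR gtr0_norm.
  rewrite mulrAC ler_pdivrMr// => /le_trans; apply.
  rewrite /B mulrDr mulrC lerD2l /d mulrA ler_pdivrMr//.
  by have := t0 m; nra.
have : \sum_(i < n * N.+2) (\sum_b cabs (hpart c (lift ord0 i) b)) * r ^+ lift ord0 i <=
    2 * (1 - c0) * (\sum_(k < n * N.+2) t k.+1).
  by rewrite mulr_sumr; apply: ler_sum => i _; apply: part.
(* The total is at most c0 + 2 (1 - c0) / 2 = 1; hence the requirement that [t] sum to at most
   1/2. *)
have := tsum (n * N.+2)%N; nra.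
Qed.

End Wiener.

(** * Asymptotics of the lower bound *)

Section Asymptotics.
Variable R : realType.

(** From exp x >= (x / (p+1))^(p+1), which gives an explicit threshold. *)
Lemma growth (p : nat) (a d : R) : 0 < a -> 0 < d ->
  exists2 l0, 0 < l0 & forall l, l0 <= l -> l ^+ p * expR (- (a * l)) <= d.
Proof.
move=> a0 d0; pose A : R := (p.+1%:R / a) ^+ p.+1.
have pa : 0 < p.+1%:R / a by rewrite divr_gt0.
have A0 : 0 < A by rewrite exprn_gt0.
exists (A / d); first by rewrite divr_gt0.
move=> l l0; have lp : 0 < l by rewrite (lt_le_trans _ l0)// divr_gt0.
rewrite expRN ler_pdivrMr ?expR_gt0//.
have h : (a * l / p.+1%:R) ^+ p.+1 <= expR (a * l).
  have -> : expR (a * l) = expR (a * l / p.+1%:R) ^+ p.+1.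
    by rewrite -expRM_natl mulrCA mulfV ?mulr1// pnatr_eq0.
  apply: lerXn2r; rewrite ?nnegrE ?expR_ge0//; first by rewrite divr_ge0// mulr_ge0// ltW.
  by rewrite (le_trans _ (expR_ge1Dx _))// lerDr.
apply: le_trans (ler_wpM2l (ltW d0) h).
have -> : (a * l / p.+1%:R) ^+ p.+1 = l ^+ p.+1 / A.
  rewrite /A -expr_div_n; congr (_ ^+ _); field.
  by rewrite gt_eqF//= pnatr_eq0.
rewrite exprS; have -> : d * (l * l ^+ p / A) = l ^+ p * (d * l / A) by ring.
by rewrite ler_peMr ?exprn_ge0 ?(ltW lp)// ler_pdivlMr// mul1r mulrC -ler_pdivrMr.
Qed.

Lemma ln_large (l : R) : exists n0, forall n, (n0 <= n)%N -> l <= ln n%:R.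
Proof.
have [n0 Hn0] := nat_large (expR l); exists n0 => n nn.
have h := Hn0 n nn; rewrite -[leLHS]expRK ler_ln ?posrE ?expR_gt0 ?ltW//.
by rewrite (lt_trans _ h)// expR_gt0.
Qed.

Lemma inv_1B_le1 (x : R) : 0 <= x <= 1 / 2 -> (1 - x)^-1 <= expR (2 * x).
Proof.
move=> /andP[x0 x1]; rewrite -[leLHS]mul1r ler_pdivrMr; last lra.
have := expR_ge1Dx (2 * x); have : 0 <= x * (1 - 2 * x) by rewrite mulr_ge0//; lra.
have : 0 <= 1 - x by lra.
nra.
Qed.

(** At x = l / n the n-th power has to be exp (l + O(1)); the cruder [inv_1B_le1] would give exp (2
    l), which large degrees cannot afford. *)
Lemma inv_1B_le2 (x : R) : 0 <= x <= 1 / 2 -> (1 - x)^-1 <= expR (x + 2 * x ^+ 2).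
Proof.
move=> /andP[x0 x1]; rewrite -[leLHS]mul1r ler_pdivrMr; last lra.
have := expR_ge1Dx (x + 2 * x ^+ 2).
have : 0 <= x ^+ 2 * (1 - 2 * x) by rewrite mulr_ge0 ?sqr_ge0//; lra.
have : 0 <= 1 - x by lra.
nra.
Qed.

Section FixedDimension.
Variables (n N : nat).
Local Notation C := R[i].
Local Notation T := {ffun 'I_n -> 'I_N.+2}.
Variable l : R.
Hypothesis n0 : (0 < n)%N.
Hypothesis nE : n%:R = expR l.
Hypothesis l1 : 1 <= l.
Hypothesis l2n : l ^+ 2 <= n%:R / 2.

Let np : 0 < n%:R :> R. Proof. by rewrite ltr0n. Qed.

Lemma rho_sqr : Num.sqrt (l / n%:R) ^+ 2 = l / n%:R.
Proof. by rewrite sqr_sqrtr// divr_ge0// (le_trans ler01). Qed.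

Lemma ln_half : l / n%:R <= 1 / 2.
Proof.
have hl1 := l1; have hl2n := l2n; have hnp := np.
rewrite ler_pdivrMr//; have : l <= l ^+ 2 by rewrite expr2 ler_peMl// (le_trans ler01).
lra.
Qed.

Lemma sqrt_nmon d (x A B : R) : 0 < x < 1 -> 0 <= A -> 0 <= B ->
  (1 - x)^-1 ^+ n <= A ^+ 2 -> (l / n%:R / x) ^+ d <= B ^+ 2 ->
  Num.sqrt (nmon n N d)%:R * Num.sqrt (l / n%:R) ^+ d <= A * B.
Proof.
move=> x01 A0 B0 hA hB; have /andP[x0 x1] := x01.
have ln0 : 0 <= l / n%:R by rewrite divr_ge0// (le_trans ler01).
rewrite -(@ler_pXn2r _ 2)// ?nnegrE ?mulr_ge0 ?exprn_ge0 ?sqrtr_ge0//.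
rewrite exprMn sqr_sqrtr// -exprM mulnC exprM rho_sqr.
apply: (@le_trans _ _ (x ^- d * (1 - x)^-1 ^+ n * (l / n%:R) ^+ d)).
  by rewrite ler_wpM2r ?exprn_ge0//; apply: nmon_bound.
have -> : x ^- d * (1 - x)^-1 ^+ n * (l / n%:R) ^+ d = (1 - x)^-1 ^+ n * (l / n%:R / x) ^+ d.
  by rewrite [(_ / x) ^+ d]exprMn !exprVn; ring.
have y0 : 0 <= (1 - x)^-1 by rewrite invr_ge0 subr_ge0 ltW.
have z0 : 0 <= l / n%:R / x by rewrite divr_ge0// ltW.
by rewrite [leRHS]exprMn; apply: ler_pM => //; apply: exprn_ge0.
Qed.

Lemma two_le_e : 2 <= expR 1 :> R.
Proof. by have := expR_ge1Dx (1 : R); lra. Qed.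

(** [sidon] with k = 1 leaves a spare factor rho, about n^(-1/2), since only monomials of degree m -
    1 are counted against r^m. For m <= l / 16 all losses C^m are powers of n that this factor can
    pay for. *)
Lemma small_degree (c : T -> C) m (r : R) : (0 < m)%N -> m%:R <= l / 16 ->
  0 <= r <= Num.sqrt (l / n%:R) ->
  (forall b, c b != 0 -> wt (mi b) = m) ->
  (forall y, (forall i, cabs (y i) <= 1) -> cabs (expsum c mi y) <= 1) ->
  (\sum_b cabs (c b)) * r ^+ m <= (1 + 4 * expR 1) * (l * expR (- (1 / 16 * l))) * (1 / 2) ^+ m.
Proof.
have hl1 := l1; have hl2n := l2n; have hnp := np.
move=> m0 ml /andP[r0 rr] hom cB.
set rho := Num.sqrt _ in rr.
have rho0 : 0 <= rho by apply: sqrtr_ge0.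
have l0 : 0 < l by lra.
have D0 : 0 <= 2 ^+ (m - 1) :> R by rewrite exprn_ge0.
have DE : (2 ^+ (m - 1)) ^+ 2 = 4 ^+ (m - 1) :> R.
  by rewrite -exprM mulnC exprM; congr (_ ^+ _); ring.
have := sidon (k := 1) isT m0 n0 hom cB D0 DE; rewrite expr0 mul1r expr1 => hs.
have sc : sidon_const R 1 m = 2 * (expR 1 * m%:R) by rewrite /sidon_const expr0 !expr1 mul1r.
(* A sixteenth of l / n: the square root of (1 - x)^(-n) becomes at most exp (l / 16), at the price
   of 4^(m-1). *)
pose x := l / (16 * n%:R).
have ln := ln_half.
have xE : x = l / n%:R / 16 by rewrite /x; field; rewrite gt_eqF.
have ln0 : 0 < l / n%:R by rewrite divr_gt0.
have x0 : 0 < x by rewrite xE; lra.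
have x1 : x < 1 by rewrite xE; lra.
have hn := @sqrt_nmon (m - 1)%N x (expR (l / 16)) (4 ^+ (m - 1)) _ (expR_ge0 _) _ _ _.
have {hn} : Num.sqrt (nmon n N (m - 1)%N)%:R * rho ^+ (m - 1) <= expR (l / 16) * 4 ^+ (m - 1).
  apply: hn; rewrite ?x0 ?exprn_ge0//.
    apply: (@le_trans _ _ (expR (2 * x) ^+ n)).
      apply: lerXn2r; rewrite ?nnegrE ?expR_ge0 ?invr_ge0 ?subr_ge0 ?(ltW x1)//.
      by apply: inv_1B_le1; rewrite (ltW x0) xE; lra.
    rewrite -!expRM_natl ler_expR; apply/eqW; rewrite /x; field.
    by rewrite gt_eqF.
  rewrite -[_ ^+ 2]exprM mulnC exprM; have -> : l / n%:R / x = 16.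
    by rewrite /x; field; rewrite !gt_eqF.
  by apply/eqW; congr (_ ^+ _); ring.
set S := Num.sqrt _ in hs * => hn.
have S0 : 0 <= S by apply: sqrtr_ge0.
have rm : r ^+ m <= rho * rho ^+ (m - 1).
  by rewrite -exprS subn1 prednK//; apply: lerXn2r.
have c0 : 0 <= \sum_b cabs (c b) by apply: sumr_ge0 => b _; apply: cabs_ge0.
set Q := 1 + 2 ^+ (m - 1) * _ in hs.
have mE : (m - 1).+1 = m by rewrite subn1 prednK.
have Q0 : 0 <= Q by rewrite addr_ge0// mulr_ge0// sc addr_ge0 ?mulr_ge0 ?expR_ge0.
have QB : Q <= (1 + 4 * expR 1) * 4 ^+ m.
  have m2 : m%:R <= 2 ^+ m :> R by rewrite -natrX ler_nat ltnW// ltn_expl.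
  have h42 : 2 ^+ m * 2 ^+ m = 4 ^+ m :> R by rewrite -exprMn; congr (_ ^+ _); ring.
  have h1 : 1 <= 4 ^+ m :> R by rewrite exprn_ege1//; lra.
  have h2 : 2 ^+ (m - 1) <= 2 ^+ m :> R by rewrite ler_eXn2l ?leq_subr//; lra.
  rewrite /Q sc [leRHS]mulrDl mul1r; apply: lerD => //.
  have -> : 2 * (expR 1 * m%:R) + 2 * (expR 1 * m%:R) = 4 * expR 1 * m%:R :> R by ring.
  rewrite mulrCA -[leRHS]mulr1 -[leRHS]mulrA ler_wpM2l ?mulr_ge0 ?expR_ge0// mulr1 -h42.
  by rewrite ler_pM.
apply: (@le_trans _ _ (S * Q * (rho * rho ^+ (m - 1)))).
  by rewrite ler_pM ?exprn_ge0.
have -> : S * Q * (rho * rho ^+ (m - 1)) = (S * rho ^+ (m - 1)) * (Q * rho) by ring.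
apply: (@le_trans _ _ (expR (l / 16) * 4 ^+ (m - 1) * ((1 + 4 * expR 1) * 4 ^+ m * rho))).
  by rewrite ler_pM ?mulr_ge0 ?exprn_ge0// ler_wpM2r.
have e4 (j : nat) : 2 ^+ j <= expR 1 ^+ j :> R.
  by apply: lerXn2r; rewrite ?nnegrE ?expR_ge0 ?two_le_e.
have h5 : 4 ^+ (m - 1) * 4 ^+ m <= expR (l / 4) * (expR (l / 16) * (1 / 2) ^+ m).
  have p2 : 0 < 2 ^+ m :> R by rewrite exprn_gt0.
  have -> : (1 / 2) ^+ m = (2 ^+ m)^-1 :> R by rewrite div1r exprVn.
  rewrite !mulrA ler_pdivlMr//.
  have -> : expR (l / 4) * expR (l / 16) = expR (5 * (l / 16)).
    by rewrite -expRD; congr expR; field.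
  apply: (@le_trans _ _ (2 ^+ (5 * m))).
    have -> : 4 = 2 ^+ 2 :> R by ring.
    rewrite -!exprM -!exprD ler_eXn2l//; last by rewrite (ltr_nat R 1 2).
    by clear; lia.
  rewrite (le_trans (e4 _))// -expRM_natl mulr1 ler_expR natrM ler_wpM2l//.
have rhoE : rho <= l * expR (- (l / 2)).
  have -> : expR (- (l / 2)) = (Num.sqrt n%:R)^-1.
    rewrite expRN; congr (_^-1); apply/esym; rewrite nE -[LHS]ger0_norm ?sqrtr_ge0//.
    apply/eqP; rewrite -(@eqrXn2 _ 2)// ?expR_ge0// real_normK ?num_real// sqr_sqrtr ?expR_ge0//.
    by rewrite -expRM_natl; apply/eqP; congr expR; field.
  rewrite /rho sqrtrM ?(ltW l0)// sqrtrV ?ler0n// ler_wpM2r ?invr_ge0 ?sqrtr_ge0//.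
  rewrite -(@ler_pXn2r _ 2)// ?nnegrE ?sqrtr_ge0 ?(ltW l0)// sqr_sqrtr ?(ltW l0)//.
  by rewrite expr2 ler_peMl// ltW.
have -> : expR (l / 16) * 4 ^+ (m - 1) * ((1 + 4 * expR 1) * 4 ^+ m * rho) =
   (1 + 4 * expR 1) * expR (l / 16) * ((4 ^+ (m - 1) * 4 ^+ m) * rho) by ring.
have -> : (1 + 4 * expR 1) * (l * expR (- (1 / 16 * l))) * (1 / 2) ^+ m =
   (1 + 4 * expR 1) * expR (l / 16) * (expR (l / 4) * (expR (l / 16) * (1 / 2) ^+ m) * (l * expR (- (l / 2)))) *
     (expR (- (1 / 16 * l)) * expR (l / 2) * (expR (- (l / 4)) * (expR (- (l / 16)) * expR (- (l / 16))))) .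
  rewrite !expRN; field.
  by rewrite !gt_eqF// expR_gt0.
have e1 : 1 <= expR (- (1 / 16 * l)) * expR (l / 2) * (expR (- (l / 4)) * (expR (- (l / 16)) * expR (- (l / 16)))).
  by rewrite -!expRD -[leLHS]expR0 ler_expR; lra.
have p14 : 0 <= (1 + 4 * expR 1) * expR (l / 16).
  by rewrite mulr_ge0 ?expR_ge0// addr_ge0// mulr_ge0// expR_ge0.
apply: (@le_trans _ _ ((1 + 4 * expR 1) * expR (l / 16) *
  (expR (l / 4) * (expR (l / 16) * (1 / 2) ^+ m) * (l * expR (- (l / 2)))))).
  rewrite ler_wpM2l// ler_pM// ?mulr_ge0 ?exprn_ge0//.
rewrite ler_peMr// mulr_ge0// !mulr_ge0 ?expR_ge0 ?exprn_ge0 ?(ltW l0)//; lra.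
Qed.

(** With x = l / n one gets sqrt(nmon) rho^(m-k) <= e sqrt n without any factor C^m, and nu^(k-1)
    rho^k = l^(k/2) / sqrt n removes the sqrt n. As l <= 16 m, the power of l is polynomial in m;
    the only geometric terms left are (1 - e)^m and th0^m. *)
Lemma large_degree (c : T -> C) m k (e th0 : R) : (0 < k)%N -> k%:R <= l / 16 -> l / 16 <= m%:R ->
  0 < e < 1 -> 1 <= th0 -> th0 ^+ k.+1 = 4 ->
  (forall b, c b != 0 -> wt (mi b) = m) ->
  (forall y, (forall i, cabs (y i) <= 1) -> cabs (expsum c mi y) <= 1) ->
  (\sum_b cabs (c b)) * ((1 - e) * Num.sqrt (l / n%:R)) ^+ m <=
    expR 1 * 3 * (sidon_const R k 1) ^+ k * 16 ^+ k * (m%:R ^+ (k + k ^ 2) * ((1 - e) * th0) ^+ m).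
Proof.
have hl1 := l1; have hl2n := l2n; have hnp := np.
move=> k0 kl ml /andP[e0 e1] th1 thE hom cB.
have l0 : 0 < l by lra.
have km : (k <= m)%N by rewrite -(ler_nat R) (le_trans kl).
have m0 : (0 < m)%N by apply: leq_trans km.
have m1 : 1 <= m%:R :> R by rewrite ler1n.
set rho := Num.sqrt _.
have rho0 : 0 <= rho by apply: sqrtr_ge0.
have th0p : 0 < th0 by lra.
have D0 : 0 <= th0 ^+ (m - k) by rewrite exprn_ge0// ltW.
have DE : (th0 ^+ (m - k)) ^+ k.+1 = 4 ^+ (m - k) by rewrite -exprM mulnC exprM thE.
have hs := sidon k0 km n0 hom cB D0 DE.
set S := Num.sqrt (nmon _ _ _)%:R in hs; set nu := Num.sqrt n%:R in hs.
have S0 : 0 <= S by apply: sqrtr_ge0.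
have nu0 : 0 < nu by rewrite sqrtr_gt0.
have lnh := ln_half; have ln0 : 0 < l / n%:R by rewrite divr_gt0.
have hn : S * rho ^+ (m - k) <= expR (l / 2 + 1) * 1.
  apply: (@sqrt_nmon _ (l / n%:R)); rewrite ?expR_ge0//; first by rewrite ln0; lra.
    apply: (@le_trans _ _ (expR (l / n%:R + 2 * (l / n%:R) ^+ 2) ^+ n)).
      apply: lerXn2r; rewrite ?nnegrE ?expR_ge0 ?invr_ge0 ?subr_ge0//; first lra.
      by apply: inv_1B_le2; rewrite (ltW ln0).
    rewrite -!expRM_natl ler_expR.
    have -> : n%:R * (l / n%:R + 2 * (l / n%:R) ^+ 2) = l + 2 * (l ^+ 2 / n%:R).
      by field; rewrite gt_eqF.
    have : l ^+ 2 / n%:R <= 1 / 2 by rewrite ler_pdivrMr//; lra.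
    lra.
  by rewrite divff ?gt_eqF// !expr1n.
set s := sidon_const R k m in hs.
pose ck := sidon_const R k 1.
have sE : s = ck * m%:R ^+ k by rewrite /s /ck /sidon_const expr1n; ring.
have ck1 : 1 <= ck.
  rewrite /ck /sidon_const expr1n mulr1 mulr_ege1 ?mulr_ege1 ?exprn_ege1//; try lra.
  by have := two_le_e; lra.
have mk1 : 1 <= m%:R ^+ k :> R by rewrite exprn_ege1.
have s1 : 1 <= s by rewrite sE mulr_ege1.
have ssk : s <= s ^+ k by rewrite -[leLHS]expr1; apply: ler_weXn2l.
set Q := 1 + th0 ^+ (m - k) * (s + s ^+ k) in hs.
have QB : Q <= 3 * (s ^+ k * th0 ^+ m).
  have h1 : 1 <= s ^+ k by rewrite exprn_ege1.
  have h2 : 1 <= th0 ^+ m by rewrite exprn_ege1.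
  have h3 : th0 ^+ (m - k) <= th0 ^+ m by rewrite ler_weXn2l ?leq_subr.
  have h4 : 1 <= s ^+ k * th0 ^+ m by rewrite mulr_ege1.
  have : th0 ^+ (m - k) * (s + s ^+ k) <= th0 ^+ m * (2 * s ^+ k).
    by rewrite ler_pM//; lra.
  rewrite /Q; lra.
have Q0 : 0 <= Q.
  by rewrite addr_ge0// mulr_ge0// addr_ge0 ?exprn_ge0//; lra.
have c0 : 0 <= \sum_b cabs (c b) by apply: sumr_ge0 => b _; apply: cabs_ge0.
have E1 : ((1 - e) * rho) ^+ m = (1 - e) ^+ m * (rho ^+ k * rho ^+ (m - k)).
  by rewrite exprMn -exprD subnKC.
have e1' : 0 <= 1 - e by lra.
have nk : nu ^+ k.-1 * rho ^+ k = Num.sqrt l ^+ k * expR (- (l / 2)).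
  have -> : expR (- (l / 2)) = nu^-1.
    rewrite expRN; congr (_^-1); apply/esym; rewrite /nu nE -[LHS]ger0_norm ?sqrtr_ge0//.
    apply/eqP; rewrite -(@eqrXn2 _ 2)// ?expR_ge0// real_normK ?num_real// sqr_sqrtr ?expR_ge0//.
    by rewrite -expRM_natl; apply/eqP; congr expR; field.
  rewrite /rho sqrtrM ?(ltW l0)// sqrtrV ?ler0n// -/nu exprMn mulrCA; congr (_ * _).
  by rewrite -[in LHS](prednK k0) exprVn exprSr invfM mulrA mulfV ?mul1r// expf_neq0// gt_eqF.
apply: (@le_trans _ _ (S * (nu ^+ k.-1 * Q) * ((1 - e) ^+ m * (rho ^+ k * rho ^+ (m - k))))).
  by rewrite E1 ler_wpM2r// !mulr_ge0 ?exprn_ge0.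
have -> : S * (nu ^+ k.-1 * Q) * ((1 - e) ^+ m * (rho ^+ k * rho ^+ (m - k))) =
   (S * rho ^+ (m - k)) * ((nu ^+ k.-1 * rho ^+ k) * (Q * (1 - e) ^+ m)) by ring.
rewrite nk; rewrite mulr1 in hn.
have sl : Num.sqrt l ^+ k <= 16 ^+ k * m%:R ^+ k.
  rewrite -exprMn; apply: lerXn2r; rewrite ?nnegrE ?sqrtr_ge0 ?mulr_ge0//.
  apply: (@le_trans _ _ l); last by lra.
  rewrite -(@ler_pXn2r _ 2)// ?nnegrE ?sqrtr_ge0 ?(ltW l0)// sqr_sqrtr ?(ltW l0)//.
  by rewrite expr2 ler_peMl// ltW.
apply: (@le_trans _ _ (expR (l / 2 + 1) * ((16 ^+ k * m%:R ^+ k * expR (- (l / 2))) *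
   (3 * (s ^+ k * th0 ^+ m) * (1 - e) ^+ m)))).
  apply: ler_pM => //.
  - by rewrite mulr_ge0 ?exprn_ge0.
  - by apply: mulr_ge0; apply: mulr_ge0; rewrite ?exprn_ge0 ?sqrtr_ge0 ?expR_ge0.
  - apply: ler_pM.
    + by apply: mulr_ge0; rewrite ?exprn_ge0 ?sqrtr_ge0 ?expR_ge0.
    + by apply: mulr_ge0; rewrite ?exprn_ge0.
    + by rewrite ler_wpM2r ?expR_ge0.
    + by rewrite ler_wpM2r ?exprn_ge0.
rewrite sE exprMn -exprM mulnn exprD [(_ * th0) ^+ m]exprMn expRD expRN -/ck.
apply/eqW; field.
by rewrite gt_eqF// expR_gt0.
Qed.

End FixedDimension.

Lemma poly_geometric_bounded (p : nat) (q : R) : 0 < q < 1 ->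
  exists2 K, 0 < K & forall m, (0 < m)%N -> m%:R ^+ p * q ^+ m <= K.
Proof.
move=> /andP[q0 q1]; pose a := - ln q.
have a0 : 0 < a by rewrite oppr_gt0 ln_lt0// q0.
have [l0 l00 H] := growth p a0 ltr01.
exists (Num.max 1 (l0 ^+ p)); first by rewrite lt_max ltr01.
move=> m m0; have qE : q ^+ m = expR (- (a * m%:R)).
  by rewrite /a mulNr opprK mulrC expRM_natl lnK.
have [le|lt] := leP l0 m%:R; first by rewrite qE le_max H.
rewrite le_max; apply/orP; right.
rewrite -[leRHS]mulr1 ler_pM ?exprn_ge0 ?(ltW q0)//.
  by apply: lerXn2r; rewrite ?nnegrE// ltW.
by rewrite exprn_ile1// ltW.
Qed.

(** k is chosen with 4 (1 - e)^(k+1) < 1, so that th = (1 - e) 4^(1/(k+1)) < 1. Then (th / eta1)^m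
    absorbs the polynomial in m, one of the two factors eta^m of eta1^m is small because m > l / 16,
    and the other remains as decay. [eta] precedes [d], so that [d] may depend on it; eta >= 1/2
    serves the small degrees. *)
Lemma homogeneous_decay (e : R) : 0 < e < 1 -> exists2 eta : R, 0 < eta < 1 & forall d : R, 0 < d ->
  exists n0, forall n N m (c : {ffun 'I_n -> 'I_N.+2} -> R[i]), (n0 <= n)%N -> (0 < m)%N ->
  (forall b, c b != 0 -> wt (mi b) = m) ->
  (forall y, (forall i, cabs (y i) <= 1) -> cabs (expsum c (@mi n N) y) <= 1) ->
  (\sum_b cabs (c b)) * ((1 - e) * Num.sqrt (ln n%:R / n%:R)) ^+ m <= d * eta ^+ m.
Proof.
move=> e01; have /andP[e0 e1] := e01.
have e1' : 0 < 1 - e by rewrite subr_gt0.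
have [k k0 Hk] : exists2 k, (0 < k)%N & 4 * (1 - e) ^+ k.+1 < 1.
  have q01 : 0 <= 1 - e < 1 by rewrite ltW//=; lra.
  have h15 : (0 : R) < 1 / 5 by lra.
  have [N0 HN0] := exp_small q01 h15.
  exists (N0.+1) => //.
  have := HN0 N0.+2 (leq_trans (leqnSn _) (leqnSn _)); lra.
have [th0 th00 thE] := root_exists k (ler0n R 4).
have th1 : 1 <= th0.
  by rewrite -(@ler_pXn2r _ k.+1)// ?nnegrE// expr1n thE; lra.
pose th := (1 - e) * th0.
have tp : 0 < th by rewrite mulr_gt0//; lra.
have tl : th < 1.
  by rewrite -(@ltr_pXn2r _ k.+1)// ?nnegrE ?(ltW tp)// expr1n exprMn thE mulrC.
pose eta1 := (1 + th) / 2.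
have et : th < eta1 by rewrite /eta1; lra.
have e1l : eta1 < 1 by rewrite /eta1; lra.
have e1p : 0 < eta1 by apply: lt_trans et.
pose eta := Num.sqrt eta1.
have etap : 0 < eta by rewrite sqrtr_gt0.
have etaE : eta ^+ 2 = eta1 by rewrite sqr_sqrtr// ltW.
have etal : eta < 1 by rewrite -(@ltr_pXn2r _ 2)// ?nnegrE ?(ltW etap)// expr1n etaE.
have eta2 : 1 / 2 <= eta.
  by rewrite -(@ler_pXn2r _ 2)// ?nnegrE ?(ltW etap)// etaE /eta1; lra.
exists eta; first by rewrite etap.
move=> d d0.
have qq : 0 < th / eta1 < 1 by rewrite divr_gt0//= ltr_pdivrMr// mul1r.
have [K K0 HK] := poly_geometric_bounded (k + k ^ 2) qq.
pose C1 := expR 1 * 3 * (sidon_const R k 1) ^+ k * 16 ^+ k.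
have C10 : 0 <= C1.
  by rewrite /C1 /sidon_const !mulr_ge0 ?exprn_ge0 ?mulr_ge0 ?exprn_ge0 ?expR_ge0.
have CK : 0 <= C1 * K by rewrite mulr_ge0// ltW.
have ee : 0 < 1 + 4 * expR 1 :> R by rewrite ltr_pwDl// mulr_ge0// expR_ge0.
have h16 : (0 : R) < 1 / 16 by lra.
have h12 : (0 : R) < 1 / 2 by lra.
have [l1 l10 Hl1] := growth 1 h16 (divr_gt0 d0 ee).
have a20 : 0 < - ln eta / 16 by rewrite divr_gt0// oppr_gt0 ln_lt0// etap.
have CK1 : 0 < C1 * K + 1 by rewrite ltr_wpDl.
have [l2 l20 Hl2] := growth 0 a20 (divr_gt0 d0 CK1).
have [l3 l30 Hl3] := growth 2 (@ltr01 R) h12.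
have [n0 Hn0] := ln_large (Num.max (Num.max l1 l2) (Num.max l3 (Num.max 1 (16 * k%:R)))).
exists (maxn n0 1) => n N m c; rewrite geq_max => /andP[nn n1] m0 hom cB.
have := Hn0 n nn; rewrite !ge_max => /andP[/andP[b1 b2] /andP[b3 /andP[b4 b5]]].
set l := ln n%:R in b1 b2 b3 b4 b5 *.
have np : 0 < n%:R :> R by rewrite ltr0n.
have nE : n%:R = expR l by rewrite lnK.
have l2n : l ^+ 2 <= n%:R / 2.
  by have := Hl3 l b3; rewrite (mul1r l) expRN -nE ler_pdivrMr//; lra.
have [ml|ml] := leP m%:R (l / 16).
  have rr : 0 <= (1 - e) * Num.sqrt (l / n%:R) <= Num.sqrt (l / n%:R).
    by rewrite mulr_ge0 ?sqrtr_ge0 ?(ltW e1')//= ler_piMl ?sqrtr_ge0//; lra.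
  apply: (le_trans (small_degree n1 nE b4 l2n m0 ml rr hom cB)).
  apply: ler_pM.
  - by rewrite mulr_ge0 ?(ltW ee)// mulr_ge0 ?expR_ge0//; lra.
  - by rewrite exprn_ge0.
  - by have := Hl1 l b1; rewrite expr1 ler_pdivlMr// mulrC.
  - by apply: lerXn2r; rewrite ?nnegrE ?(ltW etap).
have kl : k%:R <= l / 16 by lra.
apply: (le_trans (large_degree n1 nE b4 l2n k0 kl (ltW ml) e01 th1 thE hom cB)).
rewrite -/C1 -/th.
have -> : th ^+ m = (th / eta1) ^+ m * eta1 ^+ m by rewrite -exprMn divfK// gt_eqF.
have h1 := HK m m0.
have h2 : eta1 ^+ m <= d / (C1 * K + 1) * eta ^+ m.
  rewrite -etaE -exprM mulnC exprM -[X in X <= _]/((eta ^+ m) ^+ 2) expr2 ler_wpM2r ?exprn_ge0 ?(ltW etap)//.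
  apply: le_trans (Hl2 l b2); rewrite expr0 mul1r.
  have -> : eta ^+ m = expR (m%:R * ln eta) by rewrite expRM_natl lnK.
  rewrite ler_expR; have : ln eta < 0 by rewrite ln_lt0// etap.
  nra.
have p1 : 0 <= m%:R ^+ (k + k ^ 2) * (th / eta1) ^+ m.
  by rewrite mulr_ge0 ?exprn_ge0// divr_ge0 ?(ltW tp) ?(ltW e1p).
have h3 : m%:R ^+ (k + k ^ 2) * ((th / eta1) ^+ m * eta1 ^+ m) <= K * (d / (C1 * K + 1) * eta ^+ m).
  by rewrite mulrA ler_pM// exprn_ge0// ltW.
apply: (le_trans (ler_wpM2l C10 h3)).
have -> : C1 * (K * (d / (C1 * K + 1) * eta ^+ m)) = (C1 * K / (C1 * K + 1)) * (d * eta ^+ m) by ring.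
rewrite ler_piMl ?mulr_ge0 ?exprn_ge0 ?(ltW d0) ?(ltW etap)//.
by rewrite ler_pdivrMr// mul1r lerDl.
Qed.

(** For d = (1 - eta) / 2 the bounds d eta^m sum to at most 1/2, as [bohr_from_homogeneous]
    requires. The threshold n0 does not depend on N. *)
Lemma bohr_polynomial (e : R) : 0 < e < 1 -> exists n0, forall n N (c : {ffun 'I_n -> 'I_N.+2} -> R[i]),
  (n0 <= n)%N ->
  (forall y, (forall i, cabs (y i) <= 1) -> cabs (expsum c (@mi n N) y) <= 1) ->
  \sum_b cabs (c b) * ((1 - e) * Num.sqrt (ln n%:R / n%:R)) ^+ wt (mi b) <= 1.
Proof.
move=> e01; have [eta /andP[eta0 eta1] H] := homogeneous_decay e01.
have e1 : 0 < 1 - eta by rewrite subr_gt0.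
have d0 : 0 < (1 - eta) / 2 by rewrite divr_gt0.
have [n0 Hn0] := H _ d0; exists n0 => n N c nn cB.
apply: (@bohr_from_homogeneous R n N _ (fun m => (1 - eta) / 2 * eta ^+ m)) => //.
- by rewrite mulr_ge0 ?sqrtr_ge0//; have /andP[_ h] := e01; rewrite subr_ge0 ltW.
- by move=> m; rewrite mulr_ge0 ?(ltW d0)// exprn_ge0// ltW.
- move=> m; rewrite -mulr_sumr.
  have : (1 - eta) * \sum_(k < m) eta ^+ k.+1 <= 1.
    have -> : \sum_(k < m) eta ^+ k.+1 = eta * \sum_(k < m) eta ^+ k.
      by rewrite mulr_sumr; apply: eq_bigr => k _; rewrite exprS.
    rewrite mulrCA; have := subrX1 eta m; rewrite -opprB -[X in _ = X * _]opprB mulNr => /oppr_inj <-.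
    by rewrite mulr_ile1 ?(ltW eta0) ?(ltW eta1) ?subr_ge0 ?exprn_ile1 ?(ltW eta0) ?(ltW eta1)// gerBl exprn_ge0// ltW.
  rewrite mulrAC; lra.
- by move=> m c' m0 hom cB'; apply: Hn0.
Qed.

End Asymptotics.

(** * Random signs, elementary symmetric functions and binomial coefficients *)

Section RandomSigns.
Variable R : realType.

(** exp x <= 1 / (1 - x) at x = y and x = -y adds up to 2 / (1 - y^2). *)
Lemma expR_sym_small (y : R) : `|y| <= 1 / 2 -> expR y + expR (- y) <= 2 * expR (2 * y ^+ 2).
Proof.
rewrite ler_norml => /andP[y1 y2].
have inv (x : R) : x <= 1 / 2 -> expR x <= (1 - x)^-1.
  move=> x2; rewrite -[expR x]invrK lef_pV2 ?posrE ?invr_gt0 ?expR_gt0//; last lra.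
  by rewrite -expRN; exact: expR_ge1Dx.
have h1 := inv y y2; have h2 : expR (- y) <= (1 - - y)^-1 by apply: inv; lra.
apply: (le_trans (lerD h1 h2)); rewrite opprK.
have -> : (1 - y)^-1 + (1 + y)^-1 = 2 * (1 - y ^+ 2)^-1.
  by field; rewrite !gt_eqF//; nra.
by rewrite ler_wpM2l//; apply: inv_1B_le1; rewrite sqr_ge0/=; nra.
Qed.

(* cosh (2y) = 2 cosh^2 y - 1 <= cosh^4 y, so the bound propagates under doubling. *)
Lemma expR_sym (x : R) : expR x + expR (- x) <= 2 * expR (2 * x ^+ 2).
Proof.
have H k : forall y : R, `|y| <= 2 ^+ k / 2 -> expR y + expR (- y) <= 2 * expR (2 * y ^+ 2).
  elim: k => [|k IH] y yk; first by apply: expR_sym_small; rewrite expr0 in yk.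
  have := IH (y / 2) _; set u := expR (y / 2); set v := expR (- (y / 2)); set w := expR _.
  have -> : expR y = u ^+ 2 by rewrite /u -expRM_natl; congr expR; field.
  have -> : expR (- y) = v ^+ 2 by rewrite /v -expRM_natl; congr expR; field.
  have -> : expR (2 * y ^+ 2) = w ^+ 4 by rewrite /w -expRM_natl; congr expR; field.
  have uv : u * v = 1 by rewrite /u /v -expRD subrr expR0.
  move=> h; have {}h : (u + v) / 2 <= w.
    rewrite ler_pdivrMr// mulrC; apply: h.
    by rewrite normrM [`|2^-1|]ger0_norm ?invr_ge0// ler_pdivrMr//; move: yk; rewrite exprS; lra.
  set c := (u + v) / 2 in h; have c0 : 0 <= c by rewrite divr_ge0// addr_ge0// expR_ge0.
  have : c ^+ 4 <= w ^+ 4 by apply: lerXn2r; rewrite ?nnegrE ?expR_ge0.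
  have -> : u ^+ 2 + v ^+ 2 = 2 * (2 * c ^+ 2 - 1).
    have -> : 2 * (2 * c ^+ 2 - 1) = u ^+ 2 + v ^+ 2 + 2 * (u * v) - 2 by rewrite /c; field.
    by rewrite uv; ring.
  have := sqr_ge0 (c ^+ 2 - 1); have -> : (c ^+ 2 - 1) ^+ 2 = c ^+ 4 - 2 * c ^+ 2 + 1 by ring.
  lra.
have [k Hk] := nat_large (2 * `|x|).
apply: (H k); have := Hk k (leqnn _); have : k%:R <= 2 ^+ k :> R.
  by rewrite -natrX ler_nat ltnW// ltn_expl.
lra.
Qed.

(** Chernoff's method with a union bound: the mean over all signs of the sum over j of exp X_j + exp
    (- X_j) is at most exp (L + 2 t^2 V), so some choice of signs stays below it, and then so does
    each term. The parameter t is to be optimised by the caller. *)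
Lemma random_signs (I J : finType) (a : J -> I -> R) (t L V : R) : 0 <= V ->
  (forall j, \sum_i a j i ^+ 2 <= V) -> (2 * #|J|)%:R <= expR L ->
  exists s : {ffun I -> bool}, forall j, `|t * \sum_i (-1) ^+ s i * a j i| <= L + 2 * t ^+ 2 * V.
Proof.
move=> V0 aV JL.
pose X (s : {ffun I -> bool}) j := t * \sum_i (-1) ^+ s i * a j i.
pose W s := \sum_j (expR (X s j) + expR (- X s j)).
pose B := expR (L + 2 * t ^+ 2 * V).
have split j : \sum_(s : {ffun I -> bool}) expR (\sum_i (-1) ^+ s i * (t * a j i)) =
    \prod_i (expR (t * a j i) + expR (- (t * a j i))).
  transitivity (\sum_(s : {ffun I -> bool}) \prod_i expR ((-1) ^+ s i * (t * a j i))).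
    by apply: eq_bigr => s _; rewrite expR_sum.
  rewrite -(bigA_distr_bigA (fun i b => expR ((-1) ^+ (b : bool) * (t * a j i)))).
  apply: eq_bigr => i _; rewrite big_bool /= expr1 mulN1r expr0 mul1r; exact: addrC.
have avgX j : \sum_s expR (X s j) <= (2 ^ #|I|)%:R * expR (2 * t ^+ 2 * V).
  have -> : \sum_s expR (X s j) = \prod_i (expR (t * a j i) + expR (- (t * a j i))).
    rewrite -split; apply: eq_bigr => s _; congr expR.
    by rewrite /X mulr_sumr; apply: eq_bigr => i _; rewrite mulrCA.
  apply: (@le_trans _ _ (\prod_(i : I) (2 * expR (2 * (t * a j i) ^+ 2)))).
    by apply: ler_prod => i _; rewrite addr_ge0 ?expR_ge0//= expR_sym.
  rewrite big_split /= prodr_const natrX; apply: ler_wpM2l; first by rewrite exprn_ge0.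
  rewrite -expR_sum ler_expR -mulr_sumr.
  under eq_bigr do rewrite exprMn.
  by rewrite -mulr_sumr mulrA ler_wpM2l// mulr_ge0 ?sqr_ge0.
have avgN j : \sum_s expR (- X s j) = \sum_s expR (X s j).
  rewrite (reindex_inj (h := fun s : {ffun I -> bool} => [ffun i => ~~ s i])) /=; last first.
    by move=> s s' /ffunP h; apply/ffunP => i; have := h i; rewrite !ffunE; exact: negb_inj.
  apply: eq_bigr => s _; congr expR; rewrite /X -mulrN -sumrN; congr (_ * _).
  apply: eq_bigr => i _; rewrite ffunE -mulNr; congr (_ * _); case: (s i) => /=; ring.
have avgS j : \sum_s (expR (X s j) + expR (- X s j)) <= 2 * (2 ^ #|I|)%:R * expR (2 * t ^+ 2 * V).
  by rewrite big_split [X in _ + X <= _]avgN -mulrA [leRHS]mulr_natl mulr2n; apply: lerD.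
have sumW : \sum_s W s <= \sum_(s : {ffun I -> bool}) B.
  rewrite /W exchange_big /= sumr_const card_ffun card_bool.
  apply: (@le_trans _ _ (\sum_(j : J) (2 * (2 ^ #|I|)%:R * expR (2 * t ^+ 2 * V)))).
    by apply: ler_sum => j _; apply: avgS.
  rewrite sumr_const -[leLHS]mulr_natl -[leRHS]mulr_natl /B expRD.
  have -> : #|J|%:R * (2 * (2 ^ #|I|)%:R * expR (2 * t ^+ 2 * V)) =
    (2 ^ #|I|)%:R * ((2 * #|J|)%:R * expR (2 * t ^+ 2 * V)) :> R by rewrite natrM; ring.
  by rewrite ler_wpM2l ?ler0n// ler_wpM2r ?expR_ge0.
have [s Ws] : exists s, W s <= B.
  apply/existsP; apply: contraTT sumW; rewrite negb_exists => /forallP h; rewrite -ltNge.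
  apply: ltr_sum => [|s _]; last by rewrite ltNge.
  by apply/hasP; exists [ffun=> true] => //; rewrite mem_index_enum.
exists s => j.
have pos j' : 0 <= expR (X s j') + expR (- X s j') by rewrite addr_ge0 ?expR_ge0.
have : expR (X s j) + expR (- X s j) <= B.
  by apply: le_trans Ws; rewrite /W (bigD1 j)//= lerDl sumr_ge0.
have := expR_gt0 (X s j); have := expR_gt0 (- X s j) => p1 p2 h.
rewrite -/(X s j) ler_norml -(ler_expR (X s j)) lerNl -(ler_expR (- X s j)).
by apply/andP; split; apply: le_trans h; rewrite ?lerDl ?lerDr ltW.
Qed.

(* e_m(t) x^m <= prod (1 + x t_i) <= exp (x sum t), with x = m/n. *)
Lemma elementary_symmetric_le n m (t : 'I_n -> R) : (0 < n)%N -> (0 < m)%N ->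
  (forall i, 0 <= t i) -> \sum_i t i <= n%:R ->
  \sum_(A : {set 'I_n} | #|A| == m) \prod_(i in A) t i <= (expR 1 * n%:R / m%:R) ^+ m.
Proof.
move=> n0 m0 t0 tn; pose x : R := m%:R / n%:R.
have np : 0 < n%:R :> R by rewrite ltr0n.
have mp : 0 < m%:R :> R by rewrite ltr0n.
have x0 : 0 < x by rewrite divr_gt0.
have -> : (expR 1 * n%:R / m%:R) ^+ m = expR m%:R / x ^+ m.
  have -> : expR m%:R = expR 1 ^+ m :> R by rewrite -expRM_natl mulr1.
  rewrite -expr_div_n; congr (_ ^+ _).
  by rewrite /x; field; rewrite !gt_eqF.
rewrite ler_pdivlMr ?exprn_gt0//.
have h1 : \prod_i (1 + x * t i) <= expR m%:R.
  apply: (@le_trans _ _ (\prod_i expR (x * t i))).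
    by apply: ler_prod => i _; rewrite expR_ge1Dx addr_ge0// mulr_ge0// ltW.
  rewrite -expR_sum ler_expR -mulr_sumr.
  by rewrite (le_trans (ler_wpM2l (ltW x0) tn))// /x divfK// gt_eqF.
apply: le_trans h1.
have -> : \prod_i (1 + x * t i) = \prod_i (x * t i + 1) by apply: eq_bigr => i _; rewrite addrC.
rewrite (bigA_distr 1 _ (fun i => x * t i) (fun=> 1)) mulr_suml.
have E (A : {set 'I_n}) : \prod_i (if i \in A then x * t i else 1) = x ^+ #|A| * \prod_(i in A) t i.
  by rewrite -big_mkcond big_split /= prodr_const.
rewrite [leRHS](bigID (fun A : {set 'I_n} => #|A| == m))/= -[leLHS]addr0.
apply: lerD.
  apply: ler_sum => A /eqP Am; by rewrite E Am mulrC.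
by apply: sumr_ge0 => A _; rewrite E mulr_ge0 ?exprn_ge0 ?prodr_ge0// ltW.
Qed.

(** The falling factorial is at least (n - m)^m, and m! is bounded by a weak Stirling formula. *)
Lemma bin_ge n m : (0 < m)%N -> (m <= n)%N ->
  (expR 1 * (n - m)%:R / m%:R) ^+ m / (expR 1 * m%:R) <= 'C(n, m)%:R :> R.
Proof.
move=> m0 mn.
(* In the form j! e^j <= e j^(j+1); the induction step is (1 - 1/(k+2))^(k+2) <= 1/e. *)
have fact (k : nat) : k.+1`!%:R * expR 1 ^+ k.+1 <= expR 1 * k.+1%:R * k.+1%:R ^+ k.+1 :> R.
  elim: k => [|k IH]; first by rewrite !expr1 !mulr1 mul1r.
  have k2 : 0 < k.+2%:R :> R by rewrite ltr0n.
  have h : expR 1 * k.+1%:R ^+ k.+2 <= k.+2%:R ^+ k.+2 :> R.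
    have h : k.+1%:R / k.+2%:R <= expR (- k.+2%:R^-1) :> R.
      apply: le_trans (expR_ge1Dx _); apply/eqW.
      by rewrite -[in RHS](@mulfV R k.+2%:R) ?gt_eqF// -[in RHS]natr1; field; rewrite gt_eqF.
    have : (k.+1%:R / k.+2%:R) ^+ k.+2 <= expR (- k.+2%:R^-1) ^+ k.+2 :> R.
      by apply: lerXn2r; rewrite ?nnegrE ?expR_ge0 ?divr_ge0.
    rewrite -expRM_natl mulrN mulfV ?gt_eqF// expr_div_n ler_pdivrMr ?exprn_gt0//.
    by rewrite expRN mulrC ler_pdivlMr ?expR_gt0// mulrC.
  rewrite factS natrM exprS.
  have -> : k.+2%:R * k.+1`!%:R * (expR 1 * expR 1 ^+ k.+1) =
    k.+2%:R * expR 1 * (k.+1`!%:R * expR 1 ^+ k.+1) :> R by ring.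
  apply: (@le_trans _ _ (k.+2%:R * expR 1 * (expR 1 * k.+1%:R * k.+1%:R ^+ k.+1))).
    by rewrite ler_wpM2l// mulr_ge0// expR_ge0.
  have -> : k.+2%:R * expR 1 * (expR 1 * k.+1%:R * k.+1%:R ^+ k.+1) =
    expR 1 * k.+2%:R * (expR 1 * k.+1%:R ^+ k.+2) :> R by rewrite (exprS k.+1%:R k.+1); ring.
  by rewrite ler_wpM2l// mulr_ge0// expR_ge0.
have mp : 0 < m%:R :> R by rewrite ltr0n.
have := fact m.-1; rewrite prednK// => hf.
have nf : (n - m)%:R ^+ m <= 'C(n, m)%:R * m`!%:R :> R.
  rewrite -natrM bin_ffact -natrX ler_nat ffact_prod -[X in (X <= _)%N]/((n - m) ^ m)%N.
  rewrite -[X in (_ ^ X <= _)%N]card_ord -prod_nat_const; apply: leq_prod => i _.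
  by rewrite leq_sub2l// ltnW.
rewrite ler_pdivrMr ?mulr_gt0 ?expR_gt0// expr_div_n ler_pdivrMr ?exprn_gt0// exprMn.
apply: (@le_trans _ _ (expR 1 ^+ m * ('C(n, m)%:R * m`!%:R))).
  by rewrite ler_wpM2l// exprn_ge0// expR_ge0.
have -> : expR 1 ^+ m * ('C(n, m)%:R * m`!%:R) = 'C(n, m)%:R * (m`!%:R * expR 1 ^+ m) :> R by ring.
by rewrite -[leRHS]mulrA ler_wpM2l.
Qed.

End RandomSigns.

(** * A random polynomial with small supremum on the l2 ball *)

Section RandomPolynomial.
Variable R : realType.
Local Notation C := R[i].

Definition gridr (h : R) L (p : bool * 'I_L.+1) : R := (-1) ^+ p.1 * (p.2%:R / h).

Definition gridc (h : R) L (p : (bool * 'I_L.+1) * (bool * 'I_L.+1)) : C :=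
  Complex (gridr h p.1) (gridr h p.2).

(** Rounding towards 0 does not increase the modulus; hence the grid point chosen for a point of the
    l2 ball is again in the ball. *)
Lemma gridr_near (h : R) L (x : R) : 0 < h -> `|x| <= L%:R / h -> exists p : bool * 'I_L.+1,
  `|gridr h p| <= `|x| /\ `|x - gridr h p| <= h^-1.
Proof.
move=> h0; rewrite ler_pdivlMr// => xL.
have y0 : 0 <= `|x| * h by rewrite mulr_ge0// ltW.
have /andP[k1 k2] := truncn_itv y0; set k := Num.trunc _ in k1 k2.
have kL : (k < L.+1)%N by rewrite ltnS -(ler_nat R) (le_trans k1).
exists (x < 0, Ordinal kL); rewrite /gridr /=.
have e1 : k%:R / h <= `|x| by rewrite ler_pdivrMr.
have e2 : `|x| - k%:R / h <= h^-1.
  by rewrite lerBlDr -[X in X + _]mul1r -mulrDl ler_pdivlMr// nat1r ltW.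
have kh : 0 <= k%:R / h by rewrite divr_ge0// ltW.
split; first by rewrite normrM normrX normrN1 expr1n mul1r ger0_norm.
have [xn|xp] := ltP x 0; rewrite ?expr1 ?expr0.
  by move: e1 e2; rewrite ltr0_norm// => e1 e2; rewrite ler_norml; apply/andP; split; lra.
by move: e1 e2; rewrite ger0_norm// => e1 e2; rewrite ler_norml; apply/andP; split; lra.
Qed.

Lemma gridc_near (h : R) L (w : C) : 0 < h -> cabs w <= L%:R / h ->
  exists p : (bool * 'I_L.+1) * (bool * 'I_L.+1),
  cabs (gridc h p) <= cabs w /\ cabs (w - gridc h p) <= 2 / h.
Proof.
move=> h0 wL.
have [p1 [a1 b1]] := gridr_near h0 (le_trans (Re_le_cabs w) wL).
have [p2 [a2 b2]] := gridr_near h0 (le_trans (Im_le_cabs w) wL).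
exists (p1, p2); split.
  rewrite -(@ler_pXn2r _ 2)// ?nnegrE ?cabs_ge0// !sqr_cabs /=.
  by apply: lerD; rewrite -[leLHS]real_normK ?num_real// -[leRHS]real_normK ?num_real//; apply: lerXn2r;
    rewrite ?nnegrE.
apply: le_trans (cabs_le_ReIm _) _; rewrite mulrC mulr_natr mulr2n.
by case: w {wL a1 a2} b1 b2 => a b /= b1 b2; apply: lerD.
Qed.

Lemma prod_near (I : Type) (r : seq I) (z w : I -> C) (B d : R) : 1 <= B -> 0 <= d ->
  (forall i, cabs (z i) <= B) -> (forall i, cabs (w i) <= B) ->
  (forall i, cabs (z i - w i) <= d) ->
  cabs (\prod_(i <- r) z i - \prod_(i <- r) w i) <= (size r)%:R * B ^+ size r * d.
Proof.
move=> B1 d0 zB wB zw; have B0 : 0 <= B by apply: le_trans B1.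
have wr s : cabs (\prod_(i <- s) w i) <= B ^+ size s.
  elim: s => [|i s IH]; first by rewrite big_nil cabs1 expr0.
  by rewrite big_cons cabsM exprS ler_pM ?cabs_ge0.
elim: r => [|i r IH]; first by rewrite !big_nil subrr cabs0 /= !mul0r.
rewrite !big_cons /=.
have -> : z i * \prod_(j <- r) z j - w i * \prod_(j <- r) w j =
  z i * (\prod_(j <- r) z j - \prod_(j <- r) w j) + (z i - w i) * \prod_(j <- r) w j by ring.
apply: (le_trans (cabsD _ _)); rewrite !cabsM.
apply: (@le_trans _ _ (B * ((size r)%:R * B ^+ size r * d) + d * B ^+ size r)).
  by apply: lerD; apply: ler_pM; rewrite ?cabs_ge0.
have b1 : B ^+ size r <= B ^+ (size r).+1 by rewrite exprS ler_peMl// exprn_ge0.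
have := ler_wpM2l d0 b1; rewrite -[(size r).+1%:R]natr1 exprS; nra.
Qed.

Definition spoly n m (s : {ffun {set 'I_n} -> bool}) (z : 'I_n -> C) : C :=
  \sum_(A : {set 'I_n} | #|A| == m) (-1) ^+ s A * \prod_(i in A) z i.

Lemma bin_le_exp n m : ('C(n, m) <= n ^ m)%N.
Proof.
apply: (@leq_trans ('C(n, m) * m`!)); first by rewrite leq_pmulr// fact_gt0.
rewrite bin_ffact ffact_prod -[X in (_ <= _ ^ X)%N]card_ord -prod_nat_const.
by apply: leq_prod => i _; rewrite leq_subr.
Qed.

Lemma spoly_near n m (s : {ffun {set 'I_n} -> bool}) (z w : 'I_n -> C) (d : R) :
  (0 < n)%N -> 0 <= d ->
  (forall i, cabs (z i) <= n%:R) -> (forall i, cabs (w i) <= n%:R) ->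
  (forall i, cabs (z i - w i) <= d) ->
  cabs (spoly m s z - spoly m s w) <= n%:R ^+ m * (m%:R * n%:R ^+ m * d).
Proof.
move=> n0 d0 zn wn zw; rewrite /spoly -sumrB.
apply: (le_trans (cabs_sum _ _ _)).
apply: (@le_trans _ _ (\sum_(A : {set 'I_n} | #|A| == m) (m%:R * n%:R ^+ m * d))).
  apply: ler_sum => A /eqP Am; rewrite -mulrBr cabsM cabsX cabsN cabs1 expr1n mul1r.
  rewrite -!big_enum; have -> : m = size (enum A) by rewrite -cardE.
  by apply: prod_near => //; rewrite ler1n.
rewrite sumr_const -[leLHS]mulr_natl; apply: ler_wpM2r; first by rewrite mulr_ge0// mulr_ge0// exprn_ge0.
have -> : #|[pred A : {set 'I_n} | #|A| == m]| = 'C(n, m).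
  by rewrite -[in RHS](card_ord n) -card_draws; apply: eq_card => A; rewrite !inE.
by rewrite -natrX ler_nat bin_le_exp.
Qed.

(** Union bound over a grid. The variance at a point of the ball is at most an elementary symmetric
    function of the |z_i|^2, hence at most V; L dominates the logarithm of the size of the grid;
    passing from grid points to all points costs the summand 1. *)
Lemma random_polynomial n m : (1 < n)%N -> (0 < m <= n)%N ->
  let V : R := (expR 1 * n%:R / m%:R) ^+ m in let L : R := 16 * n%:R * m%:R * ln n%:R in
  exists s : {ffun {set 'I_n} -> bool}, forall z : 'I_n -> C,
  \sum_i cabs (z i) ^+ 2 <= n%:R -> cabs (spoly m s z) <= 1 + 6 * Num.sqrt (L * V).
Proof.
move=> n1 /andP[m0 mn] V L.
have n0 : (0 < n)%N by apply: leq_trans n1.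
have np : 0 < n%:R :> R by rewrite ltr0n.
have nr1 : 1 <= n%:R :> R by rewrite ler1n.
have mp : 0 < m%:R :> R by rewrite ltr0n.
(* With mesh 2 / h the bound of [spoly_near] is m / n <= 1; h is a small multiple of a power of n,
   so the logarithm of the grid size stays of order n m ln n. *)
pose hn := (2 * n ^ (2 * m + 1))%N; pose h : R := hn%:R.
have hn0 : (0 < hn)%N by rewrite muln_gt0 expn_gt0 n0.
have h0 : 0 < h by rewrite ltr0n.
pose K := (n * hn)%N.
pose P := ((bool * 'I_K.+1) * (bool * 'I_K.+1))%type.
pose T := {ffun 'I_n -> P}.
pose pt (g : T) i : C := gridc h (g i).
pose part (c : bool) (z : C) := if c then complex.Re z else complex.Im z.
pose ok (g : T) := \sum_i cabs (pt g i) ^+ 2 <= n%:R.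
(* Grid points off the ball and sets of the wrong size get coefficient 0, so that the variance bound
   holds for every index; the boolean separates real and imaginary parts. *)
pose a (j : T * bool) (A : {set 'I_n}) : R :=
  if (#|A| == m) && ok j.1 then part j.2 (\prod_(i in A) pt j.1 i) else 0.
have V0 : 0 < V by rewrite exprn_gt0// divr_gt0// mulr_gt0// expR_gt0.
have lnn : 0 < ln n%:R :> R by rewrite ln_gt0// ltr1n.
have L0 : 0 < L by rewrite !mulr_gt0.
have part_le c (z : C) : part c z ^+ 2 <= cabs z ^+ 2.
  by rewrite sqr_cabs; case: c => /=; rewrite ?lerDl ?lerDr sqr_ge0.
have aV j : \sum_A a j A ^+ 2 <= V.
  have [okj|nok] := boolP (ok j.1); last first.
    by rewrite big1 ?(ltW V0)// => A _; rewrite /a (negbTE nok) andbF expr0n.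
  apply: (@le_trans _ _ (\sum_(A : {set 'I_n} | #|A| == m) \prod_(i in A) cabs (pt j.1 i) ^+ 2)).
    rewrite [leRHS]big_mkcond; apply: ler_sum => A _; rewrite /a okj andbT.
    case: ifP => _; last by rewrite expr0n.
    by rewrite (le_trans (part_le _ _))// cabs_prod prodrXl.
  by apply: elementary_symmetric_le => // i; rewrite sqr_ge0.
have JL : (2 * #|{: T * bool}|)%:R <= expR L.
  have -> : expR L = n%:R ^+ (16 * n * m).
    rewrite /L -[in RHS](lnK (x := n%:R)) ?posrE// -expRM_natl; congr expR.
    by rewrite !natrM.
  rewrite -natrX ler_nat card_prod card_bool card_ffun !card_prod card_bool !card_ord.
  have n3 : (n ^ 3 >= 6)%N.
    by apply: (@leq_trans (2 ^ 3)%N) => //; rewrite leq_exp2r.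
  have hK : (2 * K.+1 <= n ^ (2 * m + 5))%N.
    have -> : (2 * m + 5 = 3 + (2 * m + 2))%N by lia.
    rewrite expnD; apply: (@leq_trans (6 * n ^ (2 * m + 2))%N); last by rewrite leq_mul2r n3 orbT.
    have -> : K = (2 * n ^ (2 * m + 2))%N by rewrite /K /hn mulnCA -expnS; congr (2 * n ^ _)%N; lia.
    have : (0 < n ^ (2 * m + 2))%N by rewrite expn_gt0 n0.
    by move: (n ^ _)%N => q; clear; lia.
  apply: (@leq_trans (n ^ 2 * (n ^ (2 * m + 5) * n ^ (2 * m + 5)) ^ n)%N).
    have n2 : (4 <= n ^ 2)%N by apply: (@leq_trans (2 ^ 2)%N) => //; rewrite leq_exp2r.
    rewrite mulnCA [X in (X <= _)%N]mulnC; apply: leq_mul => //.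
    by rewrite leq_exp2r//; apply: leq_mul.
  rewrite -expnD -expnM -expnD leq_exp2l//.
  have nm : (n <= n * m)%N by rewrite leq_pmulr.
  by move: nm n0; clear; nia.
(* Balances L / t and 2 t V: together 3 sqrt(L V), once for the real and once for the imaginary
   part, whence the 6. *)
pose t := Num.sqrt (L / V).
have t0 : 0 < t by rewrite sqrtr_gt0 divr_gt0.
have t2 : t ^+ 2 = L / V by rewrite sqr_sqrtr// ltW// divr_gt0.
have [s Hs] := random_signs t (ltW V0) aV JL.
exists s => z zn.
have Lt : L = t * Num.sqrt (L * V).
  rewrite /t -sqrtrM ?(ltW (divr_gt0 _ _))//.
  have -> : L / V * (L * V) = L ^+ 2 by field; rewrite gt_eqF.
  by rewrite sqrtr_sqr ger0_norm// ltW.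
have bnd (g : T) : ok g -> cabs (spoly m s (pt g)) <= 6 * Num.sqrt (L * V).
  move=> okg.
  have E c : \sum_A (-1) ^+ s A * a (g, c) A = part c (spoly m s (pt g)).
    have partE : part c (spoly m s (pt g)) =
        \sum_(A : {set 'I_n} | #|A| == m) part c ((-1) ^+ s A * \prod_(i in A) pt g i).
      by rewrite /spoly /part; case: c; rewrite raddf_sum.
    rewrite partE [RHS]big_mkcond; apply: eq_bigr => A _; rewrite /a /= okg andbT.
    case: ifP => _; last by rewrite mulr0.
    case: (s A); rewrite ?expr1 ?expr0 ?mul1r ?mulN1r//.
    by clear partE; rewrite /part; case: c; rewrite raddfN.
  have H c : `|part c (spoly m s (pt g))| <= 3 * Num.sqrt (L * V).
    have := Hs (g, c); rewrite E normrM [`|t|]gtr0_norm// t2.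
    have -> : 2 * (L / V) * V = 2 * L by field; rewrite gt_eqF.
    rewrite {1 2}Lt; have -> : t * Num.sqrt (L * V) + 2 * (t * Num.sqrt (L * V)) = t * (3 * Num.sqrt (L * V)) by ring.
    by rewrite ler_pM2l.
  apply: (le_trans (cabs_le_ReIm _)).
  have := lerD (H true) (H false); rewrite /part; lra.
have zi i : cabs (z i) <= n%:R.
  rewrite -(@ler_pXn2r _ 2)// ?nnegrE ?cabs_ge0// (@le_trans _ _ n%:R)//.
    apply: le_trans zn; rewrite (bigD1 i)//= lerDl sumr_ge0// => j _; exact: sqr_ge0.
  by rewrite expr2 ler_peMl.
have near i : exists p : P, cabs (gridc h p) <= cabs (z i) /\ cabs (z i - gridc h p) <= 2 / h.
  apply: gridc_near => //; rewrite /K natrM mulfK ?gt_eqF//.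
have [g0 g0P] := choice near; pose g : T := [ffun i => g0 i].
have gP i : cabs (pt g i) <= cabs (z i) /\ cabs (z i - pt g i) <= 2 / h.
  by rewrite /pt ffunE.
have okg : ok g.
  apply: le_trans zn; apply: ler_sum => i _; have [h1 _] := gP i.
  by apply: lerXn2r; rewrite ?nnegrE ?cabs_ge0.
have -> : spoly m s z = (spoly m s z - spoly m s (pt g)) + spoly m s (pt g) by rewrite subrK.
apply: (le_trans (cabsD _ _)); apply: lerD; last exact: bnd.
have d0 : 0 <= 2 / h by rewrite divr_ge0// ltW.
apply: le_trans (@spoly_near n m s z (pt g) (2 / h) n0 d0 zi _ _) _.
- by move=> i; have [h1 _] := gP i; apply: le_trans h1 _.
- by move=> i; have [_ h1] := gP i.
have -> : h = 2 * (n%:R ^+ m * n%:R ^+ m * n%:R).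
  by rewrite /h /hn natrM natrX -exprD -exprSr addn1 mul2n addnn.
have p1 : 0 < n%:R ^+ m :> R by rewrite exprn_gt0.
have -> : n%:R ^+ m * (m%:R * n%:R ^+ m * (2 / (2 * (n%:R ^+ m * n%:R ^+ m * n%:R)))) = m%:R / n%:R :> R.
  by field; rewrite !gt_eqF.
by rewrite ler_pdivrMr// mul1r ler_nat.
Qed.

End RandomPolynomial.

Lemma sqr_ln_le (R : realType) : exists n0, forall n, (n0 <= n)%N -> (ln n%:R) ^+ 2 <= n%:R / 2 :> R.
Proof.
have h12 : (0 : R) < 1 / 2 by lra.
have [l0 l00 H] := growth 2 (@ltr01 R) h12.
have [n0 Hn0] := ln_large l0; exists (maxn n0 1) => n; rewrite geq_max => /andP[nn n1].
have np : 0 < n%:R :> R by rewrite ltr0n.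
have := H _ (Hn0 n nn); rewrite (mul1r (ln n%:R)) expRN lnK ?posrE// ler_pdivrMr//; lra.
Qed.

(* With m ~ ln n, the majorant 'C(n,m) r^m beats the random bound by the factor (1+e)^m / poly(m). *)
Lemma random_polynomial_radius (R : realType) (e : R) : 0 < e -> exists n0, forall n, (n0 <= n)%N ->
  exists m (s : {ffun {set 'I_n} -> bool}) (B : R),
  (forall z : 'I_n -> R[i], \sum_i cabs (z i) ^+ 2 <= n%:R -> cabs (spoly m s z) <= B) /\
  forall r, 0 <= r -> 'C(n, m)%:R * r ^+ m <= B -> r <= (1 + e) * Num.sqrt (ln n%:R / n%:R).
Proof.
move=> e0; pose q := (1 + e)^-1.
have e1 : 0 < 1 + e by lra.
have q01 : 0 < q < 1 by rewrite invr_gt0 e1/= invf_lt1//; lra.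
have [K K0 HK] := poly_geometric_bounded 3 q01.
pose E := expR 1 : R; have E2 : 2 <= E by apply: two_le_e.
have Ep : 0 < E by lra.
(* Twice 37 times E^2, where 37 = 1 + 36 collects the summand 1 and 6 sqrt L <= 36 m sqrt n of the
   random bound. *)
pose K1 := 74 * E ^+ 2.
have K10 : 0 < K1 by rewrite mulr_gt0// exprn_gt0.
have [n1 Hn1] := ln_large (Num.max 2 (K * K1 + 1)).
have [n2 Hn2] := sqr_ln_le R.
exists (maxn (maxn n1 n2) 2) => n; rewrite !geq_max => /andP[/andP[nn1 nn2] n_2].
have := Hn1 n nn1; rewrite ge_max => /andP[l2 lK].
have l2n := Hn2 n nn2; set l := ln n%:R in l2 lK l2n *.
have n0 : (0 < n)%N by apply: leq_trans n_2.
have np : 0 < n%:R :> R by rewrite ltr0n.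
have nE : n%:R = expR l by rewrite lnK.
have hl : ln n%:R = l by [].
clearbody l.
have l0 : 0 <= l by lra.
have /andP[m1 m2] := truncn_itv l0; set m := Num.trunc l in m1 m2.
have mr : m.+1%:R = m%:R + 1 :> R by rewrite -natr1.
rewrite mr in m2.
have m1r : 1 <= m%:R :> R by lra.
have m0 : (0 < m)%N by rewrite -(ler1n R).
have mp : 0 < m%:R :> R by lra.
have m2n : m%:R ^+ 2 <= n%:R / 2 :> R.
  by apply: le_trans l2n; apply: lerXn2r; rewrite ?nnegrE.
have mn' : m%:R <= n%:R :> R by nra.
have mn : (m <= n)%N by rewrite -(ler_nat R).
have mmn : (0 < m <= n)%N by rewrite m0.
pose V : R := (E * n%:R / m%:R) ^+ m; pose L : R := 16 * n%:R * m%:R * l.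
have [s Hs] : exists s : {ffun {set 'I_n} -> bool}, forall z : 'I_n -> R[i],
    \sum_i cabs (z i) ^+ 2 <= n%:R -> cabs (spoly m s z) <= 1 + 6 * Num.sqrt (L * V).
  by rewrite /L -hl; exact: random_polynomial.
exists m, s, (1 + 6 * Num.sqrt (L * V)); split; first exact: Hs.
move=> r r0 h.
rewrite leNgt; apply/negP => rlt.
set rho := Num.sqrt _ in rlt.
have rho0 : 0 <= rho by apply: sqrtr_ge0.
have ln0 : 0 <= l / n%:R by rewrite divr_ge0// ltW.
have rho2 : rho ^+ 2 = l / n%:R by rewrite sqr_sqrtr.
have V1 : 1 <= V.
  rewrite /V; apply: exprn_ege1.
  rewrite ler_pdivlMr//.
  rewrite mul1r.
  apply: (le_trans mn').
  rewrite ler_peMl//.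
  lra.
have V0 : 0 < V by lra.
pose v := Num.sqrt V.
have v1 : 1 <= v by rewrite -sqrtr1; apply: ler_wsqrtr.
have v2 : v * v = V by rewrite -expr2 sqr_sqrtr// ltW.
have L0 : 0 <= L by rewrite !mulr_ge0.
pose nu := Num.sqrt n%:R : R.
have nu1 : 1 <= nu by rewrite -sqrtr1; apply: ler_wsqrtr; rewrite ler1n.
have nu2 : nu ^+ 2 = n%:R by rewrite sqr_sqrtr// ltW.
have vp : 0 < v by apply: lt_le_trans v1.
have nup : 0 < nu by apply: lt_le_trans nu1.
have sL : Num.sqrt L <= 6 * m%:R * nu.
  have b0 : 0 <= 6 * m%:R * nu by apply: mulr_ge0 (ltW nup); apply: mulr_ge0.
  rewrite -(@ler_pXn2r _ 2)// ?nnegrE ?sqrtr_ge0// sqr_sqrtr// !exprMn nu2 /L.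
  have : l <= 2 * m%:R by lra.
  have : 0 <= n%:R * m%:R :> R by rewrite mulr_ge0.
  nra.
have hC : V / 2 / (E * m%:R) <= 'C(n, m)%:R.
  apply: le_trans (bin_ge R m0 mn); rewrite ler_wpM2r ?invr_ge0 ?mulr_ge0 ?(ltW Ep)//.
  have -> : E * (n - m)%:R / m%:R = E * n%:R / m%:R * (1 - m%:R / n%:R).
    by rewrite natrB//; field; rewrite !gt_eqF.
  rewrite exprMn -/V ler_wpM2l ?(ltW V0)//.
  have t0 : 0 <= 1 - m%:R / n%:R :> R by rewrite subr_ge0 ler_pdivrMr// mul1r.
  apply: le_trans (bernoulli m t0).
  have -> : 1 + m%:R * (1 - m%:R / n%:R - 1) = 1 - m%:R ^+ 2 / n%:R :> R.
    by field; rewrite gt_eqF.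
  have : m%:R ^+ 2 / n%:R <= 1 / 2 :> R by rewrite ler_pdivrMr//; lra.
  lra.
(* V rho^(2m) = (E l / m)^m >= E^m >= n / E because m <= l < m + 1. Its square root is what cancels
   the sqrt n of the random bound. *)
have vr : nu / E <= v * rho ^+ m.
  have v0 : 0 <= v by apply: sqrtr_ge0.
  have x0 : 0 <= nu / E by apply: divr_ge0; [apply: sqrtr_ge0|apply: ltW].
  have y0 : 0 <= v * rho ^+ m by apply: mulr_ge0 => //; apply: exprn_ge0.
  rewrite -(@ler_pXn2r _ 2)//.
  rewrite exprMn nu2 [leRHS]exprMn [v ^+ 2]expr2 v2 -[(rho ^+ m) ^+ 2]exprM mulnC exprM rho2 /V -[leRHS]exprMn.
  have -> : E * n%:R / m%:R * (l / n%:R) = E * (l / m%:R) by field; rewrite !gt_eqF.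
  rewrite exprMn.
  have h1 : 1 <= (l / m%:R) ^+ m by rewrite exprn_ege1// ler_pdivlMr// mul1r.
  have h2 : n%:R / E <= E ^+ m.
    by rewrite ler_pdivrMr// -exprSr nE /E -expRM_natl ler_expR mulr1 mr ltW.
  have h3 : E^-1 <= 1 by rewrite invf_le1// (le_trans _ E2)// ler1n.
  have h4 : n%:R / E * E^-1 <= n%:R / E by rewrite ler_piMr// divr_ge0// ltW.
  rewrite exprVn expr2 invfM mulrA (le_trans h4)// (le_trans h2)//.
  by rewrite ler_peMr// exprn_ge0// ltW.
have rm : ((1 + e) * rho) ^+ m <= r ^+ m.
  by apply: lerXn2r; rewrite ?nnegrE ?mulr_ge0 ?(ltW e1)// ltW.
pose G := (1 + e) ^+ m; have G0 : 0 < G by rewrite exprn_gt0.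
have main : v * (nu / E) * G / 2 / (E * m%:R) <= 1 + 6 * Num.sqrt (L * V).
  apply: le_trans h; apply: le_trans (ler_wpM2l (ler0n _ _) rm).
  apply: (@le_trans _ _ (V / 2 / (E * m%:R) * ((1 + e) * rho) ^+ m)); last first.
    by rewrite ler_wpM2r// exprn_ge0// mulr_ge0// ltW.
  rewrite exprMn -/G -v2.
  have -> : v * v / 2 / (E * m%:R) * (G * rho ^+ m) = v * (v * rho ^+ m) * G / 2 / (E * m%:R) by ring.
  by rewrite !ler_wpM2r ?invr_ge0 ?mulr_ge0 ?(ltW Ep) ?(ltW G0)// ler_wpM2l//; lra.
have main2 : v * (nu / E) * G / 2 / (E * m%:R) <= v * (37 * m%:R * nu).
  apply: (le_trans main); rewrite (sqrtrM _ L0) -/v.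
  have s1 : 1 <= m%:R * nu :> R by rewrite mulr_ege1.
  have h1 : Num.sqrt L * v <= 6 * m%:R * nu * v by rewrite ler_pM2r.
  have h2 : 1 <= v * (m%:R * nu) by rewrite mulr_ege1.
  by move: h1 h2; rewrite [_ * (37 * _ * _)]mulrC; nra.
have GK : G <= K1 * m%:R ^+ 2.
  have vn : 0 < v * nu by apply: mulr_gt0.
  rewrite -(ler_pM2l vn).
  have -> : v * nu * G = (v * (nu / E) * G / 2 / (E * m%:R)) * (2 * E ^+ 2 * m%:R).
    by field; rewrite !gt_eqF.
  have -> : v * nu * (K1 * m%:R ^+ 2) = v * (37 * m%:R * nu) * (2 * E ^+ 2 * m%:R).
    by rewrite /K1; ring.
  by rewrite ler_wpM2r// !mulr_ge0 ?exprn_ge0 ?(ltW Ep).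
(* m^3 <= K (1 + e)^m <= K K1 m^2 gives m <= K K1, against m > l - 1 >= K K1. *)
have := HK m m0; rewrite /q exprVn -/G ler_pdivrMr// => h3.
have : m%:R * m%:R ^+ 2 <= K * K1 * m%:R ^+ 2 :> R.
  by rewrite -exprS (le_trans h3)// -mulrA ler_wpM2l// ltW.
have mp2 : 0 < m%:R ^+ 2 :> R by apply: exprn_gt0.
by rewrite (ler_pM2r mp2); lra.
Qed.

(** * Polynomials: holomorphy and Taylor coefficients *)

Section Polynomials.
Variable R : realType.
Local Notation "x %:C" := (real_complex R x) : ring_scope.
Local Notation C := R[i].

Lemma differentiable_sephol n (f : 'rV[C]_n -> C^o) (rho : 'I_n -> R) (M : R) :
  (forall z, polydisc rho z -> differentiable f (z : cvec R n)) ->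
  (forall z, polydisc rho z -> cabs (f z) <= M) -> sephol rho M f.
Proof.
move=> df fM i z zr; split=> t tr; last by apply: fM; apply: polydisc_subst.
have [d Hd] := differentiable_cdiff (delta_mx 0 i) (df _ (polydisc_subst zr tr)).
exists d; apply/cdiff_shift; move: Hd; congr (cdiff _ 0 d).
by apply/funext => h; rewrite substD.
Qed.

Lemma differentiable_monomial n (a : {ffun 'I_n -> nat}) (z : 'rV[C]_n) :
  differentiable (fun z => monomial z a : C^o) (z : cvec R n).
Proof.
rewrite /monomial; elim: (index_enum _) => [|i s IH].
  rewrite (_ : (fun _ => _) = fun=> 1) ?funeqE => [|y]; first exact: differentiable_cst.
  by rewrite big_nil.
rewrite (_ : (fun _ => _) = (fun y : 'rV[C]_n => y 0 i ^+ a i : C^o) \* (fun y : 'rV[C]_n => \prod_(i <- s) y 0 i ^+ a i : C^o)) ?funeqE => [|y]; last first.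
  by rewrite big_cons.
apply: (@differentiableM _ (cvec R n)) => //.
elim: (a i) => [|k IHk].
  rewrite (_ : (fun _ => _) = fun=> 1) ?funeqE => [|y]; first exact: differentiable_cst.
  by rewrite expr0.
rewrite (_ : (fun _ => _) = (fun y : 'rV[C]_n => y 0 i : C^o) \* (fun y : 'rV[C]_n => y 0 i ^+ k : C^o)) ?funeqE => [|y]; last first.
  by rewrite exprS.
apply: (@differentiableM _ (cvec R n)) => //.
exact: (@differentiable_coord C 1 n).
Qed.

Lemma differentiable_polynomial n (I : finType) (q : I -> C) (e : I -> {ffun 'I_n -> nat})
  (z : 'rV[C]_n) :
  differentiable (fun z => \sum_t q t * monomial z (e t) : C^o) (z : cvec R n).
Proof.
elim: (index_enum _) => [|t s IH].
  rewrite (_ : (fun _ => _) = fun=> 0) ?funeqE => [|y]; first exact: differentiable_cst.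
  by rewrite big_nil.
rewrite (_ : (fun _ => _) = (fun y : 'rV[C]_n => q t * monomial y (e t) : C^o) \+
   (fun y : 'rV[C]_n => \sum_(t <- s) q t * monomial y (e t) : C^o)) ?funeqE => [|y]; last first.
  by rewrite big_cons.
apply: (@differentiableD _ (cvec R n)) => //.
apply: (@differentiableM _ (cvec R n)); first exact: differentiable_cst.
exact: differentiable_monomial.
Qed.

(* The Taylor polynomial of degree N approximates within O(q^(N+1)) on the polydisc of radius q; by
   Parseval the coefficients of the difference d satisfy |d_b| q^|b| = O(q^(N+1)), so let q -> 0. *)
Lemma taylor_coef_polynomial n (I : finType) (q : I -> C) (e : I -> {ffun 'I_n -> nat})
  (a : {ffun 'I_n -> nat}) :
  taylor_coef (fun z => \sum_t q t * monomial z (e t) : C^o) a = \sum_(t | e t == a) q t.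
Proof.
set f := fun z => _.
pose N := (\max_t \max_i e t i + wt a + \max_i a i)%N.
have eN t i : (e t i < N.+2)%N.
  rewrite !ltnS ltnW// ltnS /N -!addnA (leq_trans _ (leq_addr _ _))//.
  by rewrite (leq_trans (leq_bigmax i))// (leq_bigmax t).
have aN i : (a i < N.+2)%N.
  by rewrite !ltnS ltnW// ltnS /N (leq_trans (leq_bigmax i))// leq_addl.
have waN : (wt a <= N)%N by rewrite /N addnAC leq_addl.
have h12 : 0 < (1 : R) < 2 by apply/andP; split; lra.
clearbody N; pose d (b : {ffun 'I_n -> 'I_N.+2}) : C := \sum_(t | e t == nbox b) q t - taylor_coef f (nbox b).
pose M := \sum_t cabs (q t) * \prod_i 2 ^+ e t i.
have M0 : 0 <= M by apply: sumr_ge0 => t _; rewrite mulr_ge0 ?cabs_ge0// prodr_ge0// => i _; rewrite exprn_ge0.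
have Hf : sephol (fun=> 2) M f.
  apply: differentiable_sephol => z zr; first exact: differentiable_polynomial.
  apply: (le_trans (cabs_sum _ _ _)); apply: ler_sum => t _.
  rewrite cabsM ler_wpM2l ?cabs_ge0// cabs_prod; apply: ler_prod => i _.
  rewrite cabs_ge0 cabsX /=; apply: lerXn2r; rewrite ?nnegrE ?cabs_ge0//.
  exact/ltW/zr.
have nboxE (b : {ffun 'I_n -> 'I_N.+2}) (y : 'rV[C]_n) : monomial y (nbox b) = mon (y 0) (mi b).
  by apply: eq_bigr => i _; rewrite ffunE.
have fE (y : 'rV[C]_n) : f y = \sum_(b : {ffun 'I_n -> 'I_N.+2}) (\sum_(t | e t == nbox b) q t) * monomial y (nbox b) :> C.
  under [RHS]eq_bigr do rewrite mulr_suml big_mkcond.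
  rewrite exchange_big /=; apply: eq_bigr => t _.
  pose bt : {ffun 'I_n -> 'I_N.+2} := [ffun i => Ordinal (eN t i)].
  have btE : nbox bt = e t by apply/ffunP => i; rewrite !ffunE.
  rewrite (bigD1 bt)//= btE eqxx big1 ?addr0// => b bbt; case: eqP => // eb.
  case/eqP: bbt; apply/ffunP => i; apply: val_inj => /=.
  by have /ffunP/(_ i) := eb; rewrite !ffunE.
pose K : R := n%:R * (M * 2 ^+ n).
have K0 : 0 <= K by rewrite mulr_ge0// mulr_ge0// exprn_ge0.
have dq (b : {ffun 'I_n -> 'I_N.+2}) (r : R) : 0 < r <= 1 / 2 -> cabs (d b) * r ^+ wt (mi b) <= K * r ^+ N.+2.
  move=> /andP[r0 r1].
  pose D b := d b * r%:C ^+ wt (mi b).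
  have DE (y : 'I_n -> C) : expsum D mi y = \sum_b d b * mon (fun i => r%:C * y i) (mi b).
    by apply: eq_bigr => b' _; rewrite monZ mulrA.
  have bnd (y : 'I_n -> C) : (forall i, cabs (y i) = 1) -> cabs (expsum D mi y) ^+ 2 <= (K * r ^+ N.+2) ^+ 2.
    move=> y1; apply: lerXn2r; rewrite ?nnegrE ?cabs_ge0//.
      by rewrite mulr_ge0// exprn_ge0// ltW.
    pose z : 'rV[C]_n := \row_i (r%:C * y i).
    have zr i : cabs (z 0 i) <= r * 1 by rewrite mxE cabsM cabsR gtr0_norm// y1.
    have r01 : 0 <= r < 1 by rewrite ltW//=; lra.
    have := @taylor_polynomial_error R n N.+1 (fun=> 2) M f (fun=> 1) r z Hf (fun=> h12) M0 r01 zr.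
    rewrite DE.
    have -> : f z - \sum_(b : {ffun 'I_n -> 'I_N.+2}) taylor_coef f (nbox b) * monomial z (nbox b) =
       \sum_b d b * mon (fun i => r%:C * y i) (mi b).
      rewrite fE -sumrB; apply: eq_bigr => b' _; rewrite nboxE /d mulrBl; congr (_ * _ - _ * _);
        by apply: eq_bigr => i _; rewrite mxE.
    move=> h; apply: (le_trans h).
    have h2 : (1 - r)^-1 ^+ n <= 2 ^+ n.
      have i0 : 0 <= (1 - r)^-1 by rewrite invr_ge0; lra.
      by apply: lerXn2r; rewrite ?nnegrE// invf_ple ?posrE//; lra.
    have -> : K * r ^+ N.+2 = n%:R * (M * r ^+ N.+2 * 2 ^+ n) by rewrite /K; ring.
    apply: ler_wpM2l => //; apply: ler_wpM2l => //; apply: mulr_ge0 => //.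
    by apply: exprn_ge0; apply: ltW.
  have := gavg_bound (isT : (0 < N.+2)%N) bnd.
  rewrite gavg_sqr_inj; [|by []|exact: mi_lt|by move=> b1 b2 _ _; apply: mi_inj].
  move=> h; have p0 k : 0 <= r ^+ k by rewrite exprn_ge0// ltW.
  have p1 : 0 <= cabs (d b) * r ^+ wt (mi b) by rewrite mulr_ge0// cabs_ge0.
  have p2 : 0 <= K * r ^+ N.+2 by rewrite mulr_ge0.
  rewrite -(@ler_pXn2r _ 2)//.
  apply: le_trans h; rewrite (bigD1 b)//= /D cabsM cabsX cabsR gtr0_norm//.
  by rewrite lerDl sumr_ge0// => b' _; rewrite exprn_ge0// cabs_ge0.
pose b : {ffun 'I_n -> 'I_N.+2} := [ffun i => Ordinal (aN i)].
have bE : nbox b = a by apply/ffunP => i; rewrite !ffunE.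
suff /eqP : d b = 0 by rewrite subr_eq0 bE => /eqP <-.
have wb : wt (mi b) = wt a by apply: eq_bigr => i _; rewrite /mi ffunE.
apply/eqP; rewrite -cabs_eq0; apply/eqP/le_anti; rewrite cabs_ge0 andbT.
apply/ler_addgt0Pr => eps eps0; rewrite add0r.
(* After cancellation of r^|a| the bound on |d_b| is at most K r, which this r makes smaller than
   eps. *)
pose r := Num.min (1 / 2) (eps / (K + 1)).
have K1 : 0 < K + 1 by rewrite ltr_wpDl.
have r0 : 0 < r by rewrite lt_min divr_gt0//= divr_gt0.
have r1 : r <= 1 / 2 by rewrite ge_min lexx.
have r2 : r * (K + 1) <= eps by rewrite -ler_pdivlMr// ge_min lexx orbT.
have := dq b r; rewrite r0 r1 => /(_ isT); rewrite wb.
have p0 : 0 < r ^+ wt a by rewrite exprn_gt0.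
have -> : (N.+2 = (N - wt a) + 1 + wt a + 1)%N by move: waN; clear; lia.
rewrite addn1 exprS exprD.
have s1 : r ^+ (N - wt a + 1) <= 1 by rewrite exprn_ile1 ?(ltW r0)//; lra.
have -> : K * (r * (r ^+ (N - wt a + 1) * r ^+ wt a)) = K * r * r ^+ (N - wt a + 1) * r ^+ wt a by ring.
rewrite ler_pM2r// => /le_trans; apply; apply: (@le_trans _ _ (K * r)).
  by rewrite ler_piMr// mulr_ge0// ltW.
by apply: le_trans r2; rewrite mulrC ler_wpM2l ?(ltW r0)// lerDl.
Qed.

End Polynomials.

(** * The norm of X_n and the majorant bound for functions on its ball *)

Section Lattice.
Variables (R : realType) (X : set (cseq R)) (nrm : cseq R -> R).
Hypothesis HX : banach_seq_lattice X nrm.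
Local Notation "x %:C" := (real_complex R x) : ring_scope.
Local Notation C := R[i].

Lemma ind_in n : X (ind R n).
Proof.
have [[X0 XD _] _ _ _ Xe] := HX.
elim: n => [|n IH]; first by have -> : ind R 0 = fun=> 0 by apply/funext.
have -> : ind R n.+1 = fun k => ind R n k + unit_vec R n k; last exact: XD.
apply/funext => k; rewrite /ind /unit_vec ltnS.
by case: (ltngtP k n) => _; rewrite ?addr0 ?add0r.
Qed.

Lemma extend_ord n (z : 'rV[C]_n) (i : 'I_n) : extend z i = z 0 i.
Proof. by rewrite /extend; case: insubP => [j _ /val_inj ->//|]; rewrite ltn_ord. Qed.

Lemma extend_ge n (z : 'rV[C]_n) k : (n <= k)%N -> extend z k = 0.
Proof. by rewrite /extend; case: insubP => // j; rewrite ltnNge => /negbTE ->. Qed.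

Lemma ord_or_geq (n k : nat) : (exists i : 'I_n, k = i) \/ (n <= k)%N.
Proof. by have [lt|] := ltnP k n; [left; exists (Ordinal lt)|right]. Qed.

Let modulus n (z : 'rV[C]_n) : cseq R := fun k => (cabs (extend z k))%:C.

Lemma cabs_modulus n (z : 'rV[C]_n) k : cabs (modulus z k) = cabs (extend z k).
Proof. by rewrite cabsR ger0_norm// cabs_ge0. Qed.

Lemma modulus_in n (z : 'rV[C]_n) : X (modulus z).
Proof.
have [[_ _ XZ] _ _ XL _] := HX.
pose M : R := \sum_i cabs (z 0 i).
apply: (proj1 (XL _ (modulus z) (XZ M%:C _ (ind_in n)) _)) => k.
rewrite cabs_modulus cabsM cabsR ger0_norm; last by apply: sumr_ge0 => i _; apply: cabs_ge0.
have [[i ->]|nk] := ord_or_geq n k; last by rewrite extend_ge// cabs0 mulr_ge0 ?cabs_ge0// sumr_ge0// => i _; apply: cabs_ge0.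
rewrite extend_ord /ind ltn_ord cabs1 mulr1 /M (bigD1 i)//= lerDl sumr_ge0// => j _; exact: cabs_ge0.
Qed.

Lemma nrmXn_ge0 n (z : 'rV[C]_n) : 0 <= nrmXn nrm z.
Proof. by have [_ [N0 _ _ _] _ _ _] := HX; apply/N0/modulus_in. Qed.

Lemma nrmXnZ n (a : C) (z : 'rV[C]_n) : nrmXn nrm (a *: z) = cabs a * nrmXn nrm z.
Proof.
have [_ [_ _ NZ _] _ _ _] := HX.
rewrite /nrmXn -[cabs a]ger0_norm ?cabs_ge0// -cabsR -(NZ _ _ (modulus_in z)).
congr nrm; apply/funext => k; rewrite /modulus -rmorphM -cabsM; congr ((cabs _)%:C).
have [[i ->]|nk] := ord_or_geq n k; first by rewrite !extend_ord mxE.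
by rewrite !extend_ge// mulr0.
Qed.

(** Combines the triangle inequality with the lattice property, so that vectors may be compared
    through the moduli of their coordinates only; the second summand is often a small multiple of
    the all-ones vector. *)
Lemma nrmXn_tri n (z w v : 'rV[C]_n) : (forall i, cabs (z 0 i) <= cabs (w 0 i) + cabs (v 0 i)) ->
  nrmXn nrm z <= nrmXn nrm w + nrmXn nrm v.
Proof.
have [[_ XD _] [_ _ _ ND] _ XL _] := HX => h.
apply: le_trans (ND _ _ (modulus_in w) (modulus_in v)).
apply: (proj2 (XL _ (modulus z) (XD _ _ (modulus_in w) (modulus_in v)) _)) => k.
rewrite cabs_modulus -rmorphD cabsR ger0_norm ?addr_ge0 ?cabs_ge0//.
have [[i ->]|nk] := ord_or_geq n k; first by rewrite !extend_ord.
by rewrite extend_ge// cabs0 addr_ge0 ?cabs_ge0.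
Qed.

Lemma nrmXn0 n : nrmXn nrm (0 : 'rV[C]_n) = 0.
Proof. by rewrite -(scale0r (0 : 'rV[C]_n)) nrmXnZ cabs0 mul0r. Qed.

Lemma nrmXn_mono n (z w : 'rV[C]_n) : (forall i, cabs (z 0 i) <= cabs (w 0 i)) ->
  nrmXn nrm z <= nrmXn nrm w.
Proof.
by move=> h; rewrite -[leRHS]addr0 -(nrmXn0 n); apply: nrmXn_tri => i; rewrite mxE cabs0 addr0.
Qed.

Lemma nrmXn_delta_gt0 n (i : 'I_n) : 0 < nrmXn nrm (delta_mx 0 i : 'rV[C]_n).
Proof.
have [_ [_ N0 _ _] _ _ _] := HX; rewrite lt_def nrmXn_ge0 andbT; apply/eqP => h.
have /(congr1 (fun f => f (i : nat))) := N0 _ (modulus_in _) h.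
by rewrite /modulus extend_ord mxE !eqxx cabs1 => /eqP; rewrite rmorph1 oner_eq0.
Qed.

(** Raising every modulus |w_i| by d raises the norm by at most d times the norm of the all-ones
    vector, and w has room to spare. *)
Lemma polydisc_sub_ball n (w : 'rV[C]_n) : BX nrm n w -> exists2 d : R, 0 < d &
  forall z : 'rV[C]_n, polydisc (fun i => cabs (w 0 i) + d) z -> BX nrm n z.
Proof.
move=> w1; have w1' : nrmXn nrm w < 1 by [].
pose E := nrmXn nrm (const_mx 1 : 'rV[C]_n); have E0 : 0 <= E by apply: nrmXn_ge0.
pose d := (1 - nrmXn nrm w) / (E + 1).
have E1 : 0 < E + 1 by rewrite ltr_wpDl.
have d0 : 0 < d by rewrite divr_gt0// subr_gt0.
exists d => // z zd; rewrite /BX /=.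
apply: (@le_lt_trans _ _ (nrmXn nrm w + nrmXn nrm (d%:C *: const_mx 1 : 'rV[C]_n))).
  apply: nrmXn_tri => i; rewrite !mxE mulr1 cabsR gtr0_norm//; exact/ltW/zd.
rewrite nrmXnZ cabsR gtr0_norm// -/E.
have : d * (E + 1) = 1 - nrmXn nrm w by rewrite /d divfK// gt_eqF.
by rewrite mulrDr mulr1; lra.
Qed.

(* Cover w by a polydisc inside the ball: the Taylor polynomials of u |-> f (w u) are bounded by
   M + d on the closed unit polydisc, where [bohr_polynomial] applies. *)
Lemma bohr_lower n (r : R) (f : 'rV[C]_n -> C^o) (M : R) (w : 'rV[C]_n) :
  (forall N (c : {ffun 'I_n -> 'I_N.+2} -> C),
    (forall y, (forall i, cabs (y i) <= 1) -> cabs (expsum c (@mi n N) y) <= 1) ->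
    \sum_b cabs (c b) * r ^+ wt (mi b) <= 1) ->
  0 <= r -> 0 <= M ->
  holomorphic_on (BX nrm n) f -> (forall z, BX nrm n z -> cabs (f z) <= M) -> BX nrm n w ->
  forall A : seq {ffun 'I_n -> nat}, uniq A ->
  \sum_(a <- A) cabs (taylor_coef f a * monomial (r%:C *: w) a) <= M.
Proof.
move=> BP r0 M0 hol fM w1 A uA.
have [d d0 Hd] := polydisc_sub_ball w1.
have Hf : sephol (fun i => cabs (w 0 i) + d) M f.
  by apply: differentiable_sephol => z /Hd zB; [exact: hol|exact: fM].
pose W := \sum_i cabs (w 0 i).
have W0 : 0 <= W by apply: sumr_ge0 => i _; apply: cabs_ge0.
pose rr i := cabs (w 0 i) + d / 2.
have d2 : 0 < d / 2 by rewrite divr_gt0.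
have Hr j : 0 < rr j < cabs (w 0 j) + d.
  by rewrite /rr ltr_wpDl ?cabs_ge0//= ltrD2l; lra.
(* As |w_i| <= W, one q < 1 gives |w_i| <= q (|w_i| + d / 2) for all coordinates at once. *)
pose q := W / (W + d / 2).
have Wd : 0 < W + d / 2 by rewrite ltr_wpDl.
have q01 : 0 <= q < 1 by rewrite divr_ge0 ?(ltW Wd)//= ltr_pdivrMr// mul1r ltrDl.
have wW i : cabs (w 0 i) <= W by rewrite /W (bigD1 i)//= lerDl sumr_ge0// => j _; apply: cabs_ge0.
have wq i : cabs (w 0 i) <= q * rr i.
  rewrite /q mulrAC ler_pdivlMr// /rr !mulrDr mulrC lerD2l mulrC [leRHS]mulrC.
  by rewrite ler_pM2l.
apply/ler_addgt0Pr => e e0.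
pose K := n%:R * (M * (1 - q)^-1 ^+ n) + 1.
have iq : 0 <= (1 - q)^-1 by rewrite invr_ge0; lra.
have K0 : 0 < K by rewrite ltr_wpDl// mulr_ge0// mulr_ge0// exprn_ge0.
have [N0 HN0] := exp_small q01 (divr_gt0 e0 K0).
(* Large enough both for the Taylor error and for the box of exponents to contain all of A. *)
have [N NN0 NA] : exists2 N, (N0 <= N)%N & forall a i, a \in A -> (a i <= N)%N.
  exists (N0 + \max_(a <- A) \max_i a i)%N => [|a i aA]; first exact: leq_addr.
  rewrite (leq_trans _ (leq_addl _ _))// (leq_trans (leq_bigmax i))//.
  exact: (@leq_bigmax_seq _ A xpredT (fun a : {ffun 'I_n -> nat} => \max_i a i)%N).
have err (u : 'I_n -> C) : (forall i, cabs (u i) <= 1) ->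
    cabs (\sum_(b : {ffun 'I_n -> 'I_N.+2}) taylor_coef f (nbox b) * monomial w (nbox b) * mon u (mi b)) <= M + e.
  move=> u1; pose z : 'rV[C]_n := \row_i (w 0 i * u i).
  have zw i : cabs (z 0 i) <= cabs (w 0 i) by rewrite mxE cabsM ler_piMr ?cabs_ge0.
  have zB : BX nrm n z by apply: Hd => i; rewrite (le_lt_trans (zw i))// ltrDl.
  have zq i : cabs (z 0 i) <= q * rr i by rewrite (le_trans (zw i)).
  have := @taylor_polynomial_error R n N.+1 _ M f rr q z Hf Hr M0 q01 zq.
  have -> : \sum_(b : {ffun 'I_n -> 'I_N.+2}) taylor_coef f (nbox b) * monomial z (nbox b) =
     \sum_(b : {ffun 'I_n -> 'I_N.+2}) taylor_coef f (nbox b) * monomial w (nbox b) * mon u (mi b).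
    apply: eq_bigr => b _; rewrite -mulrA; congr (_ * _).
    rewrite /monomial /mon -big_split /=; apply: eq_bigr => i _.
    by rewrite mxE exprMn ffunE.
  set S := \sum_b _ => h.
  have h2 : q ^+ N.+2 <= e / K by apply: HN0; rewrite (leq_trans NN0)// -addn2 leq_addr.
  have h3 : n%:R * (M * q ^+ N.+2 * (1 - q)^-1 ^+ n) <= e.
    have -> : n%:R * (M * q ^+ N.+2 * (1 - q)^-1 ^+ n) = (K - 1) * q ^+ N.+2 by rewrite /K; ring.
    apply: (@le_trans _ _ (K * (e / K))); last by rewrite mulrC divfK// gt_eqF.
    have q0 : 0 <= q ^+ N.+2 by rewrite exprn_ge0//; case/andP: q01.
    by apply: (@le_trans _ _ (K * q ^+ N.+2)); [rewrite ler_wpM2r//; lra|rewrite ler_wpM2l// ltW].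
  have -> : S = f z - (f z - S) by rewrite opprB addrC subrK.
  by rewrite (le_trans (cabsB _ _))// lerD ?fM// (le_trans h).
have Me : 0 < M + e by rewrite ltr_wpDl.
have Men : (M + e)%:C != 0 by rewrite -cabs_eq0 cabsR gtr0_norm// gt_eqF.
pose c (b : {ffun 'I_n -> 'I_N.+2}) := taylor_coef f (nbox b) * monomial w (nbox b) / (M + e)%:C.
have := BP N c _; have cB : forall y, (forall i, cabs (y i) <= 1) -> cabs (expsum c mi y) <= 1.
  move=> y /err h.
  have -> : expsum c mi y = (\sum_(b : {ffun 'I_n -> 'I_N.+2})
      taylor_coef f (nbox b) * monomial w (nbox b) * mon y (mi b)) / (M + e)%:C.
    by rewrite mulr_suml; apply: eq_bigr => b _; rewrite /c mulrAC.
  by rewrite cabsM cabsV cabsR gtr0_norm// ler_pdivrMr// mul1r.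
move=> /(_ cB) {cB}.
have -> : \sum_b cabs (c b) * r ^+ wt (mi b) =
    (\sum_(b : {ffun 'I_n -> 'I_N.+2}) cabs (taylor_coef f (nbox b) * monomial (r%:C *: w) (nbox b))) / (M + e).
  rewrite mulr_suml; apply: eq_bigr => b _; rewrite /c cabsM cabsV [cabs (M + e)%:C]cabsR [`|M + e|]gtr0_norm//.
  have -> : monomial (r%:C *: w) (nbox b) = r%:C ^+ wt (mi b) * monomial w (nbox b).
    rewrite /monomial /wt expr_sum -big_split /=; apply: eq_bigr => i _.
    by rewrite mxE exprMn ffunE.
  by rewrite !(cabsX, cabsM) cabsR [`|r|]ger0_norm//; ring.
rewrite ler_pdivrMr// mul1r; apply: le_trans.
have AN a i : a \in A -> (a i < N.+2)%N.
  by move=> aA; rewrite ltnS ltnW// ltnS NA.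
pose h (a : {ffun 'I_n -> nat}) : {ffun 'I_n -> 'I_N.+2} := [ffun i => inord (a i)].
have hE a : a \in A -> nbox (h a) = a.
  by move=> aA; apply/ffunP => i; rewrite !ffunE inordK// AN.
pose F a := cabs (taylor_coef f a * monomial (r%:C *: w) a).
have -> : \sum_(a <- A) F a = \sum_(b <- [seq h a | a <- A]) F (nbox b).
  by rewrite big_map big_seq [RHS]big_seq; apply: eq_bigr => a aA; rewrite hE.
have un : uniq [seq h a | a <- A].
  rewrite map_inj_in_uniq // => a b aA bA ab.
  by rewrite -(hE a aA) -(hE b bA) ab.
rewrite big_uniq// [leRHS](bigID (mem [seq h a | a <- A]))/= lerDl sumr_ge0// => b _; exact: cabs_ge0.
Qed.

End Lattice.

Lemma sum_le_esum (R : realType) (T : choiceType) (P : set T) (F : T -> R) (s : seq T) :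
  uniq s -> (forall x, x \in s -> P x) -> (forall x, 0 <= F x) ->
  ((\sum_(x <- s) F x)%:E <= \esum_(x in P) (F x)%:E)%E.
Proof.
move=> us sP F0; apply: esum_ge; exists [set` s].
  by split; [exact: finite_seq|move=> x /= /sP].
by rewrite -fsbig_seq// sumEFin.
Qed.

Lemma esum_le (R : realType) (T : choiceType) (P : set T) (F : T -> R) (M : R) :
  (forall s, uniq s -> \sum_(x <- s) F x <= M) -> (\esum_(x in P) (F x)%:E <= M%:E)%E.
Proof.
move=> H; apply: ge_ereal_sup => _ [A [finA _] <-].
by rewrite fsbig_finite//= sumEFin lee_fin H// fset_uniq.
Qed.

(** * The two bounds on the Bohr radius *)

Section BohrRadius.
Variables (R : realType) (X : set (cseq R)) (nrm : cseq R -> R).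
Hypothesis HX : banach_seq_lattice X nrm.
Local Notation "x %:C" := (real_complex R x) : ring_scope.
Local Notation C := R[i].

(** Bounds the sets behind [id_norm1] and [id_norm2], without which [sup] would not be an upper
    bound. *)
Lemma coord_le n (z : 'rV[C]_n) i : nrmXn nrm z <= 1 ->
  cabs (z 0 i) <= (nrmXn nrm (delta_mx 0 i : 'rV[C]_n))^-1.
Proof.
move=> z1; have d0 := nrmXn_delta_gt0 HX i.
rewrite -[leRHS]div1r ler_pdivlMr// -(nrmXnZ HX) (le_trans _ z1)//.
apply: (nrmXn_mono HX) => j; rewrite !mxE eqxx /=.
by case: (eqVneq j i) => [->|_]; rewrite ?mulr1 ?mulr0 ?cabs0 ?cabs_ge0.
Qed.

Lemma sum_le_id_norm1 n (z : 'rV[C]_n) : nrmXn nrm z <= 1 ->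
  \sum_i cabs (z 0 i) <= id_norm1 nrm n.
Proof.
move=> z1; apply: ub_le_sup; last by exists z.
exists (\sum_(i < n) (nrmXn nrm (delta_mx 0 i : 'rV[C]_n))^-1) => _ [w w1 <-].
by apply: ler_sum => i _; apply: coord_le.
Qed.

Lemma norm_le_id_norm2 n (z : 'rV[C]_n) : nrmXn nrm z <= 1 ->
  Num.sqrt (\sum_i cabs (z 0 i) ^+ 2) <= id_norm2 nrm n.
Proof.
move=> z1; apply: ub_le_sup; last by exists z.
exists (Num.sqrt (\sum_(i < n) ((nrmXn nrm (delta_mx 0 i : 'rV[C]_n))^-1) ^+ 2)) => _ [w w1 <-].
apply: ler_wsqrtr; apply: ler_sum => i _.
apply: lerXn2r; rewrite ?nnegrE ?cabs_ge0 ?invr_ge0//; first exact: (nrmXn_ge0 HX).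
exact: coord_le.
Qed.

Lemma id_norm1_gt0 n : (0 < n)%N -> 0 < id_norm1 nrm n.
Proof.
move=> n0; pose i := Ordinal n0; have d0 := nrmXn_delta_gt0 HX i.
pose z : 'rV[C]_n := ((nrmXn nrm (delta_mx 0 i : 'rV[C]_n))^-1)%:C *: delta_mx 0 i.
have zi : 0 < cabs (z 0 i).
  by rewrite !mxE !eqxx mulr1 cabsR gtr0_norm invr_gt0.
apply: lt_le_trans (sum_le_id_norm1 (z := z) _).
  rewrite (bigD1 i)//= ltr_pwDl// sumr_ge0// => j _; exact: cabs_ge0.
by rewrite (nrmXnZ HX) cabsR gtr0_norm ?invr_gt0// mulVf// gt_eqF.
Qed.

Section FixedDimension.
Variable n : nat.
Hypothesis n0 : (0 < n)%N.
Hypothesis hn : id_norm2 nrm n <= id_norm1 nrm n / Num.sqrt n%:R.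
Let S := id_norm1 nrm n.

Lemma sum_sqr_le (z : 'rV[C]_n) : nrmXn nrm z <= 1 -> \sum_i cabs (z 0 i) ^+ 2 <= S ^+ 2 / n%:R.
Proof.
move=> z1; have h := le_trans (norm_le_id_norm2 z1) hn.
have p0 : 0 <= \sum_i cabs (z 0 i) ^+ 2 by apply: sumr_ge0 => i _; apply: sqr_ge0.
have S0 := id_norm1_gt0 n0.
rewrite -(sqr_sqrtr p0) -[n%:R]sqr_sqrtr// -expr_div_n.
by apply: lerXn2r; rewrite ?nnegrE ?sqrtr_ge0// divr_ge0 ?sqrtr_ge0// ltW.
Qed.

(* Equality case of Cauchy-Schwarz: an almost maximizer of the l1 norm is almost constant in modulus. *)
Lemma nrmXn_const : nrmXn nrm (const_mx (S / n%:R)%:C : 'rV[C]_n) <= 1.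
Proof.
have S0 : 0 < S := id_norm1_gt0 n0.
have np : 0 < n%:R :> R by rewrite ltr0n.
pose E := nrmXn nrm (const_mx 1 : 'rV[C]_n); have E0 : 0 <= E by apply: (nrmXn_ge0 HX).
apply/ler_addgt0Pr => e e0.
(* t times the all-ones vector has norm at most e. By [sum_sqr_le] the squared deviations of the
   |z_i| from S / n sum to at most 2 (S / n) (S - T), where T is the l1 norm of z; the d below makes
   this at most t^2. *)
pose t := e / (E + 1); have E1 : 0 < E + 1 by rewrite ltr_wpDl.
have t0 : 0 < t by rewrite divr_gt0.
pose d := t ^+ 2 * n%:R / (2 * S).
have d0 : 0 < d by apply: divr_gt0; apply: mulr_gt0 => //; apply: exprn_gt0.
have [y [z z1 <-] yS] : exists2 y, [set \sum_(i < n) cabs (z 0 i) | z in [set z : 'rV[C]_n | nrmXn nrm z <= 1]] y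
    & S - d < y.
  apply: sup_adherent => //; split.
    by exists (\sum_(i < n) cabs ((0 : 'rV[C]_n) 0 i)); exists 0 => //=; rewrite (nrmXn0 HX).
  by exists S => _ [z z1 <-]; apply: sum_le_id_norm1.
set T := \sum_(i < n) _ in yS.
have var : \sum_i (cabs (z 0 i) - S / n%:R) ^+ 2 <= t ^+ 2.
  have -> : \sum_i (cabs (z 0 i) - S / n%:R) ^+ 2 =
      \sum_i cabs (z 0 i) ^+ 2 - 2 * (S / n%:R) * T + S ^+ 2 / n%:R.
    have -> : S ^+ 2 / n%:R = \sum_(i < n) (S / n%:R) ^+ 2.
      by rewrite sumr_const card_ord -mulr_natr; field; rewrite gt_eqF.
    by rewrite /T mulr_sumr -sumrB -big_split /=; apply: eq_bigr => i _; ring.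
  have h := sum_sqr_le z1.
  have : 2 * (S / n%:R) * (S - d) <= 2 * (S / n%:R) * T.
    by apply: ler_wpM2l; [rewrite mulr_ge0// divr_ge0// ltW|exact: ltW].
  have -> : 2 * (S / n%:R) * (S - d) = S ^+ 2 / n%:R + S ^+ 2 / n%:R - t ^+ 2.
    by rewrite /d; field; rewrite !gt_eqF.
  lra.
have near i : S / n%:R <= cabs (z 0 i) + t.
  have : (cabs (z 0 i) - S / n%:R) ^+ 2 <= t ^+ 2.
    by apply: le_trans var; rewrite (bigD1 i)//= lerDl sumr_ge0// => j _; exact: sqr_ge0.
  rewrite -ler_sqrt ?exprn_ge0 ?(ltW t0)// !sqrtr_sqr [`|t|]gtr0_norm// ler_norml => /andP[h _].
  by move: h; lra.
apply: (@le_trans _ _ (nrmXn nrm z + nrmXn nrm (t%:C *: const_mx 1 : 'rV[C]_n))).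
  apply: (nrmXn_tri HX) => i; rewrite !mxE mulr1 !cabsR gtr0_norm ?divr_gt0// gtr0_norm//.
apply: lerD => //; rewrite (nrmXnZ HX) cabsR gtr0_norm// -/E /t mulrAC ler_pdivrMr//.
by rewrite ler_wpM2l ?(ltW e0)// lerDl.
Qed.

(** The test function is the signed polynomial in the variables n z_i / S, which map the ball of X_n
    into the l2 ball of radius sqrt n. At r times the vector with coordinates k S / n each of its
    terms has modulus (k r)^m. The factor k < 1 is needed because [nrmXn_const] reaches only the
    closed ball. All multi-indices involved are square-free, hence in J. *)
Lemma bohr_upper (J : set (nat -> nat)) m (s : {ffun {set 'I_n} -> bool}) (B r : R) :
  @LambdaT `<=` J ->
  (forall z : 'I_n -> C, \sum_i cabs (z i) ^+ 2 <= n%:R -> cabs (spoly m s z) <= B) ->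
  0 < r ->
  (forall f : 'rV[C]_n -> C^o, HinfJ nrm J f ->
     (ereal_sup [set majorant J f z | z in rBX nrm n r] <= supB nrm f)%E) ->
  forall k, 0 < k < 1 -> 'C(n, m)%:R * (k * r) ^+ m <= B.
Proof.
move=> LJ sB r0 adm k /andP[k0 k1].
have S0 : 0 < S := id_norm1_gt0 n0.
have np : 0 < n%:R :> R by rewrite ltr0n.
pose e (A : {set 'I_n}) : {ffun 'I_n -> nat} := [ffun i => (i \in A) : nat].
pose q (A : {set 'I_n}) : C := if #|A| == m then (-1) ^+ s A * (n%:R / S)%:C ^+ m else 0.
pose f : 'rV[C]_n -> C^o := fun z => \sum_A q A * monomial z (e A).
have e_inj : injective e.
  move=> A B' /ffunP h; apply/setP => i; have := h i; rewrite !ffunE.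
  by case: (i \in A); case: (i \in B').
have monE (z : 'rV[C]_n) A : monomial z (e A) = \prod_(i in A) z 0 i.
  rewrite /monomial [RHS]big_mkcond; apply: eq_bigr => i _; rewrite ffunE.
  by case: (i \in A).
have fE (z : 'rV[C]_n) : f z = spoly m s (fun i => (n%:R / S)%:C * z 0 i).
  rewrite /f /spoly [RHS]big_mkcond; apply: eq_bigr => A _; rewrite monE /q.
  case: eqP => [Am|_]; last by rewrite mul0r.
  by rewrite big_split /= prodr_const Am mulrA.
have fB (z : 'rV[C]_n) : BX nrm n z -> cabs (f z) <= B.
  move=> z1; rewrite fE; apply: sB.
  have h := sum_sqr_le (ltW z1).
  under eq_bigr do rewrite cabsM exprMn cabsR gtr0_norm ?divr_gt0//.
  rewrite -mulr_sumr; apply: le_trans (ler_wpM2l (sqr_ge0 _) h) _.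
  by apply/eqW; field; rewrite !gt_eqF.
have tcE A : taylor_coef f (e A) = q A.
  rewrite taylor_coef_polynomial (bigD1 A)//= big1 ?addr0// => A' /andP[/eqP/e_inj -> /eqP//].
have tc0 a : ~ J (mi_ext a) -> taylor_coef f a = 0.
  move=> nJ; rewrite taylor_coef_polynomial big1// => A /eqP eA; case: nJ; apply: LJ; split.
    exists n => j nj; rewrite /mi_ext; case: insubP => // i; rewrite ltnNge => /negbTE.
    by rewrite nj.
  move=> j; rewrite /mi_ext; case: insubP => // i _ _; rewrite -eA ffunE.
  by case: (i \in A).
have Hf : HinfJ nrm J f.
  split=> //; last by exists B.
  by move=> z _; apply: differentiable_polynomial.
have supB_le : (supB nrm f <= B%:E)%E.
  by apply: ge_ereal_sup => _ [z zB <-]; rewrite lee_fin fB.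
pose w : 'rV[C]_n := const_mx (k * (S / n%:R))%:C.
have wB : BX nrm n w.
  rewrite /BX /=; have -> : w = k%:C *: const_mx (S / n%:R)%:C.
    by apply/rowP => i; rewrite !mxE rmorphM.
  rewrite (nrmXnZ HX) cabsR gtr0_norm// (le_lt_trans _ k1)//.
  by rewrite -[leRHS]mulr1 ler_wpM2l ?nrmXn_const// ltW.
rewrite -lee_fin; apply: le_trans supB_le; apply: le_trans (adm f Hf).
apply: (@le_trans _ _ (majorant J f (r%:C *: w))); last first.
  by apply: ereal_sup_ubound; exists (r%:C *: w) => //; exists w.
pose F a := cabs (taylor_coef f a * monomial (r%:C *: w) a).
have FE (A : {set 'I_n}) : #|A| == m -> F (e A) = (k * r) ^+ m.
  move=> Am; rewrite /F tcE monE /q Am !(cabsM, cabsX) cabsN cabs1 expr1n mul1r cabsR.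
  rewrite cabs_prod (eq_bigr (fun=> r * (k * (S / n%:R)))) => [|i _]; last first.
    have ks : 0 < k * (S / n%:R) by apply: mulr_gt0 => //; apply: divr_gt0.
    by rewrite !mxE cabsM !cabsR (gtr0_norm r0) (gtr0_norm ks).
  rewrite prodr_const (eqP Am) gtr0_norm ?divr_gt0// -exprMn; congr (_ ^+ _).
  by field; rewrite !gt_eqF.
pose D := [set A : {set 'I_n} | #|A| == m]%SET.
have -> : 'C(n, m)%:R * (k * r) ^+ m = \sum_(a <- [seq e A | A <- enum D]) F a.
  rewrite big_map big_enum /= (eq_bigr (fun=> (k * r) ^+ m)) => [|A]; last by rewrite inE => /FE.
  by rewrite sumr_const card_draws card_ord mulr_natl.
apply: sum_le_esum => [|a|a]; last 1 first.
- exact: cabs_ge0.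
- by rewrite map_inj_uniq ?enum_uniq.
case/mapP => A _ -> /=; apply: LJ; split.
  exists n => j nj; rewrite /mi_ext; case: insubP => // i; rewrite ltnNge => /negbTE.
  by rewrite nj.
by move=> j; rewrite /mi_ext; case: insubP => // i _ _; rewrite ffunE; case: (i \in A).
Qed.

End FixedDimension.

(** The majorant is a supremum of finite partial sums, so [bohr_lower], with M the supremum of |f|,
    shows that the left side is itself an admissible radius. The threshold is uniform in J. *)
Lemma bohr_radius_ge (e : R) : 0 < e < 1 -> exists n0, forall n J, (n0 <= n)%N ->
  (1 - e) * Num.sqrt (ln n%:R / n%:R) <= bohr_radius nrm J n.
Proof.
move=> e01; have /andP[e0 e1] := e01.
have [n1 BP] := bohr_polynomial e01.
have [n2 Hn2] := ln_large (1 : R).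
have [n3 Hn3] := sqr_ln_le R.
exists (maxn (maxn n1 n2) (maxn n3 1)) => n J; rewrite !geq_max => /andP[/andP[nn1 nn2] /andP[nn3 n0]].
have l1 := Hn2 n nn2; have l2 := Hn3 n nn3; set l := ln n%:R in l1 l2 *.
have np : 0 < n%:R :> R by rewrite ltr0n.
have l0 : 0 < l by lra.
have ln1 : l / n%:R < 1.
  have : l <= l ^+ 2 by rewrite expr2 ler_peMl// ltW.
  by rewrite ltr_pdivrMr// mul1r; lra.
have rho0 : 0 < Num.sqrt (l / n%:R) by rewrite sqrtr_gt0 divr_gt0.
have rho1 : Num.sqrt (l / n%:R) < 1 by rewrite -[ltRHS]sqrtr1 ltr_sqrt.
set r := (1 - e) * _.
have r0 : 0 < r by rewrite mulr_gt0// subr_gt0.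
have r1 : r < 1 by rewrite /r -[ltRHS]mul1r ltr_pM ?sqrtr_ge0 ?subr_ge0 ?(ltW e1)// ltrBlDr ltrDl.
apply: ub_le_sup; first by exists 1 => x /= [/andP[_ /ltW]].
split; first by rewrite r0.
move=> f [hol [M0 fM0] _].
have z0 : BX nrm n 0 by rewrite /BX /= (nrmXn0 HX).
have sE : supB nrm f = (fine (supB nrm f))%:E.
  rewrite fineK// fin_numElt; apply/andP; split.
    apply: lt_le_trans (ltNyr (cabs (f 0))) _.
    by apply: ereal_sup_ubound; exists 0.
  apply: le_lt_trans (ltry M0); apply: ge_ereal_sup => _ [z zB <-].
  by rewrite lee_fin fM0.
have fM z : BX nrm n z -> cabs (f z) <= fine (supB nrm f).
  by move=> zB; rewrite -lee_fin -sE; apply: ereal_sup_ubound; exists z.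
have M00 : 0 <= fine (supB nrm f) := le_trans (cabs_ge0 _) (fM _ z0).
apply: ge_ereal_sup => _ [_ [w wB <-] <-]; rewrite sE.
apply: esum_le => A uA.
exact: (bohr_lower HX (fun N c => BP n N c nn1) (ltW r0) M00 hol fM wB uA).
Qed.

Lemma bohr_radius_le (e : R) : 0 < e ->
  (forall n : nat, (0 < n)%N -> id_norm2 nrm n <= id_norm1 nrm n / Num.sqrt n%:R) ->
  exists n0, forall n J, (n0 <= n)%N -> LambdaT `<=` J ->
  bohr_radius nrm J n <= (1 + e) * Num.sqrt (ln n%:R / n%:R).
Proof.
move=> e0 H2; have [n1 Hn1] := random_polynomial_radius e0.
exists (maxn n1 1) => n J; rewrite geq_max => /andP[nn1 n0] LJ.
have [m [s [B [sB Hr]]]] := Hn1 n nn1; set T := (1 + e) * _ in Hr *.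
have T0 : 0 <= T by rewrite mulr_ge0 ?sqrtr_ge0// addr_ge0// ltW.
(* If no radius is admissible, [sup] takes the value 0, which is at most T. *)
rewrite /bohr_radius; set A := [set r | _]; have [->|/set0P ne] := eqVneq A set0; first by rewrite sup0.
apply: sup_le_ub => // r [/andP[r0 r1] adm].
rewrite leNgt; apply/negP => Tr.
(* Puts k r halfway between T and r: still above T, yet with k < 1 as [bohr_upper] requires. *)
pose k := (T + r) / (2 * r).
have kr : k * r = (T + r) / 2 by rewrite /k; field; rewrite gt_eqF.
have r20 : 0 < 2 * r by rewrite mulr_gt0.
have k01 : 0 < k < 1.
  by rewrite divr_gt0//= ?ltr_pwDr// ltr_pdivrMr// mul1r; lra.
have h := bohr_upper n0 (H2 n n0) LJ sB r0 adm k01.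
have kr0 : 0 <= k * r by rewrite kr divr_ge0// addr_ge0// ltW.
by have := Hr _ kr0 h; rewrite kr; lra.
Qed.

End BohrRadius.

Theorem theorem2p34 (R : realType) (X : set (cseq R)) (nrm : cseq R -> R) :
  banach_seq_lattice X nrm ->
  (exists C : R, forall n : nat, (0 < n)%N ->
     ((phiX nrm n)%:E * phiXd X nrm n <= (C * n%:R)%:E)%E) ->
  (forall n : nat, (0 < n)%N ->
     id_norm2 nrm n <= id_norm1 nrm n / Num.sqrt n%:R) ->
  forall J : set (nat -> nat), index_set J -> LambdaT `<=` J ->
  (fun n : nat => bohr_radius nrm J n / Num.sqrt (ln n%:R / n%:R)) @ \oo --> (1 : R).
Proof.
move=> HX _ H2 J _ LJ; apply/cvgrPdist_le => eps eps0.
(* Capped because the lower bound requires e < 1. *)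
pose e := Num.min eps (1 / 2).
have e0 : 0 < e by rewrite lt_min eps0/= divr_gt0.
have e12 : e <= 1 / 2 by rewrite ge_min lexx orbT.
have ee : e <= eps by rewrite ge_min lexx.
have e01 : 0 < e < 1 by rewrite e0/=; lra.
have [n1 H1] := bohr_radius_ge HX e01.
have [n2 H2'] := bohr_radius_le HX e0 H2.
have [n3 H3] := ln_large (1 : R).
exists (maxn (maxn n1 n2) (maxn n3 1)) => // n /=; rewrite !geq_max.
move=> /andP[/andP[nn1 nn2] /andP[nn3 n0]].
have h1 := H1 n J nn1; have h2 := H2' n J nn2 LJ; have l1 := H3 n nn3.
have rho0 : 0 < Num.sqrt (ln n%:R / n%:R) :> R.
  by rewrite sqrtr_gt0 divr_gt0 ?ltr0n//; lra.
move: (Num.sqrt _) rho0 h1 h2 => rho rho0 h1 h2.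
rewrite ler_norml.
have : 1 - e <= bohr_radius nrm J n / rho by rewrite ler_pdivlMr.
have : bohr_radius nrm J n / rho <= 1 + e by rewrite ler_pdivrMr.
by move=> ? ?; apply/andP; split; lra.
Qed.
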